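(* For every $n\ge 3$, the extension complexity of a generic (even rational) $n$-gon is at least $2\sqrt{2n-2}-1$.
   Context: The extension complexity $\mathrm{xc}(P)$ of a polytope $P$ is the minimal number of facets of a polytope $Q$ (of any dimension) that can be mapped onto $P$ by an affine (linear) projection. An $n$-gon is a $2$-dimensional convex polytope with exactly $n$ vertices. The space of $n$-gons is the semi-algebraic set $\mathcal{R}_n$ of matrices $A\in\mathbb{R}^{n\times 2}$ such that $P_A=\{x\in\mathbb{R}^2:Ax\le\mathbf{1}\}$ is an $n$-gon, with $\mathbf{1}$ the all-ones vector (these are the $n$-gons with labeled edges containing the origin in their interior; this is no restriction since extension complexity is invariant under translations); it has dimension $2n$. ''A generic $n$-gon has extension complexity at least $b$'' means that the set of $n$-gons in $\mathcal{R}_n$ with $\mathrm{xc}\ge b$ is a full-dimensional dense semi-algebraic subset of $\mathcal{R}_n$, and that an $n$-gon drawn randomly from a continuous probability distribution on $\mathcal{R}_n$ almost surely has $\mathrm{xc}\ge b$. ''Even rational'' means that, in addition, arbitrarily close (in Hausdorff distance) to any $n$-gon there is an $n$-gon with rational coordinates and $\mathrm{xc}\ge b$. *)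

(* Defs.v *)
From HB Require Import structures.
From mathcomp Require Import all_boot all_order all_algebra.
From mathcomp Require Import all_classical all_reals all_analysis.
From mathcomp Require mpoly. (* not imported: its notations clash with analysis *)

Set Implicit Arguments.
Unset Strict Implicit.
Unset Printing Implicit Defensive.

Import Order.TTheory GRing.Theory Num.Theory.
Import numFieldNormedType.Exports.

Local Open Scope classical_set_scope.
Local Open Scope ring_scope.

Section Polytopes.
Context {R : realType}.

Definition conv_hull d k (v : 'I_k -> 'cV[R]_d) : set 'cV[R]_d :=
  [set x | exists w : 'I_k -> R,
     [/\ forall i, 0 <= w i, \sum_i w i = 1 & x = \sum_i w i *: v i]].

Definition polytope d (P : set 'cV[R]_d) : Prop :=
  exists k (v : 'I_k -> 'cV[R]_d), P = conv_hull v.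

Definition aff_indep d k (v : 'I_k -> 'cV[R]_d) : Prop :=
  forall l : 'I_k -> R,
    \sum_i l i = 0 -> \sum_i l i *: v i = 0 -> forall i, l i = 0.

(* The dimension of the affine hull of S, with affdim set0 = -1. The bound in
   the maximum is harmless: affinely independent families in R^d have at most
   d + 1 members. *)
Definition affdim d (S : set 'cV[R]_d) : int :=
  Posz (\max_(k < d.+2 | `[< exists v : 'I_k -> 'cV[R]_d,
                            (forall i, S (v i)) /\ aff_indep v >]) k) - 1.

(* The inequality c x <= delta may be trivial (c = 0), so that P and the empty
   set are faces of P. *)
Definition face d (P F : set 'cV[R]_d) : Prop :=
  exists (c : 'rV[R]_d) (delta : R),
    (forall x, P x -> (c *m x) 0 0 <= delta) /\
    F = [set x | P x /\ (c *m x) 0 0 = delta].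

Definition facets d (P : set 'cV[R]_d) : set (set 'cV[R]_d) :=
  [set F | face P F /\ affdim F = affdim P - 1].

Definition vertices d (P : set 'cV[R]_d) : set 'cV[R]_d :=
  [set x | face P [set x]].

(* P is the image under an affine map of a polytope, of any dimension and in a
   space of any dimension, having exactly k facets. *)
Definition extension_of_size m (P : set 'cV[R]_m) (k : nat) : Prop :=
  exists d (Q : set 'cV[R]_d) (M : 'M[R]_(m, d)) (t : 'cV[R]_m),
    [/\ polytope Q, P = [set M *m x + t | x in Q] & (facets Q #= `I_k)%card].

(* The default value 0 is irrelevant: a polytope is an extension of itself and
   has finitely many facets. *)
Definition xc m (P : set 'cV[R]_m) : nat :=
  match pselect (exists k, `[< extension_of_size P k >]) with
  | left ex => ex_minn ex
  | right _ => 0%N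
  end.

Definition ngon n (P : set 'cV[R]_2) : Prop :=
  [/\ polytope P, affdim P = 2 & (vertices P #= `I_n)%card].

Definition poly_of n (A : 'M[R]_(n, 2)) : set 'cV[R]_2 :=
  [set x | forall i, (A *m x) i 0 <= 1].

Definition ngon_space n : set 'M[R]_(n, 2) := [set A | ngon n (poly_of A)].

Definition rational_coords (P : set 'cV[R]_2) : Prop :=
  forall x, vertices P x -> forall i, exists q : rat, x i 0 = ratr q.

Definition eucl_dist d (x y : 'cV[R]_d) : R :=
  Num.sqrt (\sum_i (x i 0 - y i 0) ^+ 2).

Definition dist_to_set d (x : 'cV[R]_d) (B : set 'cV[R]_d) : \bar R :=
  ereal_inf [set (eucl_dist x y)%:E | y in B].

Definition hausdorff_dist d (A B : set 'cV[R]_d) : \bar R :=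
  maxe (ereal_sup [set dist_to_set x B | x in A])
       (ereal_sup [set dist_to_set y A | y in B]).

End Polytopes.

Arguments ngon_space {R} n.

Section Genericity.
Context {R : realType}.

Definition eval_mx m k (p : mpoly.mpoly (m * k) R) (A : 'M[R]_(m, k)) : R :=
  mpoly.meval (fun i => mxvec A 0 i) p.

(* The Boolean algebra of sets generated by the sets {p > 0}, p a polynomial in
   the entries of the matrix. *)
Inductive semialgebraic m k : set 'M[R]_(m, k) -> Prop :=
| semialgebraic_pos (p : mpoly.mpoly (m * k) R) :
    semialgebraic [set A | 0 < eval_mx p A]
| semialgebraic_setC S : semialgebraic S -> semialgebraic (~` S)
| semialgebraic_setI S T :
    semialgebraic S -> semialgebraic T -> semialgebraic (S `&` T).

(* Matrices with the Borel sigma-algebra. *)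
Definition borel_mx m k := g_sigma_algebraType (@open 'M[R]_(m, k)).

Definition box m k (a b : 'M[R]_(m, k)) : set 'M[R]_(m, k) :=
  [set A | forall i j, a i j <= A i j <= b i j].

Definition box_volume m k (a b : 'M[R]_(m, k)) : R :=
  \prod_i \prod_j (b i j - a i j).

(* The (m * k)-dimensional Lebesgue outer measure, which extends the Lebesgue
   measure on Borel sets. *)
Definition lebesgue_outer m k (N : set 'M[R]_(m, k)) : \bar R :=
  ereal_inf [set v | exists a b : nat -> 'M[R]_(m, k),
    [/\ forall l i j, a l i j <= b l i j,
        N `<=` \bigcup_l box (a l) (b l) &
        v = (\sum_(0 <= l <oo) (box_volume (a l) (b l))%:E)%E]].

Definition absolutely_continuous m k (mu : probability (borel_mx m k) R) : Prop :=
  forall N : set (borel_mx m k),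
    measurable N -> lebesgue_outer N = 0%E -> mu N = 0%E.

Definition ngons_xc_ge (n : nat) (b : R) : set 'M[R]_(n, 2) :=
  [set A | ngon_space n A /\ b <= (xc (poly_of A))%:R].
Arguments ngons_xc_ge n b : clear implicits.

(* In R^(n x 2), where the space of n-gons has dimension 2n, being
   full-dimensional means having nonempty interior. *)
Definition generic_ngon_xc_ge (n : nat) (b : R) : Prop :=
  [/\ semialgebraic (ngons_xc_ge n b),
      (ngons_xc_ge n b)^° !=set0,
      ngon_space n `<=` closure (ngons_xc_ge n b) &
      forall mu : probability (borel_mx n 2) R,
        absolutely_continuous mu ->
        {ae mu, forall A, ngon_space n (A : 'M[R]_(n, 2))} ->
        {ae mu, forall A, b <= (xc (poly_of (A : 'M[R]_(n, 2))))%:R}].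

Definition rational_ngon_xc_ge (n : nat) (b : R) : Prop :=
  forall P : set 'cV[R]_2, ngon n P -> forall eps : R, 0 < eps ->
    exists Q : set 'cV[R]_2,
      [/\ ngon n Q, rational_coords Q,
          (hausdorff_dist P Q < eps%:E)%E & b <= (xc Q)%:R].

End Genericity.

(* Main.v *)
(* Let a polygon be the affine image of a polytope with k facets, and let S be
   the matrix of the slacks of these facets at the points spanning the polytope.
   In homogeneous coordinates every vertex of the polygon is, up to a scalar, the
   image under a fixed matrix K of a support-minimal nonnegative vector of the
   column space of S. Such a vector is determined by its zeros, so that Cramer's
   rule writes it as a rational function of a basis of the column space. Once
   basis and K are normalised by scalings, all vertices are rational functions of
   cr + 2(1 + r) parameters, where 1 + r + c = k; these are fewer than 2n as soon
   as (k + 1) ^ 2 < 4 (2n - 2). Hence the 2n coordinates of the vertices of an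
   n-gon with small extension complexity satisfy one of finitely many fixed
   nontrivial polynomial equations, and so do the coefficients of its edges,
   which are cross products of vertices. The zero set of a nonzero polynomial is
   closed and negligible, and its complement contains rational points near every
   point. Semialgebraicity follows from the Tarski-Seidenberg theorem, applied
   to Yannakakis' description of extensions by nonnegative factorizations of
   the slack matrix. *)

(* The obstacle is that the polynomial equations must be fixed before the polygon is given, while an
   extension may live in any dimension and be degenerate. Once the extension is replaced by the
   column space of [S] and by [K], only finite data remain beside the real parameters: the sizes [r]
   and [c], two zero patterns, and for each vertex the Cramer system that it solves. Each choice of
   these data gives one rational family. Scaling columns of [K] and rows of the basis leaves the
   vertices unchanged and fixes one row of [K] and one column of the basis, which gives the count cr
   + 2(1 + r). By the inequality of means r(c + 2) <= (r + c + 2)^2 / 4 = (k + 1)^2 / 4, so the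
   count is at most (k + 1)^2 / 4 + 2; this is the origin of the 2n - 2 under the root. Vertices and
   edges are treated separately, because rationality concerns the vertices while the space of n-gons
   is parametrised by the edges. Dimension theory is replaced by counting monomials. Rational
   nonroots and nullity of zero sets both come from restricting a polynomial to the curve t ->
   (t^(B^j))_j. *)
Require Import Defs.
From mathcomp Require Import all_boot all_order all_algebra.
From mathcomp Require Import all_classical all_reals all_analysis.
From mathcomp Require mpoly.
Import -(notations) mpoly.
From mathcomp Require ordered_qelim qe_rcf.
From mathcomp Require Import ring lra zify.
Set Implicit Arguments.
Unset Strict Implicit.
Unset Printing Implicit Defensive.
Import Order.TTheory GRing.Theory Num.Theory.
Import numFieldNormedType.Exports.
Local Open Scope ring_scope.

(** * Nonnegative vectors of minimal support *)

Section MinimalSupport.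
Context {R : realFieldType}.

Definition supp k (y : 'cV[R]_k) : {set 'I_k} := [set j | y j 0 != 0].

Definition nneg k (y : 'cV[R]_k) : Prop := forall j, 0 <= y j 0.

Definition subsp k (U : 'cV[R]_k -> Prop) : Prop :=
  U 0 /\ forall a x y, U x -> U y -> U (a *: x + y).

(** These vectors span the extreme rays of the cone of nonnegative vectors of [U]. Up to a scalar
    each is determined by its support, so there are finitely many rays. *)
Definition minsup k (U : 'cV[R]_k -> Prop) (y : 'cV[R]_k) : Prop :=
  [/\ U y, nneg y, y != 0 &
      forall y', U y' -> supp y' \subset supp y -> exists a, y' = a *: y].

Lemma subspZ k (U : 'cV[R]_k -> Prop) a x : subsp U -> U x -> U (a *: x).
Proof. by case=> U0 Ulin Ux; rewrite -[_ *: _]addr0; exact: Ulin. Qed.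

Lemma subspB k (U : 'cV[R]_k -> Prop) a x y :
  subsp U -> U x -> U y -> U (y - a *: x).
Proof. by case=> U0 Ulin Ux Uy; rewrite addrC -scaleNr; exact: Ulin. Qed.

Lemma supp0P k (y : 'cV[R]_k) j : (j \notin supp y) = (y j 0 == 0).
Proof. by rewrite inE negbK. Qed.

Lemma col_neq0 k (y : 'cV[R]_k) : y != 0 -> exists j, y j 0 != 0.
Proof.
move=> yN0; apply/existsP; apply: contraNT yN0; rewrite negb_exists => /forallP h.
by apply/eqP/matrixP => i j; rewrite ord1 mxE; apply/eqP; rewrite -[_ == _]negbK.
Qed.

(** The factor is the least ratio y_j / z_j over the positive z_j. It is the largest factor that
    keeps nonnegativity, and the minimising coordinate leaves the support. *)
Lemma peel_support k (y z : 'cV[R]_k) j0 :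
  nneg y -> supp z \subset supp y -> 0 < z j0 0 ->
  exists t, [/\ 0 <= t, nneg (y - t *: z) & supp (y - t *: z) \proper supp y].
Proof.
move=> y_ge0 szy zj0.
case: (@arg_minP _ _ _ j0 (fun j => 0 < z j 0) (fun j => y j 0 / z j 0) zj0) => i zi imin.
have t_ge0 : 0 <= y i 0 / z i 0 by rewrite divr_ge0 // ltW.
exists (y i 0 / z i 0); split => //.
- move=> j; rewrite !mxE subr_ge0; case: (ltrP 0 (z j 0)) => zj.
    by rewrite -ler_pdivlMr //; exact: imin.
  by apply: le_trans (y_ge0 j); rewrite mulr_ge0_le0.
- apply/fintype.properP; split.
    apply/fintype.subsetP => j; rewrite !inE !mxE; apply: contraNneq => yj.
    have /eqP -> : z j 0 == 0.
      by rewrite -supp0P; apply: contra (fintype.subsetP szy j) _; rewrite supp0P yj.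
    by rewrite yj mulr0 subr0.
  exists i; first by apply: (fintype.subsetP szy); rewrite inE gt_eqF.
  by rewrite supp0P !mxE divfK ?subrr // gt_eqF.
Qed.

(** Induction on the size of the support. If [y] is not minimal, peeling off a vector that is not
    proportional to it leaves a nonzero [z] of smaller support; peeling [z] off [y] in turn splits
    [y] into two vectors of smaller support. *)
Lemma min_decomp k (U : 'cV[R]_k -> Prop) y :
  subsp U -> U y -> nneg y ->
  exists2 es : seq 'cV[R]_k, (forall e, e \in es -> minsup U e) &
    y = \sum_(e <- es) e.
Proof.
move=> hU; have [s] := ubnP #|supp y|; elim: s y => // s IH y /ltnSE ys Uy y_ge0.
have [->|yN0] := eqVneq y 0; first by exists [::]; rewrite ?big_nil.
have [my|nmy] := pselect (minsup U y).
  by exists [:: y]; [move=> e; rewrite inE => /eqP -> | rewrite big_seq1].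
have [y' [Uy' sy' ny']] : exists y', [/\ U y', supp y' \subset supp y &
    forall a, y' <> a *: y].
  apply: contrapT => h; apply: nmy; split => // y' Uy' sy'.
  apply: contrapT => h'; apply: h; exists y'; split => // a e.
  by apply: h'; exists a.
have [z [Uz z_ge0 zN0 szy]] : exists z, [/\ U z, nneg z, z != 0 & supp z \proper supp y].
  have y'N0 : y' != 0 by apply/eqP => h; apply: (ny' 0); rewrite scale0r.
  have [j0 hj0] := col_neq0 y'N0.
  (* Up to its sign [y'] has a positive coordinate, as peeling requires. *)
  have [w [c [ew Uw sw wj0]]] : exists w c,
      [/\ w = c *: y', U w, supp w \subset supp y & 0 < w j0 0].
    have [h|h] := ltrP 0 (y' j0 0); first by exists y', 1; rewrite scale1r.
    exists ((-1) *: y'), (-1); split => //; first exact: subspZ.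
      apply: fintype.subset_trans sy'; apply/fintype.subsetP => j; rewrite !inE !mxE.
      by rewrite mulN1r oppr_eq0.
    by rewrite mxE mulN1r oppr_gt0 lt_neqAle hj0.
  have [t [t_ge0 h1 h2]] := peel_support y_ge0 sw wj0.
  exists (y - t *: w); split => //; first exact: subspB.
  apply/eqP => /subr0_eq e; have tN0 : t != 0.
    by apply: contraNneq yN0 => t0; rewrite e t0 scale0r.
  have cN0 : c != 0.
    by apply: contraNneq yN0 => t0; rewrite e ew t0 scale0r scaler0.
  apply: (ny' ((t * c)^-1)); rewrite [in RHS]e ew !scalerA -mulrA mulVf ?scale1r //.
  by rewrite mulf_neq0.
have [j zj] := col_neq0 zN0.
have zj_gt0 : 0 < z j 0 by rewrite lt_neqAle eq_sym zj z_ge0.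
have [t [t_ge0 h1 h2]] := peel_support y_ge0 (proper_sub szy) zj_gt0.
have [|es1 m1 e1] := IH (y - t *: z) _ (subspB _ hU Uz Uy) h1.
  exact: leq_trans (proper_card h2) ys.
have [||es2 m2 e2] := IH (t *: z) _ (subspZ _ hU Uz).
- apply: leq_ltn_trans (subset_leq_card _) (leq_trans (proper_card szy) ys).
  apply/fintype.subsetP => i; rewrite !inE mxE; apply: contraNneq => ->; by rewrite mulr0.
- by move=> i; rewrite mxE mulr_ge0.
exists (es1 ++ es2); last by rewrite big_cat -e1 -e2 /= subrK.
by move=> e; rewrite mem_cat => /orP[/m1|/m2].
Qed.

End MinimalSupport.

(** * Algebraic dependence of rational functions *)

Section Elimination.
Context {R : realFieldType}.

Definition mnm_of N D (a : {ffun 'I_N -> 'I_D}) : multinom N :=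
  Multinom (mktuple (fun i => a i : nat)).

Lemma mnm_ofE N D (a : {ffun 'I_N -> 'I_D}) i : mnm_of a i = a i :> nat.
Proof. exact: mnmE. Qed.

Lemma mnm_of_inj N D : injective (@mnm_of N D).
Proof.
move=> a b /mnmP e; apply/ffunP => i; apply: val_inj => /=.
by rewrite -!mnm_ofE e.
Qed.

Lemma mnm_of_surj N D (m : multinom N) : (mdeg m < D)%N ->
  exists a : {ffun 'I_N -> 'I_D}, m = mnm_of a.
Proof.
move=> mD; have lt i : (m i < D)%N.
  by apply: leq_ltn_trans mD; rewrite mdegE (bigD1 i) //= leq_addr.
by exists [ffun i => Ordinal (lt i)]; apply/mnmP => i; rewrite mnm_ofE ffunE.
Qed.

Lemma msizeM_leq N (p q : mpoly N R) a b :
  (msize p <= a.+1)%N -> (msize q <= b.+1)%N -> (msize (p * q) <= (a + b).+1)%N.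
Proof.
have [->|p0] := eqVneq p 0; first by rewrite mul0r mmeasure0.
have [->|q0] := eqVneq q 0; first by rewrite mulr0 mmeasure0.
rewrite msizeM //; move: (mmeasure _ p) (mmeasure _ q) => x y; lia.
Qed.

Lemma msizeX_leq N (p : mpoly N R) a e :
  (msize p <= a.+1)%N -> (msize (p ^+ e) <= (e * a).+1)%N.
Proof.
move=> pa; elim: e => [|e IH]; first by rewrite expr0 msize1.
by rewrite exprS mulSn; exact: msizeM_leq.
Qed.

Lemma msize_prod_leq N (I : finType) (p : I -> mpoly N R) a :
  (forall i, msize (p i) <= a.+1)%N -> (msize (\prod_i p i) <= (#|I| * a).+1)%N.
Proof.
move=> pa; rewrite -sum_nat_const.
elim/big_ind2: _ => [|q b q' b' |i _]; [by rewrite msize1 | exact: msizeM_leq | exact: pa].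
Qed.

(** All monomials of degree below [D] have their exponents in ['I_D], so the [H i] live in a space
    of dimension at most [D ^ N]; a left kernel vector of the matrix of coefficients is the
    relation. *)
Lemma linear_relation N (I : finType) (H : I -> mpoly N R) D :
  (forall i, msize (H i) <= D)%N -> (D ^ N < #|I|)%N ->
  exists2 u : I -> R, (exists i, u i != 0) & \sum_i u i *: H i = 0.
Proof.
move=> HD cardI.
pose B := {ffun 'I_N -> 'I_D}.
pose C : 'M[R]_(#|I|, #|{: B}|) :=
  \matrix_(i, j) mcoeff (mnm_of (enum_val j)) (H (enum_val i)).
have : kermx C != 0.
  rewrite kermx_eq0 /row_free neq_ltn; apply/orP; left.
  apply: leq_ltn_trans (rank_leq_col C) _.
  by rewrite card_ffun !card_ord.
case/rowV0Pn => u /sub_kermxP uC uN0.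
exists (fun i => u 0 (enum_rank i)).
  apply/existsP; apply: contraNT uN0; rewrite negb_exists => /forallP h.
  apply/eqP/matrixP => i j; rewrite ord1 mxE; apply/eqP.
  by have := h (enum_val j); rewrite negbK enum_valK.
apply/mpolyP => m; rewrite mcoeff0 raddf_sum /=.
have [mD|Dm] := ltnP (mdeg m) D; last first.
  rewrite big1 // => i _; rewrite mcoeffZ.
  have := msize_mdeg_ge (leq_trans (HD i) Dm).
  by rewrite -mcoeff_eq0 => /eqP ->; rewrite mulr0.
have [a ->] := mnm_of_surj mD.
have := congr1 (fun M : 'rV_#|{: B}| => M 0 (enum_rank a)) uC.
rewrite !mxE => C0; rewrite -[RHS]C0 [LHS](reindex (fun k : 'I_#|I| => enum_val k)) /=; last first.
  by exists enum_rank => ? _; rewrite (enum_rankK, enum_valK).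
by apply: eq_bigr => i _; rewrite mcoeffZ !mxE enum_rankK enum_valK.
Qed.

(* At most [N] parameters cannot fill a space of dimension [M > N]: the
   [(D + 1) ^ M] monomials of degree [<= D] in each of the [M] fractions live,
   after clearing denominators, in a space of dimension [O(D ^ N)]. *)
Lemma rational_image_relation N M (F G : 'I_M -> mpoly N R) : (N < M)%N ->
  exists2 P : mpoly M R, P != 0 & forall th z,
    (forall i, meval th (G i) != 0 /\ z i * meval th (G i) = meval th (F i)) ->
    meval z P = 0.
Proof.
move=> NM.
pose E := (\max_i maxn (msize (F i)) (msize (G i)))%N.
have FE i : (msize (F i) <= E.+1)%N.
  apply: leqW; apply: leq_trans (leq_bigmax i); exact: leq_maxl.
have GE i : (msize (G i) <= E.+1)%N.
  apply: leqW; apply: leq_trans (leq_bigmax i); exact: leq_maxr.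
(* This choice makes the count work: (M D E + 1)^N <= ((M E + 1)(D + 1))^N = D (D + 1)^N < (D +
   1)^(N + 1) <= (D + 1)^M. *)
pose D := ((M * E + 1) ^ N)%N.
pose A := {ffun 'I_M -> 'I_D.+1}.
pose H (a : A) := \prod_i (F i ^+ a i * G i ^+ (D - a i)).
have HD a : (msize (H a) <= (M * (D * E)).+1)%N.
  have := @msize_prod_leq _ _ (fun i => F i ^+ a i * G i ^+ (D - a i)) (D * E).
  rewrite card_ord; apply => i.
  have -> : (D * E = a i * E + (D - a i) * E)%N.
    by rewrite -mulnDl subnKC // -ltnS.
  by apply: msizeM_leq; exact: msizeX_leq.
have [|u [a0 ua0] Hu] := linear_relation HD.
  rewrite card_ffun !card_ord.
  apply: (@leq_ltn_trans (((M * E + 1) * D.+1) ^ N)%N).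
    by case: (N) => // N'; rewrite leq_exp2r //; nia.
  rewrite expnMn -/D; apply: (@leq_trans (D.+1 ^ N.+1)%N).
    by rewrite expnS ltn_pmul2r // expn_gt0.
  by apply: leq_pexp2l.
exists (\sum_a u a *: mpolyX R (mnm_of a)).
  apply: contra ua0 => /eqP/(congr1 (mcoeff (mnm_of a0))).
  rewrite mcoeff0 raddf_sum /= (bigD1 a0) //= big1 ?addr0 => [|a aa0].
    by rewrite mcoeffZ mcoeffX eqxx mulr1 => ->.
  by rewrite mcoeffZ mcoeffX (inj_eq (@mnm_of_inj _ _)) (negbTE aa0) mulr0.
move=> th z hth.
have GN0 : \prod_i meval th (G i) ^+ D != 0.
  by apply/prodf_neq0 => i _; rewrite expf_neq0 //; have [] := hth i.
apply/(mulIf GN0); rewrite mul0r raddf_sum /= mulr_suml.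
rewrite -[RHS](meval0 th) -Hu raddf_sum /=; apply: eq_bigr => a _.
rewrite !mevalZ mevalX -mulrA; congr (_ * _).
rewrite -big_split /= rmorph_prod /=; apply: eq_bigr => i _.
rewrite rmorphM !rmorphXn /= mnm_ofE; have [_ <-] := hth i.
by rewrite exprMn -mulrA -exprD subnKC // -ltnS.
Qed.

End Elimination.

(** * Kronecker substitution *)

Section Curve.
Context {R : realFieldType}.

Lemma digits_inj N B (a b : nat -> nat) :
  (forall i, a i < B)%N -> (forall i, b i < B)%N ->
  (\sum_(i < N) a i * B ^ i = \sum_(i < N) b i * B ^ i)%N ->
  forall i, (i < N)%N -> a i = b i.
Proof.
elim: N a b => // N IH a b aB bB; rewrite !big_ord_recl /= !expn0 !muln1.
have shift (c : nat -> nat) :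
    (\sum_(i < N) c (bump 0 i) * B ^ bump 0 i = B * \sum_(i < N) c i.+1 * B ^ i)%N.
  rewrite big_distrr /=; apply: eq_bigr => i _.
  by rewrite /bump leq0n add1n expnS mulnCA.
rewrite !shift => e.
have B0 : (0 < B)%N by apply: leq_ltn_trans (aB 0%N).
have e0 : a 0%N = b 0%N.
  have := congr1 (modn^~ B) e.
  by rewrite !(addnC (_ 0%N)) ![(B * _)%N]mulnC !modnMDl !modn_small.
case=> [|i] // iN; apply: (IH (a \o succn) (b \o succn)) => //=.
by move: e; rewrite e0 => /addnI /eqP; rewrite eqn_pmul2l // => /eqP.
Qed.

(** With [B] above all exponents of [P], the monomial m becomes a monic polynomial in t of degree
    sum m_j B^j. By uniqueness of base [B] digits these degrees are distinct, so the largest one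
    survives in the sum. Neither [B] nor the degree bound depends on the base point [x]; the
    counting of grid translates relies on this. *)
Lemma curve_poly N (P : mpoly N R) : P != 0 ->
  exists B D : nat, (0 < B)%N /\ forall x : 'I_N -> R, exists q : {poly R},
    [/\ q != 0, (size q <= D)%N &
        forall t, q.[t] = meval (fun j => x j + t ^+ (B ^ j)) P].
Proof.
move=> PN0; set B := msize P.
have B0 : (0 < B)%N by rewrite lt0n mmeasure_poly_eq0.
have mB m j : m \in msupp P -> (m j < B)%N.
  by move/msize_mdeg_lt; apply: leq_ltn_trans; rewrite mdegE (bigD1 j) //= leq_addr.
pose w (m : multinom N) := (\sum_(j < N) m j * B ^ j)%N.
have w_inj m m' : m \in msupp P -> m' \in msupp P -> w m = w m' -> m = m'.
  move=> mP mP' e; apply/mnmP => j.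
  pose d (m0 : multinom N) i := if insub i is Some j then m0 j else 0%N.
  have dE m0 (i : 'I_N) : d m0 i = m0 i by rewrite /d valK.
  have dB m0 : m0 \in msupp P -> forall i, (d m0 i < B)%N.
    by move=> h i; rewrite /d; case: insubP => [u _ _|_]; [exact: mB | exact: B0].
  rewrite -!dE; apply: (@digits_inj N B (d m) (d m')) => //; try exact: dB.
  by under eq_bigr do rewrite dE; under [RHS]eq_bigr do rewrite dE.
exists B, (\max_(m <- msupp P) w m).+1%N; split=> // x.
pose T (m : multinom N) : {poly R} := \prod_(j < N) ('X^(B ^ j) + (x j)%:P) ^+ m j.
have Bj j : (0 < B ^ j)%N by rewrite expn_gt0 B0.
have TP m : T m \is monic /\ size (T m) = (w m).+1.
  rewrite /T /w; elim/big_ind2: _ => [|p a q b [pm ps] [qm qs]|j _].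
  - by rewrite monic1 size_poly1.
  - by rewrite monicMl // qm size_Mmonic ?monic_neq0 // ps qs addnS.
  - split; first by rewrite monic_exp // monicXnaddC.
    have h1 : 'X^(B ^ j) + (x j)%:P \is monic by rewrite monicXnaddC.
    elim: (m j) => [|e IH]; first by rewrite expr0 size_poly1.
    rewrite exprS size_Mmonic ?monic_neq0 ?monic_exp // IH size_XnaddC //.
    by rewrite addnS mulSn.
exists (\sum_(m <- msupp P) mcoeff m P *: T m); split.
- have [m0 m0P m0max] : exists2 m0, m0 \in msupp P &
      forall m, m \in msupp P -> (w m <= w m0)%N.
    have : msupp P != [::] by rewrite msupp_eq0.
    case E : (msupp P) => [//|m1 s] _.
    have : (exists2 m0, m0 \in m1 :: s & forall m, m \in m1 :: s -> (w m <= w m0)%N).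
      elim: s m1 {E} => [|m2 s IH] m1.
        by exists m1; rewrite ?inE // => m; rewrite inE => /eqP ->.
      have [m0 m0s h] := IH m2.
      have [le|lt] := leqP (w m1) (w m0).
        exists m0; first by rewrite inE m0s orbT.
        by move=> m; rewrite inE => /orP[/eqP -> //|/h].
      exists m1; first exact: mem_head.
      move=> m; rewrite inE => /orP[/eqP -> //|/h]; move/leq_trans; apply; exact: ltnW.
    by [].
  apply/eqP => /(congr1 (fun p : {poly R} => p`_(w m0))).
  rewrite coef0 coef_sum (bigD1_seq m0) ?msupp_uniq //= big1_seq.
    rewrite coefZ addr0; have [/monicP Tm sT] := TP m0.
    move: Tm; rewrite lead_coefE sT /= => ->.
    by move/eqP; rewrite mulr1 mcoeff_eq0 m0P.
  move=> m /andP[mm0 mP]; rewrite coefZ nth_default ?mulr0 //.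
  have [_ ->] := TP m; rewrite ltn_neqAle m0max // andbT.
  by apply: contra mm0 => /eqP/w_inj ->.
- apply: leq_trans (size_sum _ _ _) _; apply/bigmax_leqP_seq => m mP _.
  apply: leq_trans (size_scale_leq _ _) _; have [_ ->] := TP m.
  by rewrite ltnS; exact: (leq_bigmax_seq _ mP).
- move=> t; rewrite mevalE horner_sum; apply: eq_bigr => m _.
  rewrite hornerZ horner_prod; congr (_ * _); apply: eq_bigr => j _.
  by rewrite horner_exp !hornerE addrC.
Qed.

End Curve.

(** * Facets and their slacks *)

Section Facets.
Context {R : realType}.
Local Open Scope classical_set_scope.

Definition hom d (x : 'cV[R]_d) : 'cV[R]_(d + 1) := col_mx x (const_mx 1).

Definition homs d m (v : 'I_m -> 'cV[R]_d) : 'M[R]_(d + 1, m) :=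
  \matrix_(a, i) hom (v i) a 0.

(** Columns outside [Z] are zeroed rather than deleted: the matrix is then [homs v] times a diagonal
    matrix, and rank-nullity compares the two ranks. *)
Definition homs_on d m (v : 'I_m -> 'cV[R]_d) (Z : {set 'I_m}) : 'M[R]_(d + 1, m) :=
  \matrix_(a, i) (hom (v i) a 0 *+ (i \in Z)).

Definition affvals d m (v : 'I_m -> 'cV[R]_d) (s : 'cV[R]_m) : Prop :=
  exists (c : 'rV[R]_d) b, forall i, s i 0 = (c *m v i) 0 0 + b.

Lemma mul_row_hom d (c : 'rV[R]_d) b (x : 'cV[R]_d) :
  (row_mx c (const_mx b) *m hom x) 0 0 = (c *m x) 0 0 + b.
Proof.
by rewrite mul_row_col mxE; congr (_ + _); rewrite mxE big_ord1 !mxE mulr1.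
Qed.

Lemma row_mx_split d (g : 'rV[R]_(d + 1)) :
  g = row_mx (lsubmx g) (const_mx (rsubmx g 0 0)).
Proof.
rewrite -[LHS]hsubmxK; congr row_mx; apply/matrixP => i j.
by rewrite !ord1 [RHS]mxE.
Qed.

Lemma mul_homs d m (v : 'I_m -> 'cV[R]_d) (g : 'rV[R]_(d + 1)) i :
  (g *m homs v) 0 i = (g *m hom (v i)) 0 0.
Proof. by rewrite !mxE; apply: eq_bigr => a _; rewrite mxE. Qed.

Lemma affvalsP d m (v : 'I_m -> 'cV[R]_d) (s : 'cV[R]_m) :
  affvals v s <-> (s^T <= homs v)%MS.
Proof.
split=> [[c [b h]]|/submxP[g e]].
  apply/submxP; exists (row_mx c (const_mx b)); apply/matrixP => i j.
  by rewrite ord1 mul_homs mul_row_hom mxE h.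
exists (lsubmx g), (rsubmx g 0 0) => i.
by rewrite -mul_row_hom -row_mx_split -mul_homs -e mxE.
Qed.

Lemma affvals_subsp d m (v : 'I_m -> 'cV[R]_d) : subsp (affvals v).
Proof.
split; first by exists 0, 0 => i; rewrite mul0mx !mxE addr0.
move=> a x y /affvalsP hx /affvalsP hy; apply/affvalsP.
by rewrite linearP /= addmx_sub // scalemx_sub.
Qed.

Lemma mul_comb d m (v : 'I_m -> 'cV[R]_d) (w : 'I_m -> R) (c : 'rV[R]_d) b :
  (c *m \sum_i w i *: v i) 0 0 + b * \sum_i w i =
  \sum_i w i * ((c *m v i) 0 0 + b).
Proof.
rewrite mulmx_sumr summxE mulr_sumr -big_split /=; apply: eq_bigr => i _.
by rewrite -scalemxAr mxE mulrDr (mulrC b).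
Qed.

Lemma hom_comb d m (v : 'I_m -> 'cV[R]_d) (w : 'I_m -> R) :
  homs v *m (\col_i w i) = col_mx (\sum_i w i *: v i) (const_mx (\sum_i w i)).
Proof.
apply/matrixP => a j; rewrite ord1 !mxE; case: splitP => a' ea.
  have -> : a = lshift 1 a' by apply: val_inj.
  by rewrite summxE; apply: eq_bigr => i _; rewrite [homs _ _ _]mxE col_mxEu !mxE mulrC.
have -> : a = rshift d a' by apply: val_inj.
by rewrite mxE; apply: eq_bigr => i _; rewrite [homs _ _ _]mxE col_mxEd !mxE mul1r.
Qed.

Lemma homs_free d k (w : 'I_k -> 'cV[R]_d) : aff_indep w <-> row_free (homs w)^T.
Proof.
have key (l : 'I_k -> R) : (homs w *m (\col_i l i) == 0) =
    ((\sum_i l i *: w i == 0) && (\sum_i l i == 0)).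
  rewrite hom_comb col_mx_eq0; congr andb.
  apply/eqP/eqP => [/matrixP/(_ 0 0)|->]; first by rewrite !mxE.
  by apply/matrixP => i j; rewrite !mxE.
split=> [wi|wf l l0 l1 i].
  rewrite -kermx_eq0; apply/rowV0P => u /sub_kermxP uw.
  have : homs w *m (\col_i u 0 i) == 0.
    apply/eqP/trmx_inj; rewrite trmx_mul trmx0 -{}uw; congr (_ *m _).
    by apply/matrixP => a b; rewrite !ord1 !mxE.
  rewrite key => /andP[/eqP h1 /eqP h2].
  by apply/matrixP => a b; rewrite ord1 mxE; apply: wi h2 h1 b.
have : (\row_i l i) *m (homs w)^T == 0.
  rewrite -trmx_eq0 trmx_mul trmxK.
  have -> : (\row_i l i)^T = \col_i l i by apply/matrixP => a b; rewrite !mxE.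
  by rewrite key l0 l1 !eqxx.
rewrite mulmx_free_eq0 // => /eqP/matrixP/(_ 0 i); by rewrite !mxE.
Qed.

(** The lift of a family in [S] factors through [homs_on v Z], so an affinely independent one has at
    most rank many members. Conversely a maximal free choice of columns avoids the zero columns,
    hence consists of points with index in [Z]. *)
Lemma affdim_rank d m (v : 'I_m -> 'cV[R]_d) (Z : {set 'I_m}) (S : set 'cV[R]_d) :
  (forall i, i \in Z -> S (v i)) ->
  (forall x, S x -> exists w : 'I_m -> R,
     [/\ forall i, i \notin Z -> w i = 0, \sum_i w i = 1 & x = \sum_i w i *: v i]) ->
  affdim S = Posz (\rank (homs_on v Z)) - 1.
Proof.
move=> ZS SZ; congr (Posz _ - 1); apply/eqP; rewrite eqn_leq; apply/andP; split.
  apply/bigmax_leqP => k /asboolP[w [wS /homs_free]].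
  rewrite /row_free mxrank_tr => /eqP <-.
  have [c hc] := boolp.choice (fun i => SZ _ (wS i)).
  have -> : homs w = homs_on v Z *m (\matrix_(i, j) c j i).
    apply/matrixP => a j; rewrite [LHS]mxE [RHS]mxE.
    have [c0 c1 ew] := hc j.
    have -> : hom (w j) a 0 = (homs v *m (\col_i c j i)) a 0.
      by rewrite hom_comb c1 -ew.
    rewrite mxE; apply: eq_bigr => i _.
    rewrite [homs _ _ _]mxE [homs_on _ _ _ _]mxE [(\col__ _) _ _]mxE.
    rewrite [(\matrix_(_, _) _) _ _]mxE.
    by case: (boolP (i \in Z)) => iZ; rewrite ?mulr1n //= c0 // !mulr0.
  exact: mxrankM_maxl.
set A := (homs_on v Z)^T.
have rA : \rank A = \rank (homs_on v Z) by rewrite mxrank_tr.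
have rd : (\rank A < d.+2)%N by rewrite ltnS (leq_trans (rank_leq_col A)) ?addn1.
rewrite -rA; apply: (@leq_bigmax_cond _ _ (fun k : 'I_d.+2 => k : nat) (Ordinal rd)).
apply/asboolP => /=.
have fA : row_free (rowsub (maxrankfun A) A) by exact: maxrowsub_free.
have fZ i : maxrankfun A i \in Z.
  apply: contraT => iZ.
  have : (delta_mx 0 i : 'rV_(\rank A)) *m rowsub (maxrankfun A) A == 0.
    apply/eqP; rewrite -rowE; apply/matrixP => a b.
    by rewrite [LHS]mxE [LHS]mxE [LHS]mxE [LHS]mxE [RHS]mxE (negbTE iZ) mulr0n.
  rewrite mulmx_free_eq0 // => /eqP/matrixP/(_ 0 i)/eqP.
  by rewrite !mxE !eqxx oner_eq0.
exists (v \o maxrankfun A); split=> [i|]; first exact: ZS.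
apply/homs_free; suff -> : (homs (v \o maxrankfun A))^T = rowsub (maxrankfun A) A by [].
by apply/matrixP => i j; rewrite !mxE fZ mulr1n.
Qed.

Lemma homs_onT d m (v : 'I_m -> 'cV[R]_d) : homs_on v [set: 'I_m]%SET = homs v.
Proof. by apply/matrixP => a i; rewrite !mxE inE mulr1n. Qed.

Lemma affdim_conv d m (v : 'I_m -> 'cV[R]_d) :
  affdim (conv_hull v) = Posz (\rank (homs v)) - 1.
Proof.
rewrite -homs_onT; apply: affdim_rank => [i _|x [w [w0 w1 ->]]].
  exists (fun j => (j == i)%:R); split.
  - by move=> j; rewrite ler0n.
  - by rewrite (bigD1 i) //= eqxx big1 ?addr0 // => j /negbTE ->.
  - rewrite (bigD1 i) //= eqxx scale1r big1 ?addr0 // => j /negbTE ->.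
    by rewrite scale0r.
by exists w; split => // i; rewrite inE.
Qed.

Lemma conv_hull_vertex d m (v : 'I_m -> 'cV[R]_d) i : conv_hull v (v i).
Proof.
exists (fun j => (j == i)%:R); split.
- by move=> j; rewrite ler0n.
- by rewrite (bigD1 i) //= eqxx big1 ?addr0 // => j /negbTE ->.
- rewrite (bigD1 i) //= eqxx scale1r big1 ?addr0 // => j /negbTE ->.
  by rewrite scale0r.
Qed.

(* The affine functions vanishing on the face cut out by a support-minimal [e]
   are the multiples of [e], so that this face has codimension one. *)
Lemma facet_of_minsup d m (v : 'I_m -> 'cV[R]_d) e : minsup (affvals v) e ->
  exists2 F, facets (conv_hull v) F & forall i, F (v i) <-> e i 0 = 0.
Proof.
move=> [[c [b ecb]] e_ge0 eN0 emin].
pose F := [set x | conv_hull v x /\ (- c *m x) 0 0 = b].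
have valE w : \sum_i w i = 1 ->
    b - (- c *m \sum_i w i *: v i) 0 0 = \sum_i w i * e i 0.
  move=> w1; under [RHS]eq_bigr do rewrite ecb.
  by rewrite -mul_comb w1 mulr1 mulNmx mxE opprK addrC.
pose Z := [set i | e i 0 == 0]%SET.
have FP i : F (v i) <-> e i 0 = 0.
  rewrite ecb; split=> [[_ <-]|e0]; first by rewrite mulNmx [X in _ + X]mxE subrr.
  split; first exact: conv_hull_vertex.
  by rewrite mulNmx mxE; apply/eqP; rewrite eqr_oppLR -subr_eq0 opprK e0.
have FZ x : F x -> exists w : 'I_m -> R,
    [/\ forall i, i \notin Z -> w i = 0, \sum_i w i = 1 & x = \sum_i w i *: v i].
  move=> [[w [w0 w1 ->]] hx]; exists w; split => // i; rewrite inE => ei.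
  move: (valE w w1); rewrite hx subrr => /esym/eqP.
  rewrite psumr_eq0 => [/allP/(_ i (mem_index_enum i))|j _].
    by rewrite mulf_eq0 (negbTE ei) orbF => /eqP.
  by rewrite mulr_ge0.
exists F => //; split.
  exists (- c), b; split => // x [w [w0 w1 ->]].
  by rewrite -subr_ge0 valE // sumr_ge0 // => i _; rewrite mulr_ge0.
rewrite affdim_conv (@affdim_rank _ _ v Z) //; last first.
  by move=> i; rewrite inE => /eqP /FP.
pose D : 'M[R]_m := diag_mx (\row_i (i \in Z)%:R).
have mulD q (A : 'M[R]_(q, m)) a i : (A *m D) a i = A a i *+ (i \in Z).
  by rewrite mul_mx_diag !mxE mulr_natr.
have -> : homs_on v Z = homs v *m D.
  by apply/matrixP => a i; rewrite mulD !mxE.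
have -> : \rank (homs v) = (\rank (homs v *m D) + 1)%N.
  rewrite -(mxrank_mul_ker (homs v) D); congr (_ + _)%N.
  have -> : \rank (homs v :&: kermx D) = \rank e^T.
    apply/eqP; rewrite eqn_leq; apply/andP; split; apply: mxrankS; last first.
      rewrite sub_capmx; apply/andP; split; first by apply/affvalsP; exists c, b.
      apply/sub_kermxP/matrixP => a i; rewrite mulD !mxE inE ord1.
      by case: eqP => [->|_]; rewrite ?mul0rn ?mulr0n.
    apply/rV_subP => u; rewrite sub_capmx => /andP[uL /sub_kermxP uD].
    have [||a ea] := emin u^T.
    - by apply/affvalsP; rewrite trmxK.
    - apply/fintype.subsetP => i; rewrite !inE mxE; apply: contraNN => ei.
      have /matrixP/(_ 0 i) := uD; rewrite mulD !mxE inE ei mulr1n => ->.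
      by rewrite eqxx.
    - by rewrite -[u]trmxK ea linearZ /= scalemx_sub.
  by rewrite rank_rV trmx_eq0 eN0.
by rewrite PoszD addrK.
Qed.

(** A nonnegative affine function is a sum of support-minimal ones. Each of these vanishes exactly
    on a facet, and minimality makes it a positive multiple of the slack of that facet. *)
Lemma facet_slacks d m (v : 'I_m -> 'cV[R]_d) k :
  (facets (conv_hull v) #= `I_k)%card ->
  exists S : 'M[R]_(k, m), (forall j i, 0 <= S j i) /\
    forall s, affvals v s -> nneg s ->
      exists2 l : 'rV[R]_k, forall j, 0 <= l 0 j & s^T = l *m S.
Proof.
rewrite card_eq_sym => /card_set_bijP[f [fI _ fS]].
have /boolp.choice[c hc] : forall j : 'I_k, exists p : 'rV[R]_d * R,
    (forall x, conv_hull v x -> (p.1 *m x) 0 0 <= p.2) /\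
    f j = [set x | conv_hull v x /\ (p.1 *m x) 0 0 = p.2].
  by move=> j; have [[c0 [d0 h]] _] := fI j (ltn_ord j); exists (c0, d0).
pose S : 'M[R]_(k, m) := \matrix_(j, i) ((c j).2 - ((c j).1 *m v i) 0 0).
have S0 j i : 0 <= S j i.
  by rewrite mxE subr_ge0; have [h _] := hc j; apply: h; exact: conv_hull_vertex.
exists S; split => // s sL s0.
have [es mes ->] := min_decomp (affvals_subsp v) sL s0.
have : forall e, e \in es -> exists2 l : 'rV[R]_k, forall j, 0 <= l 0 j & e^T = l *m S.
  move=> e /mes me; have [F FF Fe] := facet_of_minsup me.
  have [_ e_ge0 eN0 emin] := me.
  have [j0 j0k fj] := fS F FF; pose j := Ordinal j0k.
  (* Whichever inequality was chosen for the facet, its slack has the same zeros as [e]. *)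
  have Sj i : (S j i == 0) = (e i 0 == 0).
    apply/eqP/eqP => [|/Fe].
      rewrite mxE => /subr0_eq h; apply/Fe; rewrite -fj.
      have [_ ->] := hc j; split => //; exact: conv_hull_vertex.
    by rewrite -fj; have [_ ->] := hc j; case=> _ h; rewrite mxE h subrr.
  have [||a ea] := emin (row j S)^T.
  - exists (- (c j).1), (c j).2 => i.
    by rewrite [LHS]mxE [LHS]mxE [LHS]mxE mulNmx [X in _ = X + _]mxE addrC.
  - by apply/fintype.subsetP => i; rewrite !inE [_^T _ _]mxE [row j S _ _]mxE Sj.
  have [i ei] := col_neq0 eN0.
  have := congr1 (fun M : 'cV_m => M i 0) ea; rewrite [LHS]mxE [LHS]mxE [RHS]mxE => Sji.
  have a_gt0 : 0 < a.
    have : 0 < S j i by rewrite lt_neqAle eq_sym Sj ei S0.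
    rewrite Sji pmulr_lgt0 // lt_neqAle eq_sym ei; exact: e_ge0.
  exists (a^-1 *: delta_mx 0 j) => [j'|].
    by rewrite !mxE mulr_ge0 ?ler0n // invr_ge0 ltW.
  rewrite -scalemxAl -rowE -[row j S]trmxK ea linearZ /= scalerA mulVf ?scale1r //.
  exact: lt0r_neq0.
elim: es {mes} => [_|e es IH hes].
  by exists 0; [move=> j; rewrite mxE|rewrite mul0mx big_nil trmx0].
have [l1 h1 e1] := hes e (mem_head _ _).
have [|l2 h2 e2] := IH; first by move=> e' h; apply: hes; rewrite inE h orbT.
exists (l1 + l2); first by move=> j; rewrite mxE addr_ge0.
by rewrite big_cons linearD /= e1 e2 mulmxDl.
Qed.

End Facets.

(** * Vertices as images of support-minimal vectors *)

Section Normal.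
Context {R : realType}.
Local Open Scope classical_set_scope.

Lemma small_multiple (I : finType) (P : pred I) (e b : I -> R) :
  (forall i, P i -> 0 < e i) ->
  exists2 eps, 0 < eps & forall i, P i -> eps * `|b i| <= e i.
Proof.
move=> e_gt0; pose M := \sum_(i | P i) `|b i| / e i.
have M0 : 0 <= M by apply: sumr_ge0 => i Pi; rewrite divr_ge0 // ltW // e_gt0.
have M1 : 0 < 1 + M by rewrite ltr_wpDr.
exists (1 + M)^-1; first by rewrite invr_gt0.
move=> i Pi; rewrite mulrC ler_pdivrMr // -ler_pdivrMl ?e_gt0 // mulrC.
rewrite /M (bigD1 i) //= addrCA lerDl addr_ge0 //.
by apply: sumr_ge0 => j /andP[Pj _]; rewrite divr_ge0 // ltW // e_gt0.
Qed.

Definition colsp k m (S : 'M[R]_(k, m)) (y : 'cV[R]_k) : Prop := exists u, y = S *m u.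

Lemma colsp_subsp k m (S : 'M[R]_(k, m)) : subsp (colsp S).
Proof.
split; first by exists 0; rewrite mulmx0.
move=> a _ _ [u ->] [u' ->]; exists (a *: u + u').
by rewrite mulmxDr scalemxAr.
Qed.

(** All that is kept of an extension with [k] facets. The rows of [S] are facet slacks upstairs;
    they need not be values of affine functions at the projected points [p]. *)
Definition slack_rows q m (p : 'I_m -> 'cV[R]_q) k (S : 'M[R]_(k, m)) : Prop :=
  (forall j i, 0 <= S j i) /\
  forall s, affvals p s -> nneg s ->
    exists2 l : 'rV[R]_k, forall j, 0 <= l 0 j & s^T = l *m S.

(** On finitely many points every affine function is the difference of two nonnegative ones, itself
    plus a large constant and that constant; so its values lie in the row space of [S]. *)
Lemma slack_rows_homs q m (p : 'I_m -> 'cV[R]_q) k (S : 'M[R]_(k, m)) :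
  slack_rows p S -> exists K : 'M[R]_(q + 1, k), homs p = K *m S.
Proof.
move=> [S0 HS].
suff /submxP[K ->] : (homs p <= S)%MS by exists K.
apply/row_subP => a.
have const_affvals b : affvals p (const_mx b).
  by exists 0, b => i; rewrite mul0mx !mxE add0r.
have sub s : affvals p s -> (s^T <= S)%MS.
  move=> ps; pose b := \sum_i `|s i 0|.
  have [||l _ el] := HS (1 *: s + const_mx b).
  - by case: (affvals_subsp p) => _; apply => //.
  - move=> i; rewrite scale1r !mxE.
    have : `|s i 0| <= b by rewrite /b (bigD1 i) //= lerDl; exact: sumr_ge0.
    by have := ler_norm (- s i 0); rewrite normrN; lra.
  have [||l' _ el'] := HS (const_mx b) => //.
    by move=> i; rewrite mxE; apply: sumr_ge0.
  have -> : s^T = (1 *: s + const_mx b)^T - (const_mx b)^T.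
    by rewrite scale1r linearD /= addrK.
  by rewrite el el' -mulmxBl submxMl.
rewrite -[row a _]trmxK; apply: sub; apply/affvalsP.
by rewrite trmxK row_sub.
Qed.

Lemma vertex_of_conv d m (p : 'I_m -> 'cV[R]_d) x :
  vertices (conv_hull p) x -> exists l, p l = x.
Proof.
move=> [c [delta [cP cx]]].
have [[w [w0 w1 xw]] cxE] : conv_hull p x /\ (c *m x) 0 0 = delta.
  by have : [set x] x by []; rewrite cx.
pose e l := delta - (c *m p l) 0 0.
have e_ge0 l : 0 <= e l by rewrite subr_ge0 cP //; exact: conv_hull_vertex.
have eP l : e l = 0 -> p l = x.
  move/eqP; rewrite subr_eq0 => /eqP h; have : [set x] (p l); last by [].
  by rewrite cx; split; [exact: conv_hull_vertex|].
have : \sum_l w l * e l = 0.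
  under eq_bigr do rewrite mulrBr; rewrite sumrB -mulr_suml w1 mul1r.
  apply/eqP; rewrite subr_eq0 -cxE xw mulmx_sumr summxE; apply/eqP.
  by apply: eq_bigr => l _; rewrite -scalemxAr mxE.
move/eqP; rewrite psumr_eq0 => [/allP h|l _]; last by rewrite mulr_ge0.
have [l0 wl0] : exists l0, w l0 != 0.
  apply/existsP; apply: contraT; rewrite negb_exists => /forallP h'.
  move/eqP: w1; rewrite big1 ?(eq_sym 0) ?oner_eq0 // => i _.
  by have := h' i; rewrite negbK => /eqP.
exists l0; apply: eP; have := h l0 (mem_index_enum _).
by rewrite mulf_eq0 (negbTE wl0) => /eqP.
Qed.

(** The column of [S] at a point projecting to [x] splits into support-minimal parts, whose images
    under [K] add up to [hom x]. These images lie in the cone over the polytope, where [hom x] spans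
    an extreme ray, so all are multiples of [hom x] and one is nonzero. *)
Lemma vertex_minsup q m (p : 'I_m -> 'cV[R]_q) k (S : 'M[R]_(k, m)) K x :
  slack_rows p S -> homs p = K *m S -> vertices (conv_hull p) x ->
  exists y rho, [/\ minsup (colsp S) y, rho != 0 & K *m y = rho *: hom x].
Proof.
move=> [S0 HS] pK vx; have [l0 pl0] := vertex_of_conv vx.
have [c [delta [cP cx]]] := vx.
have [_ cxE] : conv_hull p x /\ (c *m x) 0 0 = delta.
  by have : [set x] x by []; rewrite cx.
pose e l := delta - (c *m p l) 0 0.
have e_ge0 l : 0 <= e l by rewrite subr_ge0 cP //; exact: conv_hull_vertex.
have eP l : e l = 0 -> p l = x.
  move/eqP; rewrite subr_eq0 => /eqP h; have : [set x] (p l); last by [].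
  by rewrite cx; split; [exact: conv_hull_vertex|].
have [||es mes ey] := min_decomp (colsp_subsp S) (y := col l0 S).
- by exists (delta_mx l0 0); rewrite colE.
- by move=> j; rewrite mxE.
have Kcol : K *m col l0 S = hom x.
  rewrite colE mulmxA -pK -colE -pl0; apply/matrixP => a b.
  by rewrite ord1 [LHS]mxE [LHS]mxE.
(* Such a functional is a nonnegative combination of the rows of [S], hence nonnegative on every
   part. *)
have nonneg (g : 'rV[R]_(q + 1)) : (forall l, 0 <= (g *m homs p) 0 l) ->
    forall e', e' \in es -> 0 <= (g *m (K *m e')) 0 0.
  move=> g0 e' /mes[[u ->] e'_ge0 _ _].
  have [||la la0 ela] := HS (g *m homs p)^T.
  - by apply/affvalsP; rewrite trmxK submxMl.
  - by move=> i; rewrite mxE.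
  rewrite !mulmxA -(mulmxA g) -pK.
  move: ela; rewrite trmxK => ->; rewrite -mulmxA mxE.
  by apply: sumr_ge0 => j _; rewrite mulr_ge0.
have zero (g : 'rV[R]_(q + 1)) : (forall l, 0 <= (g *m homs p) 0 l) -> (g *m hom x) 0 0 = 0 ->
    forall e', e' \in es -> (g *m (K *m e')) 0 0 = 0.
  move=> g0 gx e' e'es.
  have : \sum_(e0 <- es) (g *m (K *m e0)) 0 0 = 0.
    by rewrite -summxE -mulmx_sumr -mulmx_sumr -ey Kcol.
  rewrite big_seq => /eqP; rewrite psumr_eq0 => [/allP/(_ _ e'es)|e0]; last exact: nonneg.
  by rewrite e'es => /eqP.
have Kes e' : e' \in es -> exists t, K *m e' = t *: hom x.
  move=> e'es; pose z := K *m e'; exists (z (rshift q 0) 0).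
  pose g0 := row_mx (- c) (const_mx delta : 'rV_1).
  have g0E y : (g0 *m hom y) 0 0 = delta - (c *m y) 0 0.
    by rewrite mul_row_hom mulNmx [X in X + _]mxE addrC.
  suff H (w' : 'rV[R]_q) : (w' *m usubmx z) 0 0 = (w' *m x) 0 0 * z (rshift q 0) 0.
    rewrite -/z -[LHS]vsubmxK /hom scale_col_mx; congr col_mx.
      apply/matrixP => a b; rewrite ord1; have := H (delta_mx 0 a).
      by rewrite -!rowE [LHS]mxE => ->; rewrite !mxE mulrC.
    by apply/matrixP => a b; rewrite !ord1 !mxE mulr1.
  pose g1 := row_mx w' (const_mx (- (w' *m x) 0 0) : 'rV_1).
  have g1E y : (g1 *m hom y) 0 0 = (w' *m y) 0 0 - (w' *m x) 0 0.
    by rewrite mul_row_hom.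
  (* [g0] is positive at all points other than [x], so adding a small multiple of any functional
     [g1] vanishing at [x] keeps it nonnegative. Hence every such [g1] kills [z]. *)
  have [eps eps0 heps] := @small_multiple _ (fun l => 0 < e l) e
    (fun l => (g1 *m hom (p l)) 0 0) (fun l h => h).
  have z0 : (g0 *m z) 0 0 = 0.
    apply: zero => //; last by rewrite g0E cxE subrr.
    by move=> l; rewrite mul_homs g0E; exact: e_ge0.
  have z1 : ((eps *: g1 + g0) *m z) 0 0 = 0.
    apply: zero => //; last first.
      by rewrite mulmxDl -scalemxAl mxE [X in X + _]mxE g1E g0E cxE !subrr mulr0 addr0.
    move=> l; rewrite mul_homs mulmxDl -scalemxAl mxE [X in X + _]mxE g0E.
    have [el|] := ltrP 0 (e l).
      have := heps l el; set u := (g1 *m _) 0 0 => h.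
      have := ler_norm (- (eps * u)); rewrite normrN normrM (gtr0_norm eps0) /e in h *.
      by lra.
    move=> el; have /eP -> : e l = 0 by apply/eqP; rewrite eq_le el e_ge0.
    by rewrite g1E cxE !subrr mulr0 addr0.
  have {}z1 : (g1 *m z) 0 0 = 0.
    move: z1; rewrite mulmxDl -scalemxAl mxE [X in X + _]mxE z0 addr0 => /eqP.
    by rewrite mulf_eq0 gt_eqF //= => /eqP.
  move: z1; rewrite -{1}[z]vsubmxK mul_row_col mxE => /eqP; rewrite addr_eq0 => /eqP ->.
  by rewrite mxE big_ord1 !mxE mulNr opprK.
have [e' e'es [t [t0 et]]] : exists2 e', e' \in es & exists t, t != 0 /\ K *m e' = t *: hom x.
  apply: contrapT => h; have : K *m col l0 S = 0.
    rewrite ey mulmx_sumr big_seq big1 // => e' e'es.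
    have [t et] := Kes e' e'es; have [t0|tN0] := eqVneq t 0; first by rewrite et t0 scale0r.
    by case: h; exists e' => //; exists t.
  rewrite Kcol => /matrixP/(_ (rshift q 0) 0)/eqP.
  by rewrite /hom col_mxEd !mxE oner_eq0.
by exists e', t; split => //; exact: mes.
Qed.

End Normal.

(** * Counting the parameters of an extension *)

Section NormalForm.
Context {R : realType}.

(* [z] is, up to a nonzero scalar, the image under [K] of a vector [x] that
   solves a Cramer system whose matrix is made of rows of [col_mx 1 X]. *)
Definition cramer_image q r c (X : 'M[R]_(c, r)) (K : 'M[R]_(q, r)) (z : 'cV[R]_q) : Prop :=
  exists (h : {ffun 'I_r -> 'I_(r + c)}) (i0 : 'I_r) (x : 'cV[R]_r) (xi : R),
    [/\ rowsub h (col_mx 1%:M X) \in unitmx,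
        rowsub h (col_mx 1%:M X) *m x = xi *: delta_mx i0 0,
        xi != 0 & K *m x = z].

(** Only the order of the rows changes, and [u] records it; square systems of rows of [B] are thus
    systems of rows of [col_mx 1%:M X]. *)
Lemma identity_rows k r (B : 'M[R]_(k, r)) (f : 'I_r -> 'I_k) :
  injective f -> rowsub f B = 1%:M ->
  exists c (X : 'M[R]_(c, r)) (u : 'I_k -> 'I_(r + c)),
    (r + c)%N = k /\ B = rowsub u (col_mx 1%:M X).
Proof.
move=> finj fB; pose C := (~: [set f i | i : 'I_r])%SET.
pose X : 'M[R]_(#|C|, r) := rowsub (fun i => enum_val i) B.
have /boolp.choice[u hu] : forall j, exists u : 'I_(r + #|C|),
    row u (col_mx 1%:M X) = row j B.
  move=> j; have [/imsetP[i _ ->]|jC] := boolP (j \in [set f i | i : 'I_r]%SET).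
    exists (lshift _ i); apply/matrixP => a b.
    by rewrite ord1 !mxE (unsplitK (inl _)) -fB !mxE.
  have jC' : j \in C by rewrite finset.in_setC.
  exists (rshift _ (enum_rank_in jC' j)); apply/matrixP => a b.
  by rewrite ord1 !mxE (unsplitK (inr _)) !mxE enum_rankK_in.
exists #|C|, X, u; split.
  have := cardsC [set f i | i : 'I_r]%SET.
  by rewrite card_imset // !card_ord.
apply/row_matrixP => j; rewrite -hu; apply/matrixP => a b; by rewrite !mxE.
Qed.

Lemma row_mxsub_rows m n p (g : 'I_m -> 'I_n) (A : 'M[R]_(n, p)) q (x : 'M[R]_(p, q)) :
  rowsub g A *m x = rowsub g (A *m x).
Proof. by apply/matrixP => i j; rewrite !mxE; apply: eq_bigr => a _; rewrite mxE. Qed.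

(** The column space is parametrised as y = B x, where [B] contains an identity matrix. For a
    minimal y the equations saying that it vanishes off its support determine x up to a scalar, and
    one nonzero coordinate fixes the scalar; [\rank S] independent equations among these form the
    Cramer system. *)
Lemma minsup_cramer q k m (S : 'M[R]_(k, m)) (K : 'M[R]_(q, k)) :
  exists r c (X : 'M[R]_(c, r)) (K' : 'M[R]_(q, r)),
    (r + c)%N = k /\ forall y, minsup (colsp S) y -> cramer_image X K' (K *m y).
Proof.
pose f := maxrankfun S; pose S0 := rowsub f S.
have S0free : row_free S0 by exact: maxrowsub_free.
have /submxP[B SB] : (S <= S0)%MS by rewrite eq_maxrowsub.
have fB : rowsub f B = 1%:M.
  by apply: (row_free_inj S0free); rewrite mul1mx row_mxsub_rows -SB.
have [c [X [u [rc Bu]]]] := identity_rows (@maxrankfun_inj _ _ _ S) fB.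
exists (\rank S), c, X, (K *m B); split => // y [[s ys] y_ge0 yN0 ymin].
pose x := S0 *m s.
have yx : y = B *m x by rewrite ys mulmxA -SB.
have xE z : rowsub f (B *m z) = z by rewrite -row_mxsub_rows fB mul1mx.
have xmin (x' : 'cV_(\rank S)) : supp (B *m x') \subset supp y -> exists a, x' = a *: x.
  have /row_freeP[T S0T] := S0free.
  case/ymin => [|a ea].
    have ST : S *m T = B.
      by transitivity (B *m S0 *m T); [congr (_ *m _) | rewrite -mulmxA S0T mulmx1].
    by exists (T *m x'); rewrite mulmxA ST.
  exists a; rewrite -[LHS]xE ea yx -[in RHS](xE _ x).
  by apply/matrixP => i j; rewrite !mxE.
have [j0 yj0] := col_neq0 yN0.
(* Keeps the rows where [y] vanishes and the row [j0]. A kernel vector is a multiple of [x] by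
   minimality, and row [j0] makes it zero. *)
pose B' : 'M[R]_(k, \rank S) := \matrix_(j, a) (B j a *+ ((y j 0 == 0) || (j == j0))).
have B'E z j : (B' *m z) j 0 = (B *m z) j 0 *+ ((y j 0 == 0) || (j == j0)).
  rewrite !mxE -sumrMnl; apply: eq_bigr => a _; by rewrite mxE mulrnAl.
have B'full : row_full B'.
  rewrite -cokermx_eq0; apply/eqP/matrixP => i j; rewrite [RHS]mxE.
  pose z := col j (cokermx B').
  have B'z l : (B' *m z) l 0 = 0.
    by rewrite /z colE mulmxA mulmx_coker mul0mx mxE.
  have [|a za] := xmin z.
    apply/fintype.subsetP => l; rewrite !inE; apply: contraNN => yl.
    by have := B'z l; rewrite B'E yl /= mulr1n => ->.
  have := B'z j0; rewrite B'E eqxx orbT mulr1n za -scalemxAr -yx mxE => /eqP.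
  rewrite mulf_eq0 (negbTE yj0) orbF => /eqP a0.
  by have /matrixP/(_ i 0) := za; rewrite a0 scale0r !mxE.
pose h0 := fullrankfun B'full.
have W0 : rowsub h0 B' \in unitmx by exact: fullrowsub_unit.
have h0Z i : (y (h0 i) 0 == 0) || (h0 i == j0).
  apply: contraT => hi; have : (delta_mx 0 i : 'rV_(\rank S)) *m rowsub h0 B' == 0.
    apply/eqP; rewrite -rowE; apply/matrixP => a b.
    by rewrite [LHS]mxE [LHS]mxE [LHS]mxE [RHS]mxE (negbTE hi) mulr0n.
  rewrite mulmx_free_eq0 ?row_free_unit // => /eqP/matrixP/(_ 0 i)/eqP.
  by rewrite !mxE !eqxx oner_eq0.
have W0E : rowsub h0 B' = rowsub (u \o h0) (col_mx 1%:M X).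
  apply/matrixP => i a; rewrite [LHS]mxE [LHS]mxE h0Z mulr1n Bu.
  by rewrite mxE [RHS]mxE.
have Wx i : (rowsub h0 B' *m x) i 0 = y (h0 i) 0.
  by rewrite row_mxsub_rows mxE B'E h0Z mulr1n -yx.
(* Otherwise the system would be homogeneous and [x] would vanish. *)
have [i0 hi0] : exists i0, h0 i0 = j0.
  apply: contrapT => h; have : rowsub h0 B' *m x = 0.
    apply/matrixP => i a; rewrite ord1 Wx [RHS]mxE.
    by case/orP: (h0Z i) => /eqP // e; case: h; exists i.
  move/(congr1 (mulmx (invmx (rowsub h0 B')))).
  rewrite mulKmx // mulmx0 => x0.
  by move: yj0; rewrite yx x0 mulmx0 mxE eqxx.
exists [ffun i => u (h0 i)], i0, x, (y j0 0).
have -> : rowsub [ffun i => u (h0 i)] (col_mx 1%:M X) = rowsub h0 B'.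
  by rewrite W0E; apply/matrixP => i a; rewrite !mxE ffunE.
split => //; last by rewrite -mulmxA -yx.
apply/matrixP => i a; rewrite ord1 Wx !mxE eqxx andbT.
case: (eqVneq i i0) => [->|ii0]; first by rewrite hi0 mulr1.
case/orP: (h0Z i) => /eqP; first by rewrite mulr0.
by rewrite -hi0 => /fullrankfun_inj e; rewrite e eqxx in ii0.
Qed.

Lemma cramer_image_scale q r c (X : 'M[R]_(c, r)) (K : 'M[R]_(q, r))
    (be : 'I_r -> R) (ga : 'I_c -> R) z :
  (forall a, be a != 0) -> (forall b, ga b != 0) -> cramer_image X K z ->
  cramer_image (\matrix_(b, a) (ga b * X b a * be a)) (\matrix_(i, a) (K i a * be a)) z.
Proof.
move=> be0 ga0 [h [i0 [x [xi [Wu Wx xi0 Kx]]]]].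
(* Row scalings of the whole matrix [col_mx 1%:M X]: on the identity block they undo the column
   scalings [be]. *)
pose ka (j : 'I_(r + c)) := match fintype.split j with inl a => (be a)^-1 | inr b => ga b end.
have ka0 j : ka j != 0 by rewrite /ka; case: fintype.split => // a; rewrite invr_eq0.
set X' := \matrix_(b, a) _.
have WE : rowsub h (col_mx 1%:M X') =
    diag_mx (\row_i ka (h i)) *m rowsub h (col_mx 1%:M X) *m diag_mx (\row_a be a).
  apply/matrixP => i a; rewrite mul_mx_diag mul_diag_mx !mxE /ka.
  case: fintype.split => [b|b]; rewrite !mxE //.
  by case: eqVneq => [->|_]; rewrite /= ?mulr1 ?mulVf // mulr0 mul0r.
have Du n (d : 'I_n -> R) : (forall i, d i != 0) -> diag_mx (\row_i d i) \in unitmx.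
  move=> d0; rewrite unitmxE det_diag unitfE; apply/prodf_neq0 => i _.
  by rewrite mxE.
have bex : diag_mx (\row_a be a) *m (\col_a ((be a)^-1 * x a 0)) = x.
  by apply/matrixP => a b; rewrite ord1 mul_diag_mx !mxE mulrA mulfV ?mul1r.
exists h, i0, (\col_a ((be a)^-1 * x a 0)), (ka (h i0) * xi); split.
- by rewrite WE !unitmx_mul Wu (Du _ be) // (Du _ (fun i => ka (h i))).
- rewrite WE -!mulmxA bex Wx; apply/matrixP => i a.
  rewrite mul_diag_mx !mxE; case: eqVneq => [->|_]; first by rewrite !mulrA.
  by rewrite /= !mulr0.
- by rewrite mulf_neq0.
- rewrite -Kx; apply/matrixP => i a; rewrite ord1 !mxE; apply: eq_bigr => b _.
  by rewrite !mxE -mulrA (mulrA (be b)) mulfV // mul1r.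
Qed.

(** Column scalings turn the last row of [K] into zeros and ones, then row scalings do the same for
    the first column of [X]; [bK] and [bX] record which entries vanish. Rank zero cannot occur,
    since a [cramer_image] comes with an index in ['I_r]. *)
Lemma normal_form q k m (S : 'M[R]_(k, m)) (K : 'M[R]_(q + 1, k)) :
  (exists2 y, minsup (colsp S) y & K *m y != 0) ->
  exists r c (X : 'M[R]_(c, r)) (bX : {ffun 'I_c -> bool})
    (K2 : 'M[R]_(q, 1 + r)) (bK : {ffun 'I_(1 + r) -> bool}),
    (1 + r + c)%N = k /\ forall y, minsup (colsp S) y ->
      cramer_image (row_mx (\col_b (bX b)%:R) X) (col_mx K2 (\row_a (bK a)%:R)) (K *m y).
Proof.
move=> [y0 my0 Ky0]; have [r [c [X [K' [rc H]]]]] := minsup_cramer S K.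
case: r X K' rc H => [|r] X K' rc H.
  by have [h [[]]] := H _ my0.
pose be a : R := if K' (rshift q 0) a == 0 then 1 else (K' (rshift q 0) a)^-1.
have be0 a : be a != 0.
  by rewrite /be; case: ifP => [_|/negbT]; rewrite ?oner_eq0 ?invr_eq0.
pose ga b : R := if X b 0 == 0 then 1 else (X b 0 * be 0)^-1.
have ga0 b : ga b != 0.
  by rewrite /ga; case: ifP => [_|/negbT h]; rewrite ?oner_eq0 // invr_eq0 mulf_neq0.
pose X' : 'M[R]_(c, 1 + r) := \matrix_(b, a) (ga b * X b a * be a).
pose K'' : 'M[R]_(q + 1, 1 + r) := \matrix_(i, a) (K' i a * be a).
exists r, c, (rsubmx X'), [ffun b => X b 0 != 0], (usubmx K''),
  [ffun a => K' (rshift q 0) a != 0]; split => // y my.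
have -> : row_mx (\col_b ([ffun b => X b 0 != 0] b)%:R) (rsubmx X') = X'.
  rewrite -[RHS]hsubmxK; congr row_mx; apply/matrixP => b a.
  have e0 : lshift r a = 0 by apply: val_inj; rewrite /= ord1.
  rewrite !mxE e0 ffunE /ga; case: eqVneq => [->|Xb0]; first by rewrite mulr0 mul0r.
  by rewrite -mulrA mulVf // mulf_neq0.
have -> : col_mx (usubmx K'') (\row_a ([ffun a => K' (rshift q 0) a != 0] a)%:R) = K''.
  rewrite -[RHS]vsubmxK; congr col_mx; apply/matrixP => a b.
  rewrite ord1 !mxE ffunE /be; case: eqVneq => [->|Kb0]; first by rewrite mul0r.
  by rewrite mulfV.
exact: cramer_image_scale be0 ga0 (H y my).
Qed.

(** The adjugate sends xi e_i0 to a multiple of the solution, so column [i0] of the adjugate is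
    proportional to it. Dividing by the last coordinate removes all unknown scalars. *)
Lemma cramer_image_adj q r c (X : 'M[R]_(c, r)) (K : 'M[R]_(q + 1, r)) x rho :
  rho != 0 -> cramer_image X K (rho *: hom x) ->
  exists (h : {ffun 'I_r -> 'I_(r + c)}) (i0 : 'I_r),
    let U := K *m col i0 (\adj (rowsub h (col_mx 1%:M X))) in
    U (rshift q 0) 0 != 0 /\
    forall a, x a 0 * U (rshift q 0) 0 = U (lshift 1 a) 0.
Proof.
move=> rho0 [h [i0 [z [xi [Wu Wz xi0 Kz]]]]]; exists h, i0 => /=.
set W := rowsub h _ in Wu Wz *.
have dW : \det W != 0 by rewrite -unitfE -unitmxE.
have -> : K *m col i0 (\adj W) = (\det W / xi * rho) *: hom x.
  rewrite -scalerA -Kz scalemxAr; congr (_ *m _).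
  have : \adj W *m (W *m z) = \det W *: z by rewrite mulmxA mul_adj_mx mul_scalar_mx.
  rewrite Wz -scalemxAr -colE => h1.
  apply: (scalerI xi0); rewrite h1 scalerA; congr (_ *: _).
  by rewrite mulrC divfK.
have U0 : (\det W / xi * rho *: hom x) (rshift q 0) 0 = \det W / xi * rho.
  by rewrite mxE /hom col_mxEd mxE mulr1.
rewrite U0; split; first by rewrite !mulf_neq0 ?invr_eq0.
by move=> a; rewrite mxE /hom col_mxEu mulrC.
Qed.

End NormalForm.

(** * Sets contained in a hypersurface, and polygons of small extension complexity *)

Section Thin.
Context {R : realType}.
Local Open Scope classical_set_scope.

Definition thin m k (X : 'M[R]_(m, k) -> Prop) : Prop :=
  exists2 P : mpoly (m * k) R, P != 0 & forall A, X A -> eval_mx P A = 0.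

Lemma thin_sub m k (X Y : 'M[R]_(m, k) -> Prop) :
  (forall A, X A -> Y A) -> thin Y -> thin X.
Proof. by move=> XY [P PN0 hP]; exists P => // A /XY; exact: hP. Qed.

Lemma thin_empty m k (X : 'M[R]_(m, k) -> Prop) : (forall A, ~ X A) -> thin X.
Proof. by move=> X0; exists 1; [exact: oner_neq0 | move=> A /X0]. Qed.

Lemma thin_exists m k (I : finType) (X : I -> 'M[R]_(m, k) -> Prop) :
  (forall i, thin (X i)) -> thin (fun A => exists i, X i A).
Proof.
move=> hX; have /boolp.choice[P hP] : forall i, exists P : mpoly (m * k) R,
    P != 0 /\ forall A, X i A -> eval_mx P A = 0.
  by move=> i; have [P] := hX i; exists P.
exists (\prod_i P i).
  by apply/prodf_neq0 => i _; have [] := hP i.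
move=> z [i Xz]; rewrite /eval_mx rmorph_prod (bigD1 i) //=.
by have [_ h] := hP i; rewrite [meval _ _]h ?mul0r.
Qed.

Lemma rational_image_thin N m k (F G : 'M[mpoly N R]_(m, k)) : (N < m * k)%N ->
  thin (fun A => exists th, forall a b,
    meval th (G a b) != 0 /\ A a b * meval th (G a b) = meval th (F a b)).
Proof.
move=> lt; have [P PN0 hP] := rational_image_relation
  (fun i => mxvec F 0 i) (fun i => mxvec G 0 i) lt.
exists P => // A [th hA]; apply: (hP th) => i.
by case/mxvec_indexP: i => a b; rewrite !mxvecE.
Qed.

Section Family.
Variables (r c : nat) (bX : {ffun 'I_c -> bool}) (bK : {ffun 'I_(1 + r) -> bool}).

(** Stated over any commutative ring so that the same expression serves for indeterminate entries
    and for their values; the adjugate commutes with evaluation. *)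
Definition cramer_vec (S : comNzRingType) (X : 'M[S]_(c, r)) (K : 'M[S]_(2, 1 + r))
    (h : {ffun 'I_(1 + r) -> 'I_(1 + r + c)}) (i0 : 'I_(1 + r)) : 'cV[S]_(2 + 1) :=
  col_mx K (\row_a (bK a)%:R) *m
    col i0 (\adj (rowsub h (col_mx 1%:M (row_mx (\col_b (bX b)%:R) X)))).

Let N := (c * r + 2 * (1 + r))%N.
Let var : 'rV[mpoly N R]_N := \row_i mpolyX R (mnm1 i).
Let Xp : 'M[mpoly N R]_(c, r) := vec_mx (lsubmx var).
Let Kp : 'M[mpoly N R]_(2, 1 + r) := vec_mx (rsubmx var).

Lemma cramer_vec_poly (X : 'M[R]_(c, r)) (K : 'M[R]_(2, 1 + r)) :
  exists th, forall h i0 a b,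
    meval th (cramer_vec Xp Kp h i0 a b) = cramer_vec X K h i0 a b.
Proof.
pose t := row_mx (mxvec X) (mxvec K); exists (fun i => t 0 i) => h i0 a b.
have varE : map_mx (meval (fun i => t 0 i)) var = t.
  by apply/matrixP => i j; rewrite !mxE mevalXU ord1 mxE.
transitivity (map_mx (meval (fun i => t 0 i)) (cramer_vec Xp Kp h i0) a b).
  by rewrite [RHS]mxE.
congr (fun_of_matrix _ a b); rewrite /cramer_vec map_mxM map_col_mx map_col.
congr (_ *m _).
  congr col_mx; last by apply/matrixP => i j; rewrite !mxE rmorph_nat.
  by rewrite map_vec_mx map_rsubmx varE row_mxKr mxvecK.
rewrite map_mx_adj map_mxsub map_col_mx map_mx1 map_row_mx.
set C := map_mx _ (\col_b _); have -> : C = \col_b (bX b)%:R.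
  by apply/matrixP => i j; rewrite !mxE rmorph_nat.
by rewrite map_vec_mx map_lsubmx varE row_mxKl mxvecK.
Qed.

Definition vertex_family n
    (h : {ffun 'I_n -> {ffun 'I_(1 + r) -> 'I_(1 + r + c)}})
    (i0 : {ffun 'I_n -> 'I_(1 + r)}) (V : 'M[R]_(n, 2)) : Prop :=
  exists (X : 'M[R]_(c, r)) (K : 'M[R]_(2, 1 + r)), forall i,
    let U := cramer_vec X K (h i) (i0 i) in
    U (rshift 2 0) 0 != 0 /\
    forall a, V i a * U (rshift 2 0) 0 = U (lshift 1 a) 0.

Lemma vertex_family_thin n h i0 : (N < n * 2)%N -> thin (@vertex_family n h i0).
Proof.
move=> lt.
pose F : 'M[mpoly N R]_(n, 2) :=
  \matrix_(i, a) cramer_vec Xp Kp (h i) (i0 i) (lshift 1 a) 0.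
pose G : 'M[mpoly N R]_(n, 2) :=
  \matrix_(i, a) cramer_vec Xp Kp (h i) (i0 i) (rshift 2 0) 0.
have FE i a : F i a = cramer_vec Xp Kp (h i) (i0 i) (lshift 1 a) 0 by rewrite [LHS]mxE.
have GE i a : G i a = cramer_vec Xp Kp (h i) (i0 i) (rshift 2 0) 0 by rewrite [LHS]mxE.
apply: thin_sub (rational_image_thin F G lt).
move=> V [X [K hV]]; have [th hth] := cramer_vec_poly X K.
by exists th => i a; rewrite FE GE !hth; have [U0 hU] := hV i.
Qed.

Definition edge_family n h i0 (e1 e2 : {ffun 'I_n -> 'I_n}) (A : 'M[R]_(n, 2)) : Prop :=
  exists2 V, vertex_family h i0 V & forall i,
    [/\ row (e1 i) V != row (e2 i) V, (A *m V^T) i (e1 i) = 1 & (A *m V^T) i (e2 i) = 1].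

Lemma sum2 (f : 'I_2 -> R) : \sum_i f i = f 0 + f 1.
Proof. by rewrite big_ord_recl big_ord1; congr (_ + f _); apply: val_inj. Qed.

(* The coefficients of the line through two points given in homogeneous
   coordinates are read off their cross product. *)
Lemma edge_family_thin n h i0 e1 e2 : (N < n * 2)%N -> thin (@edge_family n h i0 e1 e2).
Proof.
move=> lt; pose u i a := cramer_vec Xp Kp (h i) (i0 i) (lshift 1 a) 0.
pose u3 i := cramer_vec Xp Kp (h i) (i0 i) (rshift 2 0) 0.
pose F : 'M[mpoly N R]_(n, 2) := \matrix_(i, a) if a == 0
   then u3 (e1 i) * u (e2 i) 1 - u (e1 i) 1 * u3 (e2 i)
   else u (e1 i) 0 * u3 (e2 i) - u3 (e1 i) * u (e2 i) 0.
pose G : 'M[mpoly N R]_(n, 2) :=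
  \matrix_(i, a) (u (e1 i) 0 * u (e2 i) 1 - u (e1 i) 1 * u (e2 i) 0).
apply: thin_sub (rational_image_thin F G lt).
move=> A [V [X [K hV]] hA]; have [th hth] := cramer_vec_poly X K.
exists th => i a.
have -> : F i a = if a == 0
   then u3 (e1 i) * u (e2 i) 1 - u (e1 i) 1 * u3 (e2 i)
   else u (e1 i) 0 * u3 (e2 i) - u3 (e1 i) * u (e2 i) 0 by rewrite [LHS]mxE.
have -> : G i a = u (e1 i) 0 * u (e2 i) 1 - u (e1 i) 1 * u (e2 i) 0 by rewrite [LHS]mxE.
clear F G; have [V12] := hA i; rewrite !mxE !sum2 !mxE => A1 A2.
have [w [w3 [uE u3E w30 wE]]] : exists w w3, [/\ forall j b, meval th (u j b) = w j b,
    forall j, meval th (u3 j) = w3 j, forall j, w3 j != 0 &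
    forall j b, w j b = V j b * w3 j].
  exists (fun j b => cramer_vec X K (h j) (i0 j) (lshift 1 b) 0).
  exists (fun j => cramer_vec X K (h j) (i0 j) (rshift 2 0) 0).
  split=> [j b|j|j|j b]; [exact: hth | exact: hth | by have [] := hV j |].
  by have [_ ->] := hV j.
move: u u3 uE u3E => u u3 uE u3E {hth hV lt X K}.
have GE : meval th (u (e1 i) 0 * u (e2 i) 1 - u (e1 i) 1 * u (e2 i) 0) =
    (V (e1 i) 0 * V (e2 i) 1 - V (e1 i) 1 * V (e2 i) 0) * (w3 (e1 i) * w3 (e2 i)).
  rewrite mevalB !mevalM !uE !wE.
  by ring.
set x0 := V (e1 i) 0 in GE A1 *; set x1 := V (e1 i) 1 in GE A1 *.
set y0 := V (e2 i) 0 in GE A2 *; set y1 := V (e2 i) 1 in GE A2 *.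
(* Two proportional points on a line that misses the origin coincide. *)
have D0 : x0 * y1 - x1 * y0 != 0.
  apply: contraNneq V12 => D0; apply/eqP/matrixP => z b; rewrite !mxE.
  have b01 : b = 0 \/ b = 1.
    by case: b => -[|[|//]] ?; [left|right]; apply: val_inj.
  case: b01 => ->; rewrite -/x0 -/x1 -/y0 -/y1; apply/eqP; rewrite -subr_eq0.
    have -> : x0 - y0 = x0 * (A i 0 * y0 + A i 1 * y1)
        - y0 * (A i 0 * x0 + A i 1 * x1) by rewrite A1 A2 !mulr1.
    by rewrite -[X in _ == X](mulr0 (A i 1)) -D0; apply/eqP; ring.
  have -> : x1 - y1 = x1 * (A i 0 * y0 + A i 1 * y1)
      - y1 * (A i 0 * x0 + A i 1 * x1) by rewrite A1 A2 !mulr1.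
  by rewrite -[X in _ == X](mulr0 (- A i 0)) -D0; apply/eqP; ring.
split; first by rewrite GE !mulf_neq0.
rewrite GE; case: eqP => [->|a1].
  have -> : meval th (u3 (e1 i) * u (e2 i) 1 - u (e1 i) 1 * u3 (e2 i)) =
      (y1 - x1) * (w3 (e1 i) * w3 (e2 i)).
    rewrite mevalB !mevalM !uE !u3E !wE.
    by rewrite -/x1 -/y1; ring.
  rewrite mulrA; congr (_ * _).
  transitivity ((A i 0 * x0 + A i 1 * x1) * y1 - x1 * (A i 0 * y0 + A i 1 * y1)).
    by ring.
  by rewrite A1 A2 mul1r mulr1.
have -> : a = 1 by case: a a1 => -[|[|//]] ? // h1; [case: h1|]; apply: val_inj.
have -> : meval th (u (e1 i) 0 * u3 (e2 i) - u3 (e1 i) * u (e2 i) 0) =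
    (x0 - y0) * (w3 (e1 i) * w3 (e2 i)).
  rewrite mevalB !mevalM !uE !u3E !wE.
  by rewrite -/x0 -/y0; ring.
rewrite mulrA; congr (_ * _).
transitivity (x0 * (A i 0 * y0 + A i 1 * y1) - (A i 0 * x0 + A i 1 * x1) * y0).
  by ring.
by rewrite A1 A2 mul1r mulr1.
Qed.

End Family.

Lemma affine_image_conv d q m (v : 'I_m -> 'cV[R]_d) (M : 'M[R]_(q, d)) t :
  [set M *m x + t | x in conv_hull v] = conv_hull (fun i => M *m v i + t).
Proof.
have comb (w : 'I_m -> R) : \sum_i w i = 1 ->
    M *m (\sum_i w i *: v i) + t = \sum_i w i *: (M *m v i + t).
  move=> w1; under [RHS]eq_bigr do rewrite scalerDr.
  rewrite big_split /= -scaler_suml w1 scale1r mulmx_sumr; congr (_ + _).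
  by apply: eq_bigr => i _; rewrite scalemxAr.
apply/seteqP; split=> [_ [x [w [w0 w1 ->]] <-]|_ [w [w0 w1 ->]]].
  by exists w; split => //; exact: comb.
by exists (\sum_i w i *: v i); [exists w | exact: comb].
Qed.

Lemma extension_slack_rows q (P : set 'cV[R]_q) k : extension_of_size P k ->
  exists m (p : 'I_m -> 'cV[R]_q) (S : 'M[R]_(k, m)), P = conv_hull p /\ slack_rows p S.
Proof.
move=> [d [Q [M [t [[m [v ->]] ->]]]]] /facet_slacks[S [S0 HS]].
exists m, (fun i => M *m v i + t), S; split; first exact: affine_image_conv.
split => // s [c [b hs]]; apply: HS; exists (c *m M), ((c *m t) 0 0 + b) => i.
by rewrite hs mulmxDr mxE mulmxA addrA.
Qed.

Lemma extension_vertex_family n P k (V : 'M[R]_(n, 2)) : (0 < n)%N ->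
  extension_of_size P k -> (forall i, vertices P (row i V)^T) ->
  exists r c (bX : {ffun 'I_c -> bool}) (bK : {ffun 'I_(1 + r) -> bool}) h i0,
    (1 + r + c)%N = k /\ vertex_family bX bK h i0 V.
Proof.
move=> n0 /extension_slack_rows[m [p [S [-> Sp]]]] PV.
have [K pK] := slack_rows_homs Sp.
have hom_neq0 (x : 'cV[R]_2) : hom x != 0.
  apply/eqP => /matrixP/(_ (rshift 2 0) 0)/eqP.
  by rewrite /hom col_mxEd !mxE oner_eq0.
have nf : exists2 y, minsup (colsp S) y & K *m y != 0.
  have [y [rho [my rho0 Ky]]] := vertex_minsup Sp pK (PV (Ordinal n0)).
  by exists y => //; rewrite Ky scaler_eq0 negb_or rho0 hom_neq0.
have [r [c [X [bX [K2 [bK [rck H]]]]]]] := normal_form nf.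
have /boolp.choice[hi hiP] : forall i, exists hi :
   {ffun 'I_(1 + r) -> 'I_(1 + r + c)} * 'I_(1 + r),
    let U := cramer_vec bX bK X K2 hi.1 hi.2 in
    U (rshift 2 0) 0 != 0 /\ forall a, V i a * U (rshift 2 0) 0 = U (lshift 1 a) 0.
  move=> i; have [y [rho [my rho0 Ky]]] := vertex_minsup Sp pK (PV i).
  have := H y my; rewrite Ky => /(cramer_image_adj rho0)[h [i0 [U0 hU]]].
  exists (h, i0); split => // a; have := hU a; by rewrite !mxE.
exists r, c, bX, bK, [ffun i => (hi i).1], [ffun i => (hi i).2]; split => //.
by exists X, K2 => i; rewrite !ffunE; exact: hiP.
Qed.

(** The inequality of means for [r] and [c + 2], whose sum is k + 1, gives 4 (cr + 2r) <= (k + 1)^2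
    < 8n - 8. *)
Lemma few_parameters n r c : ((1 + r + c).+1 ^ 2 < 8 * n - 8)%N ->
  (c * r + 2 * (1 + r) < n * 2)%N.
Proof.
have -> : ((1 + r + c).+1 = r + (c + 2))%N by lia.
have [AGM _] := nat_AGM2 r (c + 2); move: AGM; rewrite mulnDr.
by move: ((r + (c + 2)) ^ 2)%N => x; rewrite (mulnC r c); lia.
Qed.

Definition small_vertices n (V : 'M[R]_(n, 2)) : Prop :=
  exists P k, [/\ (k.+1 ^ 2 < 8 * n - 8)%N, extension_of_size P k &
    forall i, vertices P (row i V)^T].

Lemma small_vertices_thin n : (0 < n)%N -> thin (@small_vertices n).
Proof.
(* A crude bound on [r] and [c], to make the union finite. *)
move=> n0; pose C (r c : 'I_(8 * n)) := ((1 + r + c).+1 ^ 2 < 8 * n - 8)%N.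
apply: (@thin_sub _ _ _ (fun V => exists r c : 'I_(8 * n), exists bX bK h i0,
   C r c /\ @vertex_family r c bX bK n h i0 V)).
  move=> V [P [k [kn Pk PV]]].
  have [r [c [bX [bK [h [i0 [rck HV]]]]]]] := extension_vertex_family n0 Pk PV.
  have rn : (r < 8 * n)%N by nia.
  have cn : (c < 8 * n)%N by nia.
  by exists (Ordinal rn), (Ordinal cn), bX, bK, h, i0; rewrite /C /= rck.
apply: thin_exists => r; apply: thin_exists => c.
have [Crc|nC] := boolP (C r c); last by apply: thin_empty => V [? [? [? [? []]]]].
apply: thin_exists => bX; apply: thin_exists => bK.
apply: thin_exists => h; apply: thin_exists => i0.
apply: thin_sub (@vertex_family_thin r c bX bK n h i0 (few_parameters Crc)).
by move=> V [].
Qed.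

(** [e1 i] and [e2 i] name two vertices on the edge of row [i]. There are finitely many such
    choices, and each makes the rows rational functions of the vertices. *)
Definition small_edges n (A : 'M[R]_(n, 2)) : Prop :=
  exists2 V, small_vertices V & exists e1 e2 : 'I_n -> 'I_n, forall i,
    [/\ row (e1 i) V != row (e2 i) V, (A *m V^T) i (e1 i) = 1 & (A *m V^T) i (e2 i) = 1].

Lemma small_edges_thin n : (0 < n)%N -> thin (@small_edges n).
Proof.
move=> n0; pose C (r c : 'I_(8 * n)) := ((1 + r + c).+1 ^ 2 < 8 * n - 8)%N.
apply: (@thin_sub _ _ _ (fun V => exists r c : 'I_(8 * n), exists bX bK h i0 e1 e2,
   C r c /\ @edge_family r c bX bK n h i0 e1 e2 V)).
  move=> A [V [P [k [kn Pk PV]]] [e1 [e2 he]]].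
  have [r [c [bX [bK [h [i0 [rck HV]]]]]]] := extension_vertex_family n0 Pk PV.
  have rn : (r < 8 * n)%N by nia.
  have cn : (c < 8 * n)%N by nia.
  exists (Ordinal rn), (Ordinal cn), bX, bK, h, i0, (finfun e1), (finfun e2).
  rewrite /C /= rck; split => //; exists V => // i; rewrite !ffunE; exact: he.
apply: thin_exists => r; apply: thin_exists => c.
have [Crc|nC] := boolP (C r c); last by apply: thin_empty => V [? [? [? [? [? [? []]]]]]].
apply: thin_exists => bX; apply: thin_exists => bK.
apply: thin_exists => h; apply: thin_exists => i0.
apply: thin_exists => e1; apply: thin_exists => e2.
apply: thin_sub (@edge_family_thin r c bX bK n h i0 e1 e2 (few_parameters Crc)).
by move=> V [].
Qed.

End Thin.

(** * Zero sets of polynomials *)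

Section ZeroSets.
Context {R : realType}.
Local Open Scope classical_set_scope.

Lemma continuous_meval (T : topologicalType) N (P : mpoly N R) (f : 'I_N -> T -> R) :
  (forall i, continuous (f i)) -> continuous (fun x => meval (f ^~ x) P).
Proof.
move=> fc.
have csum (I : Type) (r : seq I) (F : I -> T -> R) :
    (forall i, continuous (F i)) -> continuous (fun x => \sum_(i <- r) F i x).
  move=> Fc; elim: r => [|i r IH] x.
    by under eq_fun do rewrite big_nil; exact: cst_continuous.
  by under eq_fun do rewrite big_cons; apply: cvgD; [exact: Fc | exact: IH].
have cexp (g : T -> R) e : continuous g -> continuous (fun x => g x ^+ e).
  move=> gc; elim: e => [|e IH] x; first exact: cst_continuous.
  by under eq_fun do rewrite exprS; apply: cvgM; [exact: gc | exact: IH].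
have cprod (I : Type) (r : seq I) (F : I -> T -> R) :
    (forall i, continuous (F i)) -> continuous (fun x => \prod_(i <- r) F i x).
  move=> Fc; elim: r => [|i r IH] x.
    by under eq_fun do rewrite big_nil; exact: cst_continuous.
  by under eq_fun do rewrite big_cons; apply: cvgM; [exact: Fc | exact: IH].
under eq_fun do rewrite mevalE.
apply: csum => m x; apply: cvgM; first exact: cst_continuous.
by apply: cprod => i; apply: cexp.
Qed.

Lemma eval_mx_continuous m k (P : mpoly (m * k) R) :
  continuous (eval_mx P : 'M[R]_(m, k) -> R).
Proof.
apply: continuous_meval => i; case/mxvec_indexP: i => a b.
under eq_fun do rewrite mxvecE; exact: coord_continuous.
Qed.

Lemma eval_mx_closed m k (P : mpoly (m * k) R) : closed [set A | eval_mx P A = 0].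
Proof.
apply: (@closed_comp _ _ (eval_mx P) [set x | x = 0]) => [A _|].
  exact: eval_mx_continuous.
exact: closed_eq.
Qed.

Lemma few_roots (q : {poly R}) (I : finType) (t : I -> R) :
  q != 0 -> injective t -> (#|[set i | root q (t i)]%SET| < size q)%N.
Proof.
move=> q0 tI; rewrite cardE -(size_map t).
apply: max_poly_roots => //.
  by apply/allP => y /mapP[i]; rewrite mem_enum inE => qi ->.
by rewrite map_inj_uniq ?enum_uniq.
Qed.

(** After rounding [A] to a rational matrix, one moves along the curve with a small rational
    parameter. [P] has fewer than [D] zeros on that curve, so one of [D + 1] parameters works. *)
Lemma nonroot_rational m k (P : mpoly (m * k) R) (A : 'M[R]_(m, k)) eps :
  P != 0 -> 0 < eps -> exists B : 'M[rat]_(m, k),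
    (forall i j, `|ratr (B i j) - A i j| < eps) /\ eval_mx P (map_mx ratr B) != 0.
Proof.
move=> PN0 eps0; have e2 : 0 < eps / 2 by rewrite divr_gt0.
have /boolp.choice[A0 hA0] : forall ij : 'I_m * 'I_k,
    exists q : rat, `|ratr q - A ij.1 ij.2| < eps / 2.
  move=> [i j] /=; have /rat_in_itvoo[q] : A i j - eps / 2 < A i j + eps / 2 by lra.
  by rewrite in_itv /= => /andP[h1 h2]; exists q; rewrite ltr_distl h1 h2.
have [B [D [B0 H]]] := curve_poly PN0.
have [q [q0 qD qE]] := H (fun l => mxvec (\matrix_(i, j) ratr (A0 (i, j))) 0 l).
pose M := (Num.truncn (2 / eps)).+1.
have MP : 2 / eps < M%:R.
  by rewrite /M; apply: truncnS_gt.
have M0 : 0 < (M%:R : R) by rewrite ltr0n.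
(* These parameters are at most 1 / M < eps / 2, and so are their powers with positive exponent. *)
pose t (s : 'I_D.+1) : rat := ((M + s)%:R)^-1.
have t0 s : 0 < t s by rewrite invr_gt0 ltr0n ltn_addr.
have t1 s : t s <= 1 by rewrite invf_le1 ?ltr0n ?ltn_addr // ler1n ltn_addr.
have tI : injective (fun s => ratr (t s) : R).
  move=> s s' /fmorph_inj/invr_inj/eqP; rewrite eqr_nat eqn_add2l => /eqP; exact: val_inj.
have [s hs] : exists s, q.[ratr (t s)] != 0.
  apply: contrapT => h; have := few_roots q0 tI; rewrite ltnNge.
  have -> : [set i | root q (ratr (t i))]%SET = [set: 'I_D.+1]%SET.
    apply/setP => s; rewrite !inE; apply/negPn/negP => hs; by apply: h; exists s.
  by rewrite cardsT card_ord (leq_trans qD).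
pose C : 'M[rat]_(m, k) := \matrix_(i, j) (A0 (i, j) + t s ^+ (B ^ mxvec_index i j)).
exists C; split => [i j|]; last first.
  rewrite qE in hs; rewrite /eval_mx; set u := meval _ _; set v := meval _ _ in hs.
  suff -> : u = v by [].
  apply: meval_eq => l; case/mxvec_indexP: l => i j.
  by rewrite !mxvecE !mxE rmorphD rmorphXn.
rewrite mxE rmorphD /= rmorphXn /= addrAC; apply: le_lt_trans (ler_normD _ _) _.
have h1 := hA0 (i, j); suff : `|ratr (t s) ^+ (B ^ mxvec_index i j)| <= eps / 2 :> R.
  by move=> h2; move: h1 h2 => /=; lra.
have ts0 : 0 <= ratr (t s) :> R by rewrite ler0q ltW.
have ts1 : ratr (t s) <= 1 :> R by rewrite -(rmorph1 (@ratr R)) ler_rat t1.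
rewrite ger0_norm ?exprn_ge0 //.
have /prednK <- : (0 < B ^ mxvec_index i j)%N by rewrite expn_gt0 B0.
rewrite exprS; apply: (@le_trans _ _ (ratr (t s))).
  by rewrite ler_piMr // exprn_ile1.
rewrite /t fmorphV rmorph_nat invf_ple ?posrE ?ltr0n ?ltn_addr //.
rewrite invf_div; apply: le_trans (ltW MP) _; by rewrite ler_nat leq_addr.
Qed.

End ZeroSets.

(** * Zero sets of polynomials have measure zero *)

Section GridCover.
Context {R : realType}.
Local Open Scope classical_set_scope.

(** The point [x] is moved along the curve with parameter s / L; the zero set then comes within 1 /
    (M + 1) of it in the maximum norm. *)
Definition hits N (P : mpoly N R) (L B M : nat) (x : 'I_N -> R) (s : 'I_L) : Prop :=
  exists2 z, meval z P = 0 &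
    forall i, `|z i - (x i + (s%:R / L%:R) ^+ (B ^ i))| <= M.+1%:R^-1.

Definition hit_set N (P : mpoly N R) (L B M : nat) (x : 'I_N -> R) : {set 'I_L} :=
  [set s | `[< hits P B M x s >]]%SET.

(** For fixed [x] and large [M] only the parameters with a zero of [P] exactly on the curve can hit,
    and these are fewer than [D]. The same [M] works near [x] by continuity, and compactness of the
    cube makes it uniform. *)
Lemma few_translates N (P : mpoly N R) (L : nat) (K : R) :
  (0 < L)%N -> P != 0 -> forall B D,
  (forall x : 'I_N -> R, exists q : {poly R},
    [/\ q != 0, (size q <= D)%N & forall t, q.[t] = meval (fun j => x j + t ^+ (B ^ j)) P]) ->
  exists M : nat, forall x : 'I_N -> R, (forall i, `|x i| <= K) ->
  (#|hit_set P L B M x| <= D)%N.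
Proof.
move=> L0 PN0 B D H.
pose Pr M (x : 'rV[R]_N) := (#|hit_set P L B M (fun i => x ord0 i)| <= D)%N.
pose KK := [set v : 'rV[R]_N | forall i, `[(- K), K] (v ord0 i)].
have KKc : compact KK by apply: (@rV_compact _ _ (fun=> `[(- K), K])) => _; exact: segment_compact.
have : \forall M \near \oo, KK `<=` Pr M.
  move/compact_near_coveringP : KKc; apply => x _.
  have [q [q0 qD qE]] := H (fun i => x ord0 i).
  have tI : injective (fun s : 'I_L => s%:R / L%:R : R).
    move=> s s' /mulIf e; apply: val_inj; apply/eqP; rewrite -(eqr_nat R).
    by apply/eqP/e; rewrite invr_eq0 pnatr_eq0 -lt0n.
  pose ok (s : 'I_L) (x' : 'rV[R]_N) M :=
    ~~ root q (s%:R / L%:R) -> ~ hits P B M (fun i => x' ord0 i) s.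
  have key : filter_prod (nbhs x) \oo [set xM | forall s, ok s xM.1 xM.2].
    have FF : Filter (filter_prod (nbhs x) \oo) by exact: filter_prod_filter.
    apply: (@filter_forall ('rV[R]_N * nat)%type _
      (fun s => [set xM | ok s xM.1 xM.2]) _ FF) => s.
    rewrite /ok.
    have [rs|qs] := boolP (root q (s%:R / L%:R)).
      by apply: (@filterS _ _ FF setT); [move=> [x' M] _ | exact: filterT].
    pose w0 : 'rV[R]_N := \row_i (x ord0 i + (s%:R / L%:R) ^+ (B ^ i)).
    have w0E : meval (fun i => w0 ord0 i) P != 0.
      move: qs; rewrite rootE qE; set u := meval _ _; set u' := meval _ _.
      by suff -> : u = u' by []; apply: meval_eq => i; rewrite mxE.
    have cont : continuous (fun w : 'rV[R]_N => meval (fun i => w ord0 i) P).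
      by apply: continuous_meval => i; exact: coord_continuous.
    have : nbhs w0 [set w : 'rV[R]_N | meval (fun i => w ord0 i) P != 0].
      apply: (cont w0 [set y : R | y != 0]); by apply: open_nbhs_nbhs; split => //; exact: open_neq.
    move=> /nbhs_ballP[r /= r0 hr].
    have r2 : 0 < r / 2 by rewrite divr_gt0.
    exists (ball x (r / 2), [set M | M.+1%:R^-1 < r / 2]) => /=.
      split; first exact: nbhsx_ballx.
      exact: near_infty_natSinv_lt (PosNum r2).
    move=> [x' M] /= [[_ xx'] Mr] _ [z z0 hz].
    have /= := hr (\row_i z i); rewrite {1}/ball /= .
    have -> : meval (fun i => (\row_i z i) ord0 i) P = 0.
      by rewrite -[RHS]z0; apply: meval_eq => i; rewrite mxE.
    rewrite eqxx => hb; have : false; last by [].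
    apply: hb; split => // a i; rewrite ord1 !mxE /ball /=.
    have h1 := hz i; have := xx' ord0 i; rewrite /ball /= => h2.
    rewrite -(subrKA (x' ord0 i + (s%:R / L%:R) ^+ (B ^ i))).
    apply: le_lt_trans (ler_normD _ _) _.
    rewrite opprD addrACA subrr addr0 (distrC _ (z i)).
    move: h1 h2 Mr; set u := `|_|; set v := `|_|; set r' := _^-1.
    by move: u v r'; clear; move=> u v r'; lra.
  case: key => -[U V] /= [xU FV] UV; exists (U, V) => // -[x' M] /= UVx.
  rewrite /Pr; have hM : forall s, ok s x' M by exact: (UV (x', M) UVx).
  apply: leq_trans qD; apply: leq_trans (few_roots q0 tI); apply: leqW.
  apply: subset_leq_card; apply/fintype.subsetP => s; rewrite !inE.
  by move=> /asboolP/asboolP bs; apply: contraT => /hM; case.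
move=> [M _ hM]; exists M => x xK.
have /= := hM M (leqnn _) (\row_i x i); rewrite /Pr.
move=> h; apply: leq_trans (h _); last by move=> i; rewrite mxE /= in_itv /= -ler_norml.
apply: subset_leq_card; apply/fintype.subsetP => s; rewrite !inE => /asboolP/asboolP[z z0 hz].
by apply/asboolP/asboolP; exists z => // i; rewrite mxE.
Qed.

End GridCover.

Section GridCount.
Context {R : realType}.

(* A cube of the grid can meet the zero set along at most [D] of the [L]
   translates, so that only a fraction [D / L] of the cubes meets the zero set. *)
Lemma zero_set_cover N (P : mpoly N R) (K L B D : nat) :
  (0 < L)%N -> P != 0 -> (0 < B)%N ->
  (forall x : 'I_N -> R, exists q : {poly R},
    [/\ q != 0, (size q <= D)%N & forall t, q.[t] = meval (fun j => x j + t ^+ (B ^ j)) P]) ->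
  exists n (a : 'I_n -> 'I_N -> R) (h : R),
    [/\ 0 < h, n%:R * h ^+ N * L%:R <= D%:R * (2 * K + 2)%:R ^+ N &
      forall z, (forall i, `|z i| <= K%:R) -> meval z P = 0 ->
        exists c, forall i, a c i <= z i <= a c i + h].
Proof.
move=> L0 PN0 B0 HP.
have [M hM] := few_translates (K%:R + 1) L0 PN0 HP.
(* The mesh 1 / H is at most 1 / (M + 1), and every displacement (s / L)^(B^i) is a multiple of it,
   so that the translates respect the grid. *)
pose E := (B ^ N)%N; pose H := (M.+1 * L ^ E)%N.
have H0 : (0 < H)%N by rewrite muln_gt0 expn_gt0 L0.
have HR : 0 < H%:R :> R by rewrite ltr0n.
have HRN : H%:R != 0 :> R by rewrite gt_eqF.
have LRN : L%:R != 0 :> R by rewrite pnatr_eq0 -lt0n.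
pose sh (s : 'I_L) (i : 'I_N) := (M.+1 * (s ^ (B ^ i) * L ^ (E - B ^ i)))%N.
have BE (i : 'I_N) : (B ^ i <= E)%N by rewrite leq_pexp2l // ltnW.
have shE s i : (sh s i)%:R / H%:R = (s%:R / L%:R) ^+ (B ^ i) :> R.
  have -> : H%:R = M.+1%:R * (L%:R ^+ (B ^ i) * L%:R ^+ (E - B ^ i)) :> R.
    by rewrite -exprD subnKC // natrM natrX.
  rewrite /sh !natrM !natrX expr_div_n -mulf_div divff ?pnatr_eq0 // mul1r.
  by rewrite -mulf_div divff ?mulr1 // expf_neq0.
have shH s i : (sh s i <= H)%N.
  rewrite leq_mul2l -[in leqRHS](subnKC (BE i)) expnD leq_mul2r.
  have e0 : (0 < B ^ i)%N by rewrite expn_gt0 B0.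
  by rewrite leq_exp2r // (ltnW (ltn_ord s)) !orbT.
pose W1 := (2 * K * H).+1; pose W := ((2 * K + 1) * H).+1.
pose C1 := {ffun 'I_N -> 'I_W1}; pose C := {ffun 'I_N -> 'I_W}.
pose corner (c : C1) i : R := (c i)%:R / H%:R - K%:R.
pose near_corner (c : C1) (z : 'I_N -> R) := forall i, corner c i <= z i <= corner c i + H%:R^-1.
pose good (c : C1) := exists z, [/\ meval z P = 0, forall i, `|z i| <= K%:R & near_corner c z].
pose G := [set c | `[< good c >]]%SET.
have GP c : c \in G -> good c by rewrite inE => /asboolP.
(* The cell from which displacement [s] leads to [c]. Adding [H], that is shifting the origin by 1,
   keeps the indices nonnegative. *)
pose phi (s : 'I_L) (c : C1) : C := [ffun i => inord (c i + H - sh s i)].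
have phiE s c i : phi s c i = (c i + H - sh s i)%N :> nat.
  rewrite ffunE inordK // /W; have := ltn_ord (c i); rewrite /W1.
  by move: (nat_of_ord (c i)) (sh s i) => x y; lia.
have phi_inj s : injective (phi s).
  move=> c c' e; apply/ffunP => i; apply: val_inj => /=.
  have := congr1 (fun f : C => nat_of_ord (f i)) e; rewrite !phiE.
  by have := shH s i; lia.
(* Pairs of a translate [s] and a good cell are counted by the cell [phi s c]: each map [phi s] is
   injective, and a given cell arises from at most [D] values of [s]. *)
have count : (L * #|G| <= #|{: C}| * D)%N.
  have -> : (L * #|G| = \sum_(s < L) #|phi s @: G|)%N.
    rewrite (eq_bigr (fun=> #|G|)) => [|s _]; last by rewrite card_imset.
    by rewrite sum_nat_const card_ord.
  have -> : (\sum_(s < L) #|phi s @: G| =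
      \sum_(c' : C) #|[set s | c' \in phi s @: G]%SET|)%N.
    under eq_bigr do rewrite -sum1_card big_mkcond /=.
    rewrite exchange_big /=; apply: eq_bigr => c' _.
    by rewrite -sum1_card [RHS]big_mkcond /=; apply: eq_bigr => s _; rewrite inE.
  rewrite -sum_nat_const; apply: leq_sum => c' _.
  pose x i : R := (c' i)%:R / H%:R - K%:R - 1.
  have xK i : `|x i| <= K%:R + 1.
    have c0 : 0 <= (c' i)%:R / H%:R :> R by rewrite divr_ge0.
    have c1 : (c' i)%:R / H%:R <= 2 * K%:R + 1 :> R.
      rewrite ler_pdivrMr // -natrM -[1]/(1%:R) -natrD -natrM ler_nat -ltnS.
      exact: ltn_ord.
    by rewrite ler_norml /x; apply/andP; split; lra.
  apply: leq_trans (hM x xK); apply: subset_leq_card; apply/fintype.subsetP => s.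
  rewrite !inE => /imsetP[c /GP[z [z0 zK zc]] ec].
  apply/asboolP/asboolP; exists z => // i.
  have -> : x i + (s%:R / L%:R) ^+ (B ^ i) = corner c i.
    rewrite -shE /x /corner ec phiE natrB; last first.
      by apply: leq_trans (shH s i) _; rewrite leq_addl.
    by rewrite natrD; field.
  have /andP[h1 h2] := zc i.
  rewrite ger0_norm ?subr_ge0 // lerBlDl; apply: le_trans h2 _.
  rewrite lerD2l lef_pV2 ?posrE ?ltr0n // ler_nat.
  by rewrite leq_pmulr // expn_gt0 L0.
exists #|G|, (fun c i => corner (enum_val c) i), H%:R^-1; split.
- by rewrite invr_gt0.
- have cR : L%:R * #|G|%:R <= #|{: C}|%:R * D%:R :> R by rewrite -!natrM ler_nat.
  rewrite mulrAC (mulrC #|G|%:R); apply: le_trans (_ : #|{: C}|%:R * D%:R * H%:R^-1 ^+ N <= _).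
    by rewrite ler_wpM2r // exprn_ge0 // invr_ge0 ltW.
  rewrite card_ffun !card_ord natrX mulrAC -exprMn mulrC ler_wpM2l //.
  apply: lerXn2r; rewrite ?nnegrE ?divr_ge0 //.
  rewrite ler_pdivrMr // -natrM ler_nat /W; lia.
- move=> z zK z0.
  have zb i : 0 <= z i + K%:R <= 2 * K%:R.
    by have := zK i; rewrite ler_norml => /andP[h1 h2]; apply/andP; split; lra.
  have tP i : (Num.truncn ((z i + K%:R) * H%:R) < W1)%N.
    have /andP[h1 h2] := zb i.
    rewrite ltnS -(ler_nat R); apply: le_trans (_ : (z i + K%:R) * H%:R <= _).
      by have /andP[] := truncn_itv (mulr_ge0 h1 (ltW HR)).
    by rewrite !natrM ler_wpM2r.
  pose c : C1 := [ffun i => Ordinal (tP i)].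
  have zc : near_corner c z.
    move=> i; have /andP[h1 h2] := zb i; rewrite /corner ffunE /=.
    set t := Num.truncn _.
    have /andP[t1 t2] := truncn_itv (mulr_ge0 h1 (ltW HR)).
    apply/andP; split; first by rewrite lerBlDr ler_pdivrMr.
    have : z i + K%:R <= t.+1%:R / H%:R by rewrite ler_pdivlMr // ltW.
    by rewrite -addn1 natrD mulrDl mul1r; lra.
  have cG : c \in G by rewrite inE; apply/asboolP; exists z.
  by exists (enum_rank_in cG c) => i; rewrite enum_rankK_in.
Qed.

End GridCount.

Section Null.
Context {R : realType}.
Local Open Scope classical_set_scope.

Lemma mx_coord_le_norm m k (A : 'M[R]_(m, k)) i j : `|A i j| <= `|A|.
Proof.
rewrite [leRHS]/Num.norm /= mx_normrE; apply/bigmax_geP; right => /=.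
by exists (i, j).
Qed.

(** The covers by cubes have total volume at most C / L, with C independent of L, and L is
    arbitrary. *)
Lemma zero_set_outer_null m k (P : mpoly (m * k) R) (K : nat) :
  P != 0 -> (0 < m * k)%N ->
  lebesgue_outer [set A : 'M[R]_(m, k) | eval_mx P A = 0 /\ `|A| <= K%:R] = 0%E.
Proof.
move=> PN0 mk0; set Z := [set A | _].
have vol0 (a b : nat -> 'M[R]_(m, k)) : (forall l i j, a l i j <= b l i j) ->
    forall l, (0 <= (box_volume (a l) (b l))%:E)%E.
  move=> ab l; rewrite lee_fin; apply: prodr_ge0 => i _; apply: prodr_ge0 => j _.
  by rewrite subr_ge0.
have ge0 : (0 <= lebesgue_outer Z)%E.
  apply/ereal_infP => _ [a [b [ab _ ->]]].
  by apply: nneseries_ge0 => l _ _; exact: vol0.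
have [B [D [B0 HP]]] := curve_poly PN0.
pose C : R := D%:R * (2 * K + 2)%:R ^+ (m * k).
have le L : (0 < L)%N -> (lebesgue_outer Z <= (C / L%:R)%:E)%E.
  move=> L0; have [n [a [h [h0 hn cov]]]] := zero_set_cover K L0 PN0 B0 HP.
  (* Beyond the [n] cubes the sequence is padded with the box from 0 to 0, of volume zero because
     there is at least one coordinate. *)
  pose f (l : nat) : 'M[R]_(m, k) :=
    if insub l is Some c then \matrix_(i, j) a c (mxvec_index i j) else 0.
  pose g (l : nat) : 'M[R]_(m, k) :=
    if insub l is Some c then \matrix_(i, j) (a c (mxvec_index i j) + h) else 0.
  have fg l i j : f l i j <= g l i j.
    by rewrite /f /g; case: insubP => [c _ _|_]; rewrite !mxE // lerDl ltW.
  have volE (l : nat) : box_volume (f l) (g l) = if (l < n)%N then h ^+ (m * k) else 0.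
    rewrite /box_volume /f /g; case: insubP => [c lc cl|/negbTE ->].
      rewrite lc (eq_bigr (fun=> h ^+ k)) => [|i _].
        by rewrite prodr_const card_ord mulnC exprM.
      rewrite (eq_bigr (fun=> h)) => [|j _]; last by rewrite !mxE addrAC subrr add0r.
      by rewrite prodr_const card_ord.
    move: mk0; rewrite muln_gt0 => /andP[m0 k0].
    rewrite (bigD1 (Ordinal m0)) //= (bigD1 (Ordinal k0)) //= !mxE subrr.
    by rewrite !mul0r.
  apply: ge_ereal_inf; exists (\sum_(0 <= l <oo) (box_volume (f l) (g l))%:E)%E.
    exists f, g; split => // A [A0 AK].
    have [i||c hc] := cov (fun i => mxvec A 0 i).
    - case/mxvec_indexP: i => i j; rewrite mxvecE.
      by apply: le_trans AK; exact: mx_coord_le_norm.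
    - exact: A0.
    exists c => // i j; have := hc (mxvec_index i j).
    by rewrite /f /g valK !mxE mxvecE.
  rewrite (@nneseries_split _ _ 0 n); last by move=> l _; exact: vol0.
  rewrite add0n eseries0 ?adde0; last by move=> l nl _; rewrite volE ltnNge nl.
  rewrite sumEFin lee_fin ler_pdivlMr ?ltr0n //; apply: le_trans hn.
  rewrite ler_wpM2r // big_nat (eq_bigr (fun=> h ^+ (m * k))) => [|l /andP[_ ln]].
    by rewrite -big_nat sumr_const_nat subn0 mulr_natl.
  by rewrite volE ln.
have finZ : lebesgue_outer Z \is a fin_num.
  rewrite fin_numE; apply/andP; split; first by rewrite gt_eqF // (lt_le_trans _ ge0).
  by rewrite lt_eqF // (le_lt_trans (le 1%N isT)) // ltry.
move: ge0 le; rewrite -(fineK finZ) => ge0 le; congr (_%:E); apply/eqP.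
rewrite eq_le -!lee_fin ge0 andbT.
apply: contraT; rewrite -ltNge lte_fin => r0; set r := fine _ in le r0.
pose L := (Num.truncn (C / r)).+1.
have CL : C / r < L%:R by exact: truncnS_gt.
have := le L isT; rewrite lee_fin ler_pdivlMr ?ltr0n //.
by rewrite mulrC -ler_pdivlMr // leNgt CL.
Qed.

Lemma closed_borel m k (A : set 'M[R]_(m, k)) :
  closed A -> measurable (A : set (borel_mx m k)).
Proof.
move=> Ac; rewrite -[A]setCK; apply: measurableC; apply: sub_sigma_algebra.
exact: closed_openC.
Qed.

(** [X] itself may fail to be measurable; it lies in a countable union of bounded closed pieces of
    the zero set, each of which is null. *)
Lemma thin_negligible m k (X : 'M[R]_(m, k) -> Prop) (mu : probability (borel_mx m k) R) :
  (0 < m * k)%N -> absolutely_continuous mu -> thin X ->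
  {ae mu, forall A, ~ X (A : 'M[R]_(m, k))}.
Proof.
move=> mk0 ac [P PN0 hP].
pose Z (K : nat) := [set A : 'M[R]_(m, k) | eval_mx P A = 0 /\ `|A| <= K%:R].
have Zc K : closed (Z K).
  apply: closedI; first exact: eval_mx_closed.
  apply: (@closed_comp _ _ (fun A : 'M[R]_(m, k) => `|A|) [set x | x <= K%:R]).
    by move=> A _; exact: norm_continuous.
  exact: closed_le.
have Zn K : mu.-negligible (Z K : set (borel_mx m k)).
  apply/negligibleP; first exact: (closed_borel (Zc K)).
  by apply: ac; [exact: (closed_borel (Zc K)) | exact: zero_set_outer_null].
apply: negligibleS (negligible_bigcup Zn) => A /= nXA.
exists (Num.truncn `|A|).+1 => //; split; last by rewrite ltW // truncnS_gt.
by apply: hP; exact: contrapT.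
Qed.

End Null.

(** * Semialgebraic projections *)

Section TarskiSeidenberg.
Context {R : realType}.
Local Open Scope classical_set_scope.
Import ordered_qelim.

Lemma semialgebraic_ext m k (S T : set 'M[R]_(m, k)) :
  (forall A, S A <-> T A) -> semialgebraic S -> semialgebraic T.
Proof. by move=> ST; have -> : S = T by apply/predeqP. Qed.

Lemma semialgebraic_setU m k (S T : set 'M[R]_(m, k)) :
  semialgebraic S -> semialgebraic T -> semialgebraic (S `|` T).
Proof.
move=> sS sT; rewrite -[S `|` T]setCK setCU.
by apply/semialgebraic_setC/semialgebraic_setI; exact: semialgebraic_setC.
Qed.

Lemma semialgebraic_const m k (P : Prop) : semialgebraic [set A : 'M[R]_(m, k) | P].
Proof.
have s1 : semialgebraic [set A : 'M[R]_(m, k) | 0 < eval_mx 1 A] := semialgebraic_pos _.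
have [p|np] := pselect P.
  by apply: semialgebraic_ext s1 => A; rewrite /= /eval_mx meval1 ltr01.
apply: semialgebraic_ext (semialgebraic_setC s1) => A /=.
by rewrite /eval_mx meval1 ltr01; split=> // /(_ isT).
Qed.

Lemma semialgebraic_exists m k (I : finType) (S : I -> set 'M[R]_(m, k)) :
  (forall i, semialgebraic (S i)) -> semialgebraic [set A | exists i, S i A].
Proof.
move=> sS; have H (s : seq I) : semialgebraic [set A | exists2 i, i \in s & S i A].
  elim: s => [|i s IH].
    by apply: semialgebraic_ext (semialgebraic_const m k False) => A; split=> // -[].
  apply: semialgebraic_ext (semialgebraic_setU (sS i) IH) => A /=; split.
    case=> [SiA|[j js SjA]]; first by exists i; rewrite ?mem_head.
    by exists j; rewrite // inE js orbT.
  by move=> [j]; rewrite inE => /orP[/eqP -> |js] SjA; [left|right; exists j].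
apply: semialgebraic_ext (H (enum I)) => A; split=> [[i _ h]|[i h]]; first by exists i.
by exists i; rewrite ?mem_enum.
Qed.

Lemma set_nth_size (e : seq R) x : set_nth 0 e (size e) x = rcons e x.
Proof. by elim: e => //= y e ->. Qed.

Definition env m k (A : 'M[R]_(m, k)) : seq R :=
  [seq mxvec A 0 i | i <- enum 'I_(m * k)].

Lemma size_env m k (A : 'M[R]_(m, k)) : size (env A) = (m * k)%N.
Proof. by rewrite size_map size_enum_ord. Qed.

Lemma nth_env m k (A : 'M[R]_(m, k)) (i : 'I_(m * k)) : (env A)`_i = mxvec A 0 i.
Proof.
rewrite (nth_map i) ?size_enum_ord //; congr (mxvec A 0 _).
by apply: val_inj; rewrite /= nth_enum_ord.
Qed.

Lemma term_mpoly m k (t : GRing.term R) : GRing.rterm t ->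
  exists p, forall A : 'M[R]_(m, k), GRing.eval (env A) t = eval_mx p A.
Proof.
elim: t => //=.
- move=> i _; have [lt|ge] := ltnP i (m * k).
    by exists (mpolyX R (mnm1 (Ordinal lt))) => A; rewrite /eval_mx mevalXU -nth_env.
  (* A variable beyond the entries of the matrix evaluates to the default 0. *)
  by exists 0 => A; rewrite /eval_mx meval0 nth_default ?size_env.
- by move=> c _; exists (mpolyC _ c) => A; rewrite /eval_mx mevalC.
- by move=> c _; exists (mpolyC _ c%:R) => A; rewrite /eval_mx mevalC.
- move=> t1 IH1 t2 IH2 /andP[/IH1[p hp] /IH2[q hq]].
  by exists (p + q) => A; rewrite /eval_mx mevalD hp hq.
- by move=> t1 IH1 /IH1[p hp]; exists (- p) => A; rewrite /eval_mx mevalN hp.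
- by move=> t1 IH1 c /IH1[p hp]; exists (p *+ c) => A; rewrite /eval_mx mevalMn hp.
- move=> t1 IH1 t2 IH2 /andP[/IH1[p hp] /IH2[q hq]].
  by exists (p * q) => A; rewrite /eval_mx mevalM hp hq.
- move=> t1 IH1 c /IH1[p hp]; exists (p ^+ c) => A.
  by rewrite /eval_mx rmorphXn /= hp.
Qed.

Lemma semialgebraic_gt m k (t1 t2 : GRing.term R) : GRing.rterm t1 -> GRing.rterm t2 ->
  semialgebraic [set A : 'M[R]_(m, k) | GRing.eval (env A) t1 < GRing.eval (env A) t2].
Proof.
move=> /(term_mpoly m k)[p hp] /(term_mpoly m k)[q hq].
apply: semialgebraic_ext (semialgebraic_pos (q - p)) => A /=.
by rewrite hp hq /eval_mx mevalB subr_gt0.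
Qed.

Lemma semialgebraic_qf m k (f : ord.formula R) : ord.qf_form f -> ord.rformula f ->
  semialgebraic [set A : 'M[R]_(m, k) | ord.qf_eval (env A) f].
Proof.
have le (t1 t2 : GRing.term R) : GRing.rterm t1 -> GRing.rterm t2 ->
    semialgebraic [set A : 'M[R]_(m, k) | GRing.eval (env A) t1 <= GRing.eval (env A) t2].
  move=> r1 r2; apply: semialgebraic_ext (semialgebraic_setC (semialgebraic_gt m k r2 r1)) => A.
  by rewrite /= leNgt; split=> /negP.
elim: f => //=.
- by move=> b _ _; exact: semialgebraic_const.
- move=> t1 t2 _ /andP[r1 r2].
  apply: semialgebraic_ext (semialgebraic_setI (le _ _ r1 r2) (le _ _ r2 r1)) => A /=.
  by rewrite eq_le; split=> [[-> ->]|/andP[]].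
- by move=> t1 t2 _ /andP[r1 r2]; exact: semialgebraic_gt.
- by move=> t1 t2 _ /andP[r1 r2]; exact: le.
- move=> f1 IH1 f2 IH2 /andP[q1 q2] /andP[r1 r2].
  apply: semialgebraic_ext (semialgebraic_setI (IH1 q1 r1) (IH2 q2 r2)) => A /=.
  by split=> [[-> ->]|/andP[]].
- move=> f1 IH1 f2 IH2 /andP[q1 q2] /andP[r1 r2].
  apply: semialgebraic_ext (semialgebraic_setU (IH1 q1 r1) (IH2 q2 r2)) => A /=.
  by split=> [[->|->]|/orP]; rewrite ?orbT.
- move=> f1 IH1 f2 IH2 /andP[q1 q2] /andP[r1 r2].
  have s12 := semialgebraic_setU (semialgebraic_setC (IH1 q1 r1)) (IH2 q2 r2).
  apply: semialgebraic_ext s12 => A /=.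
  rewrite implybE; split=> [[/negP -> //|->]|/orP[/negP h|h]]; rewrite ?orbT //.
    by left.
  by right.
- move=> f1 IH1 q1 r1; apply: semialgebraic_ext (semialgebraic_setC (IH1 q1 r1)) => A /=.
  by split=> /negP.
Qed.

(** Quantifier elimination over the real closed field [R] reduces this to quantifier-free
    formulas. *)
Lemma semialgebraic_holds m k (f : ord.formula R) : ord.rformula f ->
  semialgebraic [set A : 'M[R]_(m, k) | ord.holds (env A) f].
Proof.
move=> rf; pose wp := fun n s => qe_rcf.qfr_to_formula (@qe_rcf.wproj R n s).
have /andP[q1 q2] := ord.quantifier_elim_wf (wproj := wp) (@qe_rcf.wf_QE_wproj R) rf.
apply: semialgebraic_ext (semialgebraic_qf m k q1 q2) => A /=.
have := ord.quantifier_elim_rformP (wproj := wp) (@qe_rcf.wf_QE_wproj R)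
  (@qe_rcf.valid_QE_wproj R) (env A) rf.
by move=> h; split=> /h.
Qed.

Definition definable (S : seq R -> Prop) : Prop :=
  exists2 f : ord.formula R, ord.rformula f & forall e, ord.holds e f <-> S e.

Definition polyfun (g : seq R -> R) : Prop :=
  exists2 t : GRing.term R, GRing.rterm t & forall e, GRing.eval e t = g e.

Lemma polyfun_cst c : polyfun (fun=> c).
Proof. by exists (GRing.Const c). Qed.

Lemma polyfunM g h : polyfun g -> polyfun h -> polyfun (fun e => g e * h e).
Proof.
move=> [t rt tg] [u ru uh]; exists (GRing.Mul t u) => [|e] /=; first by rewrite rt.
by rewrite tg uh.
Qed.

Lemma polyfunD g h : polyfun g -> polyfun h -> polyfun (fun e => g e + h e).
Proof.
move=> [t rt tg] [u ru uh]; exists (GRing.Add t u) => [|e] /=; first by rewrite rt.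
by rewrite tg uh.
Qed.

Lemma polyfun_sum (I : finType) (g : I -> seq R -> R) :
  (forall i, polyfun (g i)) -> polyfun (fun e => \sum_i g i e).
Proof.
move=> pg; elim: (index_enum I) => [|i s [t rt th]].
  by exists (GRing.Const 0) => // e; rewrite big_nil.
have [u ru ug] := pg i; exists (GRing.Add u t) => [|e] /=; first by rewrite ru.
by rewrite big_cons ug th.
Qed.

Lemma definable_eq g h : polyfun g -> polyfun h -> definable (fun e => g e = h e).
Proof.
move=> [t rt tg] [u ru uh]; exists (ord.Equal t u) => [|e] /=; first by rewrite rt.
by rewrite tg uh.
Qed.

Lemma definable_lt g h : polyfun g -> polyfun h -> definable (fun e => g e < h e).
Proof.
move=> [t rt tg] [u ru uh]; exists (ord.Lt t u) => [|e] /=; first by rewrite rt.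
by rewrite tg uh.
Qed.

Lemma definable_le g h : polyfun g -> polyfun h -> definable (fun e => g e <= h e).
Proof.
move=> [t rt tg] [u ru uh]; exists (ord.Le t u) => [|e] /=; first by rewrite rt.
by rewrite tg uh.
Qed.

Lemma definableI S T : definable S -> definable T -> definable (fun e => S e /\ T e).
Proof.
move=> [f rf fS] [g rg gT]; exists (ord.And f g) => [|e] /=; first by rewrite rf.
by rewrite fS gT.
Qed.

Lemma definable_forall (I : finType) (S : I -> seq R -> Prop) :
  (forall i, definable (S i)) -> definable (fun e => forall i, S i e).
Proof.
move=> dS; have [f rf fS] : definable (fun e => forall i, i \in enum I -> S i e).
  elim: (enum I) => [|i s [f rf fS]]; first by exists (ord.Bool true).
  have [g rg gS] := dS i; exists (ord.And g f) => [|e] /=; first by rewrite rg.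
  rewrite fS gS; split=> [[h1 h2] j|h]; first by rewrite inE => /orP[/eqP ->|/h2].
  by split=> [|j js]; apply: h; rewrite inE ?eqxx // js orbT.
by exists f => // e; rewrite fS; split=> h i => [|_]; apply: h; rewrite ?mem_enum.
Qed.

(** The projected coordinates follow the entries of the matrix in the environment. Each is bound by
    a quantifier over the first free index, where [set_nth] appends. *)
Lemma semialgebraic_projection m k N (S : seq R -> Prop) : definable S ->
  semialgebraic [set A : 'M[R]_(m, k) | exists s, size s = N /\ S (env A ++ s)].
Proof.
move=> [f rf fS].
have [g rg hg] : exists2 g : ord.formula R, ord.rformula g &
    forall e, size e = (m * k)%N ->
      ord.holds e g <-> exists s, size s = N /\ S (e ++ s).
  elim: N (m * k)%N => [|N IH] o.
    exists f => // e _; rewrite fS; split=> [Se|[s [/size0nil ->]]]; last by rewrite cats0.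
    by exists [::]; rewrite cats0.
  have [g rg hg] := IH o.+1; exists (ord.Exists o g) => // e eo /=; split.
    move=> [x]; rewrite -eo set_nth_size hg ?size_rcons ?eo // => -[s [sN]].
    by rewrite cat_rcons => Ss; exists (x :: s); rewrite /= sN.
  move=> [[|x s] [//]] [sN] Ss; exists x.
  rewrite -eo set_nth_size hg ?size_rcons ?eo //.
  by exists s; rewrite cat_rcons.
apply: semialgebraic_ext (semialgebraic_holds m k rg) => A.
by rewrite /= hg ?size_env.
Qed.

End TarskiSeidenberg.

(** * Incidence structure of polygons *)

Section Polygon.
Context {R : realType}.
Local Open Scope classical_set_scope.

Lemma vertex_not_between (P : set 'cV[R]_2) x y z t : vertices P x -> P y -> P z ->
  0 < t < 1 -> x = (1 - t) *: y + t *: z -> y = z.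
Proof.
move=> [c [d [cP cx]]] Py Pz /andP[t0 t1] ex.
have [_ xd] : P x /\ (c *m x) 0 0 = d by have : [set x] x by []; rewrite cx.
have yd := cP _ Py; have zd := cP _ Pz.
have ed : (1 - t) * (c *m y) 0 0 + t * (c *m z) 0 0 = d.
  by rewrite -xd ex mulmxDr -!scalemxAr [RHS]mxE [X in _ = X + _]mxE [X in _ = _ + X]mxE.
have yE : (c *m y) 0 0 = d by nra.
have zE : (c *m z) 0 0 = d by nra.
have -> : y = x by have : [set x] y by rewrite cx.
by have : [set x] z by rewrite cx.
Qed.

Definition point n (V : 'M[R]_(n, 2)) j : 'cV[R]_2 := (row j V)^T.

Lemma mulmxD_entry n d (A : 'M[R]_(n, d)) (x y : 'cV[R]_d) i :
  (A *m (x + y)) i 0 = (A *m x) i 0 + (A *m y) i 0.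
Proof. by rewrite mulmxDr mxE. Qed.

Lemma mulmxZ_entry n d (A : 'M[R]_(n, d)) a (x : 'cV[R]_d) i :
  (A *m (a *: x)) i 0 = a * (A *m x) i 0.
Proof. by rewrite -scalemxAr mxE. Qed.

Lemma mulmxB_entry n d (A : 'M[R]_(n, d)) (x y : 'cV[R]_d) i :
  (A *m (x - y)) i 0 = (A *m x) i 0 - (A *m y) i 0.
Proof. by rewrite mulmxBr mxE [X in _ + X]mxE. Qed.

Definition det2 n (A : 'M[R]_(n, 2)) i i' := A i 0 * A i' 1 - A i 1 * A i' 0.

Lemma mulmx2E n (A : 'M[R]_(n, 2)) (x : 'cV[R]_2) i :
  (A *m x) i 0 = A i 0 * x 0 0 + A i 1 * x 1 0.
Proof. by rewrite mxE sum2. Qed.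

Lemma mul_trmxE n m (A : 'M[R]_(n, 2)) (V : 'M[R]_(m, 2)) i j :
  (A *m V^T) i j = (A *m point V j) i 0.
Proof. by rewrite !mxE; apply: eq_bigr => a _; rewrite !mxE. Qed.

Lemma col2P (x y : 'cV[R]_2) : x 0 0 = y 0 0 -> x 1 0 = y 1 0 -> x = y.
Proof.
move=> h0 h1; apply/matrixP => a b; rewrite ord1.
have [->|->] // : a = 0 \/ a = 1.
by case: a => -[|[|//]] ?; [left|right]; apply: val_inj.
Qed.

Lemma solve2 n (A : 'M[R]_(n, 2)) i i' (x y : 'cV[R]_2) s : det2 A i i' != 0 ->
  (A *m x) i 0 = s * (A *m y) i 0 -> (A *m x) i' 0 = s * (A *m y) i' 0 -> x = s *: y.
Proof.
rewrite /det2 !mulmx2E => d0 h h'; apply: col2P; rewrite mxE; apply: (mulfI d0).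
  transitivity (A i' 1 * (A i 0 * x 0 0 + A i 1 * x 1 0)
    - A i 1 * (A i' 0 * x 0 0 + A i' 1 * x 1 0)); first by ring.
  by rewrite h h'; ring.
transitivity (A i 0 * (A i' 0 * x 0 0 + A i' 1 * x 1 0)
  - A i' 0 * (A i 0 * x 0 0 + A i 1 * x 1 0)); first by ring.
by rewrite h h'; ring.
Qed.

(** [T j] is the pair of edges through vertex [j]. There are finitely many such tables, so the
    n-gons form a finite union of sets described by strict inequalities and equations. Injectivity
    says that two vertices do not share both edges. *)
Definition edge_config n (T : {ffun 'I_n -> {set 'I_n}}) : Prop :=
  [/\ forall j, #|T j| = 2%N, forall i, #|[set j | i \in T j]%SET| = 2%N & injective T].

Definition realizes n (T : {ffun 'I_n -> {set 'I_n}}) (A V : 'M[R]_(n, 2)) : Prop :=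
  forall i j, (i \in T j -> (A *m V^T) i j = 1) /\ (i \notin T j -> (A *m V^T) i j < 1).

Section Realize.
Variables (n : nat) (T : {ffun 'I_n -> {set 'I_n}}) (A V : 'M[R]_(n, 2)).
Hypotheses (n_gt0 : (0 < n)%N) (cT : edge_config T) (rT : realizes T A V).

Lemma realizes_tight i j : i \in T j -> (A *m point V j) i 0 = 1.
Proof. by rewrite -mul_trmxE; have [] := rT i j. Qed.

Lemma realizes_slack i j : i \notin T j -> (A *m point V j) i 0 < 1.
Proof. by rewrite -mul_trmxE; have [] := rT i j. Qed.

Lemma realizes_le i j : (A *m point V j) i 0 <= 1.
Proof.
have [/realizes_tight -> //|/realizes_slack] := boolP (i \in T j); exact: ltW.
Qed.

Lemma config_edge i j : i \in T j -> exists k i', [/\ i \in T k, k != j, i' \in T j, i' \notin T k &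
  forall l, l \in T j -> l = i \/ l = i'].
Proof.
have [T2 d2 Tinj] := cT; move=> iTj.
have /cards2P[k1 [k2 [k12 e]]] := introT eqP (d2 i).
have [k [ik kj]] : exists k, i \in T k /\ k != j.
  have h l : (i \in T l) = (l \in [set k1; k2]%SET) by rewrite -e inE.
  have [jk1|jk1] := eqVneq k1 j.
    by exists k2; rewrite h finset.set22 -jk1 eq_sym.
  by exists k1; rewrite h finset.set21.
have /cards2P[i1 [i2 [i12 eT]]] := introT eqP (T2 j).
have [i' [i'T i'i Tj]] : exists i', [/\ i' \in T j, i' != i & T j = [set i; i']%SET].
  move: iTj; rewrite eT => /set2P[->|->].
    by exists i2; rewrite finset.set22 eq_sym.
  by exists i1; rewrite finset.set21 finset.setUC.
exists k, i'; split => //; last by move=> l; rewrite Tj => /set2P.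
apply/negP => i'k; move/negP: kj; apply; apply/eqP/Tinj/esym/eqP.
rewrite eqEcard !T2 leqnn andbT Tj; apply/fintype.subsetP => l /set2P[] -> //.
Qed.

(** Proportional rows that both take the value 1 at vertex [j] would be equal, but at the other end
    of edge [i] the row [i'] is below 1. *)
Lemma realizes_det j i i' : i \in T j -> i' \in T j -> i != i' -> det2 A i i' != 0.
Proof.
move=> iT i'T ii'; have [k [i2 [ik kj i2T i2k Tj]]] := config_edge iT.
have e2 : i' = i2 by have [e|//] := Tj i' i'T; rewrite e eqxx in ii'.
have := realizes_tight iT; have := realizes_tight i'T; have := realizes_tight ik.
have := realizes_slack i2k; rewrite -e2 /det2 !mulmx2E => hlt hk h' h.
apply/negP => /eqP d0; set p := point V j in h h' *; set q := point V k in hk hlt *.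
have a0 : A i 0 = A i' 0.
  have -> : A i 0 = A i 0 * (A i' 0 * p 0 0 + A i' 1 * p 1 0) by rewrite h' mulr1.
  transitivity (A i' 0 * (A i 0 * p 0 0 + A i 1 * p 1 0)
    + (A i 0 * A i' 1 - A i 1 * A i' 0) * p 1 0); first by ring.
  by rewrite d0 h mul0r addr0 mulr1.
have a1 : A i 1 = A i' 1.
  have -> : A i 1 = A i 1 * (A i' 0 * p 0 0 + A i' 1 * p 1 0) by rewrite h' mulr1.
  transitivity (A i' 1 * (A i 0 * p 0 0 + A i 1 * p 1 0)
    - (A i 0 * A i' 1 - A i 1 * A i' 0) * p 0 0); first by ring.
  by rewrite d0 h mul0r subr0 mulr1.
by move: hlt; rewrite -a0 -a1 hk ltxx.
Qed.

Lemma realizes_solve j i i' (x : 'cV[R]_2) s : i \in T j -> i' \in T j -> i != i' ->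
  (A *m x) i 0 = s -> (A *m x) i' 0 = s -> x = s *: point V j.
Proof.
move=> iT i'T ii' h h'; apply: (solve2 (realizes_det iT i'T ii')).
  by rewrite h (realizes_tight iT) mulr1.
by rewrite h' (realizes_tight i'T) mulr1.
Qed.

Lemma config_vertex j : exists i i', [/\ i \in T j, i' \in T j & i != i'].
Proof.
have [T2 _ _] := cT; have /cards2P[i [i' [ii' ->]]] := introT eqP (T2 j).
by exists i, i'; rewrite finset.set21 finset.set22.
Qed.

Lemma point_inj : injective (point V).
Proof.
move=> j k e; have [_ _ Tinj] := cT; apply: Tinj; apply/setP => i.
have [ij|ij] := boolP (i \in T j); have [ik|ik] := boolP (i \in T k) => //.
  by have := realizes_slack ik; rewrite -e realizes_tight // ltxx.
by have := realizes_slack ij; rewrite e realizes_tight // ltxx.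
Qed.

(** Solving the two tight equations at two distinct vertices gives [x] as [s] times each of them. *)
Lemma homogeneous_inj (x : 'cV[R]_2) s : (forall i, s - (A *m x) i 0 = 0) -> s = 0 /\ x = 0.
Proof.
move=> h; have {}h i : (A *m x) i 0 = s by have /eqP := h i; rewrite subr_eq0 => /eqP.
pose j := Ordinal n_gt0; have [i [i' [iT i'T ii']]] := config_vertex j.
have [k [i2 [ik kj i2T i2k Tj]]] := config_edge iT.
have [l [l' [lT l'T ll']]] := config_vertex k.
have xj := realizes_solve iT i'T ii' (h i) (h i').
have xk := realizes_solve lT l'T ll' (h l) (h l').
have s0 : s = 0.
  apply/eqP; apply: contraT => s0.
  have /(scalerI s0)/point_inj ejk : s *: point V j = s *: point V k by rewrite -xj -xk.
  by rewrite ejk eqxx in kj.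
by split => //; rewrite xj s0 scale0r.
Qed.

(** The cone over the polygon is generated by the lifted vertices. A support-minimal slack vector
    has a zero, hence lies over an edge, and is there a combination of the two ends. The homogeneous
    form with arbitrary [s0] also yields boundedness. *)
Lemma homogeneous_comb s0 (x : 'cV[R]_2) : (forall i, 0 <= s0 - (A *m x) i 0) ->
  exists w : 'I_n -> R, [/\ forall j, 0 <= w j, s0 = \sum_j w j &
    x = \sum_j w j *: point V j].
Proof.
move=> Ax; pose sl s (z : 'cV[R]_2) : 'cV[R]_n := \col_i (s - (A *m z) i 0).
have slE s z i : sl s z i 0 = s - (A *m z) i 0 by rewrite mxE.
have slD a s z s' z' : sl (a * s + s') (a *: z + z') = a *: sl s z + sl s' z'.
  apply/matrixP => i b; rewrite ord1 [RHS]mxE [X in _ = X + _]mxE !slE.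
  by rewrite mulmxD_entry mulmxZ_entry; ring.
pose U (y : 'cV[R]_n) := exists s z, y = sl s z.
have Usub : subsp U.
  split; last by move=> a _ _ [s [z ->]] [s' [z' ->]]; eexists; eexists; rewrite -slD.
  by exists 0, 0; apply/matrixP => i b; rewrite ord1 slE mulmx0 !mxE subrr.
have sl0 s z : sl s z = 0 -> s = 0 /\ z = 0.
  move=> e; apply: homogeneous_inj => i.
  by have /matrixP/(_ i 0) := e; rewrite slE [RHS]mxE.
have [||es mes ex] := min_decomp Usub (y := sl s0 x); first by exists s0, x.
  by move=> i; rewrite slE.
pose comb (y : 'cV[R]_n) := exists2 w : 'I_n -> R, forall j, 0 <= w j &
  y = sl (\sum_j w j) (\sum_j w j *: point V j).
have comb_min e : e \in es -> comb e.
  move=> /mes[[s [z ez0]] e0 eN0 emin]; rewrite {e}ez0 in e0 eN0 emin *.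
  (* A minimal vector of full support would have all of [U] as its multiples, but the slacks of (1,
     0) and (0, (1, 1)) are independent. *)
  have [i ei] : exists i, sl s z i 0 = 0.
    apply: contrapT => h.
    have sub (y : 'cV[R]_n) : supp y \subset supp (sl s z).
      by apply/fintype.subsetP => i _; rewrite inE; apply/eqP => hi; apply: h; exists i.
    have [a ea] := emin (sl 0 (const_mx 1)) (ex_intro _ 0 (ex_intro _ (const_mx 1) erefl)) (sub _).
    have [b eb] := emin (sl 1 0) (ex_intro _ 1 (ex_intro _ 0 erefl)) (sub _).
    have b0 : b != 0.
      apply/eqP => b0; have : sl 1 0 = 0 by rewrite eb b0 scale0r.
      by move=> /sl0[/eqP]; rewrite oner_eq0.
    have : sl (- (a / b) * 1 + 0) (- (a / b) *: 0 + const_mx 1) = 0.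
      by rewrite slD eb ea scalerA mulNr divfK // -scalerDl addNr scale0r.
    move=> /sl0[_]; rewrite scaler0 add0r => /matrixP/(_ 0 0)/eqP.
    by rewrite !mxE oner_eq0.
  have [_ d2 _] := cT.
  have /card_gt0P[j] : (0 < #|[set j | i \in T j]%SET|)%N by rewrite d2.
  rewrite inE => ij; have [k [i2 [ik kj i2j i2k Tj]]] := config_edge ij.
  have [k' [i3 [ik' kk' i3k i3k' Tk]]] := config_edge ik.
  have i2i : i != i2 by apply: contraNneq i2k => <-.
  have i3i : i != i3 by apply: contraNneq i3k' => <-.
  have i3j : i3 \notin T j.
    apply/negP => /Tj[e|e]; first by rewrite e eqxx in i3i.
    by move: i2k; rewrite -e i3k.
  pose yj := sl 1 (point V j); pose yk := sl 1 (point V k).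
  have yjE l : yj l 0 = 1 - (A *m point V j) l 0 by rewrite slE.
  have ykE l : yk l 0 = 1 - (A *m point V k) l 0 by rewrite slE.
  have yj3 : 0 < yj i3 0 by rewrite yjE subr_gt0 realizes_slack.
  have yk2 : 0 < yk i2 0 by rewrite ykE subr_gt0 realizes_slack.
  (* The coefficients of the ends [j] and [k] of edge [i], read off at the other edge through the
     opposite end. What remains vanishes on [i], [i2] and [i3], hence is zero. *)
  pose al := sl s z i3 0 / yj i3 0; pose be := sl s z i2 0 / yk i2 0.
  have al0 : 0 <= al by rewrite divr_ge0 // ltW.
  have be0 : 0 <= be by rewrite divr_ge0 // ltW.
  pose s' := s - al - be; pose z' := z - al *: point V j - be *: point V k.
  have dE l : s' - (A *m z') l 0 = sl s z l 0 - al * yj l 0 - be * yk l 0.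
    by rewrite yjE ykE slE /z' /s' !mulmxB_entry !mulmxZ_entry; ring.
  have tight l : sl s z l 0 - al * yj l 0 - be * yk l 0 = 0 -> (A *m z') l 0 = s'.
    by rewrite -dE => /eqP; rewrite subr_eq0 => /eqP.
  have ti : (A *m z') i 0 = s'.
    by apply: tight; rewrite ei yjE ykE !realizes_tight // subrr !mulr0 !subr0.
  have t2 : (A *m z') i2 0 = s'.
    apply: tight; rewrite yjE realizes_tight // subrr mulr0 subr0.
    by rewrite /be divfK ?subrr // gt_eqF.
  have t3 : (A *m z') i3 0 = s'.
    apply: tight; rewrite ykE realizes_tight // subrr mulr0 subr0.
    by rewrite /al divfK ?subrr // gt_eqF.
  have zj := realizes_solve ij i2j i2i ti t2.
  have zk := realizes_solve ik i3k i3i ti t3.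
  have s'0 : s' = 0.
    apply/eqP; apply: contraT => s'0; have /(scalerI s'0)/point_inj ejk :
      s' *: point V j = s' *: point V k by rewrite -zj -zk.
    by rewrite ejk eqxx in kj.
  exists (fun l => al *+ (l == j) + be *+ (l == k)).
    by move=> l; rewrite addr_ge0 // mulrn_wge0.
  have sab : s = al + be by have := s'0; rewrite /s'; lra.
  have ez : z = al *: point V j + be *: point V k.
    have : z' = 0 by rewrite zj s'0 scale0r.
    by rewrite /z' -addrA -opprD => /eqP; rewrite subr_eq0 => /eqP.
  have pick (f : 'I_n -> 'cV[R]_2) (a : R) j0 : \sum_l (a *+ (l == j0)) *: f l = a *: f j0.
    rewrite (bigD1 j0) //= eqxx mulr1n big1 ?addr0 // => l /negbTE ->.
    by rewrite mulr0n scale0r.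
  have pick1 (a : R) j0 : \sum_l (a *+ (l == j0)) = a.
    rewrite (bigD1 j0) //= eqxx mulr1n big1 ?addr0 // => l /negbTE ->.
    by rewrite mulr0n.
  rewrite big_split /= !pick1 -sab; congr (sl s _).
  by under eq_bigr do rewrite scalerDl; rewrite big_split /= !pick -ez.
have [w w0 ew] : comb (sl s0 x).
  rewrite ex; elim: (es) comb_min => [_|e es' IH hes].
    exists (fun=> 0) => //; rewrite big_nil big1 // big1 => [|j _]; last by rewrite scale0r.
    by apply/matrixP => i b; rewrite ord1 slE mulmx0 !mxE subrr.
  have [w w0 ->] := hes e (mem_head _ _).
  have [|w' w'0 ew'] := IH; first by move=> e' h; apply: hes; rewrite inE h orbT.
  exists (fun j => w j + w' j); first by move=> j; rewrite addr_ge0.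
  rewrite big_cons ew' -[X in X + _]scale1r -slD mul1r scale1r -!big_split /=.
  by congr (sl _ _); apply: eq_bigr => j _; rewrite scalerDl.
have /sl0[/eqP w1 /eqP xw] : sl (s0 - \sum_j w j) (x - \sum_j w j *: point V j) = 0.
  have := slD (-1) (\sum_j w j) (\sum_j w j *: point V j) s0 x.
  by rewrite -ew mulN1r !scaleN1r addNr (addrC _ s0) (addrC _ x).
by exists w; split => //; apply/eqP; rewrite -subr_eq0.
Qed.

Lemma poly_of_realizes : poly_of A = conv_hull (point V).
Proof.
apply/seteqP; split=> x.
  move=> Ax; have [|w [w0 w1 ->]] := @homogeneous_comb 1 x.
    by move=> i; rewrite subr_ge0.
  by exists w.
move=> [w [w0 w1 ->]] i; rewrite mulmx_sumr summxE -w1; apply: ler_sum => j _.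
by rewrite -scalemxAr mxE ler_piMr // realizes_le.
Qed.

Lemma realizes_vertices j : vertices (poly_of A) (point V j).
Proof.
have [i [i' [iT i'T ii']]] := config_vertex j.
exists (row i A + row i' A), 2.
have rE l (x : 'cV[R]_2) : (row l A *m x) 0 0 = (A *m x) l 0.
  by rewrite !mxE; apply: eq_bigr => a _; rewrite mxE.
have sE (x : 'cV[R]_2) : ((row i A + row i' A) *m x) 0 0 = (A *m x) i 0 + (A *m x) i' 0.
  by rewrite mulmxDl [LHS]mxE; congr (_ + _); exact: rE.
split=> [x Px|]; first by rewrite sE; have := Px i; have := Px i'; lra.
apply/seteqP; split=> [_ ->|x [Px]] /=.
  split; first by move=> l; exact: realizes_le.
  by rewrite sE !realizes_tight.
rewrite sE => h; have hi := Px i; have hi' := Px i'.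
by rewrite (@realizes_solve j i i' x 1) ?scale1r //; lra.
Qed.

Lemma ngon_of_config : ngon_space n A.
Proof.
split.
- by exists n, (point V); exact: poly_of_realizes.
- rewrite poly_of_realizes affdim_conv; suff -> : \rank (homs (point V)) = 3%N by [].
  apply/eqP; rewrite -[_ == _]/(row_free (homs (point V))) -kermx_eq0.
  apply/rowV0P => g /sub_kermxP g0.
  have {}g0 j : (g *m hom (point V j)) 0 0 = 0 by rewrite -mul_homs g0 mxE.
  move: g0; rewrite (row_mx_split g); set c := lsubmx g; set b := rsubmx g 0 0 => g0.
  have {}g0 j : (c *m point V j) 0 0 = - b.
    by have /eqP := g0 j; rewrite mul_row_hom addr_eq0 => /eqP.
  pose j := Ordinal n_gt0; have [i [i0 [iT _ _]]] := config_vertex j.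
  have [k [i' [ik kj i'T i'k Tj]]] := config_edge iT.
  have [k' [i2 [i'k' k'j i2T i2k' Tj']]] := config_edge i'T.
  have ii' : i != i' by apply: contraNneq i'k => <-.
  have i2i : i2 = i.
    have [//|e] := Tj _ i2T; by move: i2k'; rewrite e i'k'.
  rewrite {}i2i in i2T i2k'.
  have d0 := realizes_det iT i'T ii'.
  (* Coordinates of [c] in the basis of rows [i], [i']. Comparing vertex [j] with the other end of
     each of the two edges makes them vanish. *)
  pose al := (c 0 0 * A i' 1 - c 0 1 * A i' 0) / det2 A i i'.
  pose be := (A i 0 * c 0 1 - A i 1 * c 0 0) / det2 A i i'.
  have cE (x : 'cV[R]_2) : (c *m x) 0 0 = al * (A *m x) i 0 + be * (A *m x) i' 0.
    by rewrite !mulmx2E /al /be /det2; field.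
  have e1 := g0 j; have e2 := g0 k; have e3 := g0 k'.
  rewrite cE !realizes_tight // in e1; rewrite cE (realizes_tight ik) in e2.
  rewrite cE (realizes_tight i'k') in e3.
  have l2 := realizes_slack i'k; have l3 := realizes_slack i2k'.
  have be0 : be = 0.
    apply: (mulIf (_ : (A *m point V k) i' 0 - 1 != 0)); first by rewrite subr_eq0 lt_eqF.
    by rewrite mul0r; lra.
  have al0 : al = 0.
    apply: (mulIf (_ : (A *m point V k') i 0 - 1 != 0)); first by rewrite subr_eq0 lt_eqF.
    by rewrite mul0r; lra.
  have b0 : b = 0 by move: e1; rewrite al0 be0; lra.
  have c0 : c = 0.
    apply/matrixP => a z; rewrite ord1; have := cE (delta_mx z 0).
    rewrite al0 be0 !mul0r addr0 -colE => h.
    by move: h; rewrite mxE => ->; rewrite mxE.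
  rewrite c0 b0; have -> : const_mx 0 = 0 :> 'rV[R]_1 by apply/matrixP => a z; rewrite !mxE.
  exact: row_mx0.
- rewrite card_eq_sym; apply/card_set_bijP.
  exists (fun l => if insub l is Some j then point V j else 0); split.
  + by move=> l /= ln; rewrite insubT; exact: realizes_vertices.
  + move=> l l' /set_mem/= ln /set_mem/= ln'; rewrite !insubT => /point_inj e.
    by have := congr1 val e.
  + move=> x; rewrite poly_of_realizes => /vertex_of_conv[l <-].
    by exists l; rewrite /= ?valK.
Qed.

End Realize.
End Polygon.

(** * Every n-gon realizes an incidence table *)

Section PolygonConverse.
Context {R : realType}.
Local Open Scope classical_set_scope.

(** Otherwise some direction is orthogonal to all tight rows, and [p] is the midpoint of a short
    segment inside the polygon. *)
Lemma tight_independent n (A : 'M[R]_(n, 2)) p : vertices (poly_of A) p ->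
  exists i i', [/\ (A *m p) i 0 = 1, (A *m p) i' 0 = 1 & det2 A i i' != 0].
Proof.
move=> vp; have Pp : poly_of A p.
  by have [c [d [_ e]]] := vp; have : [set p] p by []; rewrite e => -[].
apply: contrapT => h.
have d0 i i' : (A *m p) i 0 = 1 -> (A *m p) i' 0 = 1 -> det2 A i i' = 0.
  by move=> hi hi'; apply/eqP; apply: contraT => d; case: h; exists i, i'.
have [u [u0 hu]] : exists u : 'cV[R]_2, u != 0 /\ forall i, (A *m p) i 0 = 1 -> (A *m u) i 0 = 0.
  have [[i0 hi0]|no] := pselect (exists i, (A *m p) i 0 = 1).
    exists (\col_a (if a == 0 then - A i0 1 else A i0 0)); split.
      apply/eqP => /matrixP e; have := e 0 0; have := e 1 0; rewrite !mxE /= => a0 a1.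
      move: hi0; rewrite mulmx2E a0 (_ : A i0 1 = 0) ?mul0r ?addr0; last by lra.
      by move/eqP; rewrite eq_sym oner_eq0.
    move=> i hi; rewrite mulmx2E !mxE /=.
    by have := d0 i i0 hi hi0; rewrite /det2 => d; rewrite -[RHS]oppr0 -d; ring.
  exists (const_mx 1); split; last by move=> i hi; case: no; exists i.
  by apply/eqP => /matrixP/(_ 0 0)/eqP; rewrite !mxE oner_eq0.
have slack i : (A *m p) i 0 != 1 -> 0 < 1 - (A *m p) i 0.
  by move=> hi; rewrite subr_gt0 lt_neqAle hi Pp.
have [eps eps0 heps] := small_multiple (fun i => (A *m u) i 0) slack.
have Pu s : `|s| <= eps -> poly_of A (p + s *: u).
    move=> hs i; rewrite mulmxD_entry mulmxZ_entry.
    have [e|ne] := eqVneq ((A *m p) i 0) 1; first by rewrite hu // mulr0 addr0 e.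
    have h1 := heps i ne; have h2 : `|s * (A *m u) i 0| <= eps * `|(A *m u) i 0|.
      by rewrite normrM ler_wpM2r.
    by have := ler_norm (s * (A *m u) i 0); lra.
have := @vertex_not_between R (poly_of A) p (p + (- eps) *: u) (p + eps *: u) (1 / 2) vp.
move/(_ (Pu _ _) (Pu _ _)).
rewrite normrN ger0_norm ?(ltW eps0) // => /(_ (lexx _) (lexx _)) H.
have /addrI/eqP : p + (- eps) *: u = p + eps *: u.
    apply: H; first by apply/andP; split; lra.
    by apply/matrixP => a b; rewrite !mxE; field.
rewrite -subr_eq0 -scalerBl scaler_eq0 (negbTE u0) orbF => /eqP h0; lra.
Qed.

(** [g] is a coordinate along the line; among three vertices the middle one would lie strictly
    between two points of [P]. *)
Lemma line_two_vertices (P : set 'cV[R]_2) (a : 'rV[R]_2) b m (p : 'I_m -> 'cV[R]_2)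
    (S : {set 'I_m}) : a != 0 -> injective p ->
  (forall j, j \in S -> vertices P (p j) /\ (a *m p j) 0 0 = b) -> (#|S| <= 2)%N.
Proof.
move=> aN0 pinj hS; rewrite leqNgt; apply/negP => S3.
pose g j := a 0 0 * p j 1 0 - a 0 1 * p j 0 0.
have a0 : a 0 0 ^+ 2 + a 0 1 ^+ 2 != 0.
  apply: contraNneq aN0 => e.
  have h0 : a 0 0 = 0 by nra.
  have h1 : a 0 1 = 0 by nra.
  apply/eqP/trmx_inj/col2P; by rewrite !mxE.
have line (x y : 'cV[R]_2) : (a *m x) 0 0 = (a *m y) 0 0 ->
    a 0 0 * x 1 0 - a 0 1 * x 0 0 = a 0 0 * y 1 0 - a 0 1 * y 0 0 -> x = y.
  rewrite !mulmx2E => e1 e2; apply: col2P; apply: (mulfI a0).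
    transitivity (a 0 0 * (a 0 0 * x 0 0 + a 0 1 * x 1 0)
      - a 0 1 * (a 0 0 * x 1 0 - a 0 1 * x 0 0)); first by ring.
    by rewrite e1 e2; ring.
  transitivity (a 0 1 * (a 0 0 * x 0 0 + a 0 1 * x 1 0)
    + a 0 0 * (a 0 0 * x 1 0 - a 0 1 * x 0 0)); first by ring.
  by rewrite e1 e2; ring.
have ginj j j' : j \in S -> j' \in S -> g j = g j' -> j = j'.
  move=> /hS[_ h] /hS[_ h'] e; apply: pinj; apply: line => //; by rewrite h h'.
have /card_gt0P[j0 j0S] : (0 < #|S|)%N by exact: ltn_trans S3.
case: (@arg_minP _ _ _ j0 (mem S) g j0S) => j1 j1S min1.
case: (@arg_maxP _ _ _ j0 (mem S) g j0S) => j3 j3S max3.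
have [j2 [j2S j21 j23]] : exists j2, [/\ j2 \in S, j2 != j1 & j2 != j3].
  have : (0 < #|S :\: [set j1; j3]%SET|)%N.
    rewrite cardsD subn_gt0; apply: leq_ltn_trans (subset_leq_card (subsetIr _ _)) _.
    by apply: leq_ltn_trans S3; rewrite cards2; case: eqP.
  by move=> /card_gt0P[j]; rewrite !inE negb_or => /andP[/andP[? ?] ?]; exists j.
have lt12 : g j1 < g j2.
  by rewrite lt_neqAle min1 // andbT; apply: contraNneq j21 => /ginj ->.
have lt23 : g j2 < g j3.
  by rewrite lt_neqAle [_ <= _]max3 // andbT; apply: contraNneq j23 => /ginj ->.
pose t := (g j2 - g j1) / (g j3 - g j1).
have d0 : 0 < g j3 - g j1 by lra.
have t0 : 0 < t by rewrite divr_gt0 //; lra.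
have t1 : t < 1 by rewrite ltr_pdivrMr //; lra.
have [v1 h1] := hS _ j1S; have [v2 h2] := hS _ j2S; have [v3 h3] := hS _ j3S.
have inP x : vertices P x -> P x.
  by move=> [c [d [_ e]]]; have : [set x] x by []; rewrite e => -[].
have e : p j2 = (1 - t) *: p j1 + t *: p j3.
  apply: line; first by rewrite mulmxD_entry !mulmxZ_entry h1 h2 h3; ring.
  rewrite !mxE -/(g j2).
  transitivity ((1 - t) * g j1 + t * g j3); last by rewrite /g; ring.
  have : t * (g j3 - g j1) = g j2 - g j1 by rewrite /t divfK // gt_eqF.
  by lra.
have := vertex_not_between v2 (inP _ v1) (inP _ v3) (introT andP (conj t0 t1)) e.
by move=> /pinj e13; move: d0; rewrite e13 subrr ltxx.
Qed.

(** Each of the n vertices lies on at least two edges and each of the n rows is tight at no more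
    than two vertices; double counting forces equality everywhere. *)
Lemma config_of_ngon n (A : 'M[R]_(n, 2)) : ngon_space n A ->
  exists T V, edge_config T /\ realizes T A V.
Proof.
move=> [_ _]; rewrite card_eq_sym => /card_set_bijP[f [fI finj _]].
pose p (j : 'I_n) := f j.
have pinj : injective p.
  move=> j k e; apply: val_inj; apply: finj => //; exact/mem_set/ltn_ord.
have vp j : vertices (poly_of A) (p j) by apply: fI; exact: ltn_ord.
pose V : 'M[R]_(n, 2) := \matrix_(j, a) p j a 0.
have Vp j : point V j = p j by apply/matrixP => a b; rewrite ord1 !mxE.
pose T : {ffun 'I_n -> {set 'I_n}} := [ffun j => [set i | (A *m p j) i 0 == 1]%SET].
have TE i j : (i \in T j) = ((A *m p j) i 0 == 1) by rewrite ffunE inE.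
have Tge j : (2 <= #|T j|)%N.
  have [i [i' [hi hi' d0]]] := tight_independent (vp j).
  have ii' : i != i' by apply: contraNneq d0 => ->; rewrite /det2 mulrC subrr.
  have <- : #|[set i; i']%SET| = 2%N by rewrite cards2 ii'.
  apply: subset_leq_card; apply/fintype.subsetP => l.
  by rewrite !inE TE => /orP[/eqP ->|/eqP ->]; rewrite ?hi ?hi' eqxx.
have dle i : (#|[set j | i \in T j]%SET| <= 2)%N.
  have rowE j : (A *m p j) i 0 = (row i A *m p j) 0 0.
    by rewrite -row_mul [RHS]mxE.
  have [r0|rN0] := eqVneq (row i A) 0.
    rewrite (_ : [set j | i \in T j]%SET = finset.set0) ?cards0 //.
    by apply/setP => j; rewrite !inE TE rowE r0 mul0mx mxE eq_sym oner_eq0.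
  apply: (line_two_vertices (b := 1) rN0 pinj) => j; rewrite inE TE => /eqP h.
  by rewrite -rowE.
have dbl : (\sum_j #|T j| = \sum_i #|[set j | i \in T j]%SET|)%N.
  under eq_bigr do rewrite -sum1_card big_mkcond /=.
  rewrite exchange_big /=; apply: eq_bigr => i _.
  by rewrite -sum1_card [RHS]big_mkcond /=; apply: eq_bigr => j _; rewrite inE.
have s1 : (\sum_(j < n) 2 <= \sum_j #|T j|)%N by apply: leq_sum => j _.
have s2 : (\sum_i #|[set j | i \in T j]%SET| <= \sum_(j < n) 2)%N by apply: leq_sum => j _.
have T2 j : #|T j| = 2%N.
  have [_] : (\sum_(j < n) 2 <= \sum_j #|T j| ?= iff [forall j, (2 == #|T j|)%N])%N.
    by apply: leqif_sum => l _; split.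
  rewrite eqn_leq s1 dbl s2 => /esym/forallP/(_ j)/eqP; by [].
have d2 i : #|[set j | i \in T j]%SET| = 2%N.
  have [_] : (\sum_i #|[set j | i \in T j]%SET| <= \sum_(j < n) 2
      ?= iff [forall i, (#|[set j | i \in T j]%SET| == 2)%N])%N.
    by apply: leqif_sum => l _; split.
  by rewrite eqn_leq s2 -dbl s1 => /esym/forallP/(_ i)/eqP.
exists T, V; split.
  split=> // j k ejk; apply: pinj.
  have [i [i' [hi hi' d0]]] := tight_independent (vp j).
  have := TE i k; have := TE i' k; rewrite -ejk !TE hi hi' eqxx => /esym/eqP hk' /esym/eqP hk.
  by rewrite -[RHS]scale1r; apply: (solve2 d0); rewrite ?hi ?hi' ?hk ?hk' mulr1.
move=> i j; rewrite mul_trmxE Vp TE; split=> [/eqP //|ne].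
rewrite lt_neqAle ne; have [c [d [_ e]]] := vp j.
by have : [set p j] (p j) by []; rewrite e => -[Pj _]; exact: Pj.
Qed.

End PolygonConverse.

(** * The space of n-gons is open and nonempty *)

Section PolygonSpace.
Context {R : realType}.
Local Open Scope classical_set_scope.

(** For a fixed table the vertices are recomputed from [A] as intersections of their two edges;
    realizing the table then amounts to finitely many strict polynomial inequalities. *)
Lemma ngon_space_open n : (0 < n)%N -> open (@ngon_space R n).
Proof.
move=> n0; rewrite openE => A0 /config_of_ngon[T [V0 [cT rT]]].
have [T2 _ _] := cT.
have /boolp.choice[ii hii] : forall j, exists ii : 'I_n * 'I_n,
    [/\ ii.1 \in T j, ii.2 \in T j, ii.1 != ii.2 & T j = [set ii.1; ii.2]%SET].
  move=> j; have /cards2P[i [i' [ne e]]] := introT eqP (T2 j).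
  by exists (i, i'); rewrite e finset.set21 finset.set22.
pose dt j (A : 'M[R]_(n, 2)) := det2 A (ii j).1 (ii j).2.
pose num j (A : 'M[R]_(n, 2)) i := A i 0 * (A (ii j).2 1 - A (ii j).1 1)
  + A i 1 * (A (ii j).1 0 - A (ii j).2 0).
pose pt (A : 'M[R]_(n, 2)) : 'M[R]_(n, 2) := \matrix_(j, a)
  (if a == 0 then (A (ii j).2 1 - A (ii j).1 1) / dt j A
   else (A (ii j).1 0 - A (ii j).2 0) / dt j A).
have ptE A i j : dt j A != 0 -> (A *m (pt A)^T) i j = num j A i / dt j A.
  by move=> d0; rewrite mul_trmxE mulmx2E !mxE /= /num; field.
have tightE A i j : dt j A != 0 -> i \in T j -> (A *m (pt A)^T) i j = 1.
  move=> d0; have [_ _ _ ->] := hii j; move=> /set2P[] ->; rewrite ptE //.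
    by rewrite (_ : num j A _ = dt j A) ?divff // /num /dt /det2; ring.
  by rewrite (_ : num j A _ = dt j A) ?divff // /num /dt /det2; ring.
(* Multiplying the slack by the square of the determinant clears the denominator without changing
   the sign. *)
pose good j i A := 0 < dt j A ^+ 2 /\
  (i \notin T j -> 0 < dt j A * (dt j A - num j A i)).
have sub : [set A | forall j i, good j i A] `<=` @ngon_space R n.
  move=> A gA; have d0 j : dt j A != 0.
    by have [h _] := gA j (Ordinal n0); apply: contraTneq h => ->; rewrite expr0n ltxx.
  apply: (ngon_of_config n0 cT (V := pt A)) => i j; split; first exact: tightE.
  move=> iT; rewrite ptE //; have [d2 /(_ iT) h] := gA j i.
  rewrite -subr_gt0 -(pmulr_rgt0 _ d2).
  have -> // : dt j A ^+ 2 * (1 - num j A i / dt j A) = dt j A * (dt j A - num j A i).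
    by field.
apply: filterS sub _; rewrite -/(nbhs _ _).
have cD (f g : 'M[R]_(n, 2) -> R) : continuous f -> continuous g -> continuous (fun A => f A + g A).
  by move=> cf cg A; exact: (cvgD (cf A) (cg A)).
have cB (f g : 'M[R]_(n, 2) -> R) : continuous f -> continuous g -> continuous (fun A => f A - g A).
  by move=> cf cg A; exact: (cvgB (cf A) (cg A)).
have cM (f g : 'M[R]_(n, 2) -> R) : continuous f -> continuous g -> continuous (fun A => f A * g A).
  by move=> cf cg A; exact: (cvgM (cf A) (cg A)).
have cc i a : continuous (fun A : 'M[R]_(n, 2) => A i a) := @coord_continuous _ _ _ i a.
have cdt j : continuous (dt j) by apply: (cB); apply: cM; exact: cc.
have cnum j i : continuous (fun A => num j A i).
  by apply: cD; apply: cM; try exact: cc; apply: cB; exact: cc.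
have near_gt (f : 'M[R]_(n, 2) -> R) : continuous f -> 0 < f A0 -> nbhs A0 [set A | 0 < f A].
  move=> cf f0; apply: (cf A0 [set y : R | 0 < y]).
  by apply: open_nbhs_nbhs; split => //; exact: open_gt.
have A0n : forall j i, good j i A0.
  move=> j i; have [h1 h2 h3 _] := hii j.
  have d0 : dt j A0 != 0 := realizes_det cT rT h1 h2 h3.
  have d2 : 0 < dt j A0 ^+ 2 by rewrite exprn_even_gt0.
  split=> // iT; have := realizes_slack rT iT.
  have <- : point (pt A0) j = point V0 j.
    rewrite -[RHS]scale1r; apply: (realizes_solve cT rT h1 h2 h3);
      by rewrite -mul_trmxE tightE.
  rewrite -mul_trmxE ptE // -subr_gt0 -(pmulr_rgt0 _ d2).
  have -> // : dt j A0 ^+ 2 * (1 - num j A0 i / dt j A0) = dt j A0 * (dt j A0 - num j A0 i).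
    by field.
have NF : Filter (nbhs A0) by exact: nbhs_filter.
apply: (@filter_forall _ _ (fun j => [set A | forall i, good j i A]) _ NF) => j.
apply: (@filter_forall _ _ (fun i => [set A | good j i A]) _ NF) => i.
have [g1 g2] := A0n j i; apply: filterI.
  by apply: near_gt => //; under eq_fun do rewrite expr2; apply: cM; exact: cdt.
have [iT|iT] := boolP (i \in T j); first by apply: (filterS _ filterT) => A _.
apply: filterS (near_gt (fun A => dt j A * (dt j A - num j A i)) _ (g2 iT)) => [A h _ //|].
by apply: cM; [exact: cdt | apply: cB; [exact: cdt | exact: cnum]].
Qed.

Lemma ordS_val n (i : 'I_n) : ordS i = (if i.+1 == n then 0 else i.+1)%N :> nat.
Proof.
rewrite /=; case: eqP => [->|ne]; first by rewrite modnn.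
by rewrite modn_small // ltn_neqAle (introN eqP ne) ltn_ord.
Qed.

Lemma ordS_neq n (j : 'I_n) : (1 < n)%N -> j != ordS j.
Proof.
move=> n1; apply/eqP => e; have := congr1 (@nat_of_ord n) e; rewrite ordS_val.
by have := ltn_ord j; case: eqP => ?; lia.
Qed.

(* The points (j, j ^ 2) of a parabola, seen from (1, 3 / 2); the edge [i] joins
   the points [i] and [i + 1], the last edge closes the polygon. *)
Lemma ngon_space_nonempty n : (3 <= n)%N -> exists A : 'M[R]_(n, 2), ngon_space n A.
Proof.
move=> n3; have n0 : (0 < n)%N by lia.
pose T : {ffun 'I_n -> {set 'I_n}} :=
  [ffun j => [set i | (j == i) || (j == ordS i)]%SET].
have TE i j : (i \in T j) = (j == i) || (j == ordS i) by rewrite ffunE inE.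
have n1 : (1 < n)%N by lia.
have cT : edge_config T.
  split.
  - move=> j; have -> : T j = [set j; ord_pred j]%SET.
      apply/setP => i; rewrite TE !inE eq_sym; congr (_ || _).
      by rewrite -(inj_eq (@ord_pred_inj n)) ordSK eq_sym.
    rewrite cards2 -(inj_eq (@ordS_inj n)) ord_predK eq_sym.
    by rewrite ordS_neq.
  - move=> i; have -> : [set j | i \in T j]%SET = [set i; ordS i]%SET.
      by apply/setP => j; rewrite !inE TE.
    by rewrite cards2 ordS_neq.
  - move=> j k ejk; apply/eqP; apply: contraT => jk.
    have := TE j j; rewrite ejk eqxx TE eq_sym (negbTE jk) /= => /eqP kj.
    have := TE k k; rewrite -ejk eqxx TE (negbTE jk) /= => /eqP jk'.
    have := congr1 val kj; have := congr1 val jk'.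
    rewrite -[val (ordS k)]/(ordS k : nat) -[val (ordS j)]/(ordS j : nat) !ordS_val /=.
    by have := ltn_ord j; have := ltn_ord k; do 2!case: eqP => ?; lia.
pose V : 'M[R]_(n, 2) := \matrix_(j, a)
  (if a == 0 then (j%:R - 1) else j%:R ^+ 2 - 3 / 2).
(* Vertical distance from the centre (1, 3 / 2) to the line of edge [i]: y = (2i + 1) x - i (i + 1),
   and y = (n - 1) x for the last edge. Division by it normalises the right-hand side to 1. *)
pose sl (i : 'I_n) : R := if i.+1 == n then n%:R - 1 - 3 / 2 else i%:R ^+ 2 - i%:R + 1 / 2.
pose A : 'M[R]_(n, 2) := \matrix_(i, a)
  (if i.+1 == n then (if a == 0 then - (n%:R - 1) / sl i else 1 / sl i)
   else (if a == 0 then (2 * i%:R + 1) / sl i else - 1 / sl i)).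
have nR : 3 <= n%:R :> R by rewrite ler_nat.
have sl0 i : 0 < sl i by rewrite /sl; case: (i.+1 =P n) => _; nra.
(* Vertical distance from the point [j] to the line of edge [i]; for integers it is positive off the
   two ends. *)
pose d (i j : 'I_n) : R := if i.+1 == n then j%:R * (n%:R - 1 - j%:R)
  else (j%:R - i%:R) * (j%:R - i%:R - 1).
have AV i j : (A *m V^T) i j = 1 - d i j / sl i.
  have s0 : sl i != 0 by rewrite gt_eqF.
  rewrite mul_trmxE mulmx2E !mxE /= /d; have := s0; rewrite /sl.
  case: (i.+1 =P n) => _ s1.
    by rewrite mulrAC (mulrAC 1) -mulrDl -[X in _ = X - _](divff s1) -mulrBl; congr (_ / _); field.
  rewrite mulrAC (mulrAC (- 1)) -mulrDl -[X in _ = X - _](divff s1) -mulrBl.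
  by congr (_ / _); field.
have dE i j : (i \in T j -> d i j = 0) /\ (i \notin T j -> 0 < d i j).
  rewrite TE /d -!val_eqE -[val (ordS i)]/(ordS i : nat) ordS_val /=.
  have ltj : j%:R <= n%:R - 1 :> R.
    by have := ltn_ord j; rewrite -(ler_nat R) -natr1; lra.
  case: (i.+1 =P n) => en; split.
  - move=> /orP[/eqP ->|/eqP ->]; last by rewrite mul0r.
    have nE : n%:R = i%:R + 1 :> R by rewrite natr1 en.
    by rewrite nE; ring.
  - rewrite negb_or => /andP[ji j0]; rewrite mulr_gt0 ?ltr0n ?lt0n // subr_gt0.
    rewrite ltrBrDr natr1 ltr_nat ltn_neqAle ltn_ord andbT.
    by apply: contraNneq ji => ej; apply/eqP; lia.
  - by move=> /orP[/eqP ->|/eqP ->]; rewrite -?natr1; ring.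
  - rewrite negb_or => /andP[ji jS]; have [lt|gt] := ltnP j i.
      have : j%:R + 1 <= i%:R :> R by rewrite natr1 ler_nat.
      by nra.
    have : i%:R + 2 <= j%:R :> R.
      by rewrite -natrD ler_nat addn2; lia.
    by nra.
exists A; apply: (ngon_of_config n0 cT (V := V)) => i j; rewrite AV; have [h1 h2] := dE i j.
split=> [/h1 ->|/h2 dp]; first by rewrite mul0r subr0.
by rewrite gtrBl divr_gt0.
Qed.

End PolygonSpace.

(** * Extensions and nonnegative factorizations *)

Section Yannakakis.
Context {R : realType}.
Local Open Scope classical_set_scope.

Section ConeSection.
Variables (k : nat) (U : 'cV[R]_k -> Prop) (tau : 'rV[R]_k).
Hypotheses (hU : subsp U)
  (tau_gt0 : forall y, U y -> nneg y -> y != 0 -> 0 < (tau *m y) 0 0).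

Let Q : set 'cV[R]_k := [set y | [/\ U y, nneg y & (tau *m y) 0 0 = 1]].

Lemma subsp_sum (I : finType) (w : I -> R) (y : I -> 'cV[R]_k) :
  (forall i, U (y i)) -> U (\sum_i w i *: y i).
Proof.
move=> Uy; elim/big_ind: _ => [|x z Ux Uz|i _]; first by case: hU.
  by rewrite -[x]scale1r; case: hU => _; apply.
exact: subspZ.
Qed.

Lemma tau_sum (I : finType) (w : I -> R) (y : I -> 'cV[R]_k) :
  (tau *m \sum_i w i *: y i) 0 0 = \sum_i w i * (tau *m y i) 0 0.
Proof.
by rewrite mulmx_sumr summxE; apply: eq_bigr => i _; rewrite -scalemxAr mxE.
Qed.

(** Support-minimal vectors are finite in number up to scalars, so one per support, normalised by
    [tau], generates the slice. *)
Lemma cone_section_polytope : exists m (v : 'I_m -> 'cV[R]_k),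
  (forall i, Q (v i)) /\ Q = conv_hull v.
Proof.
pose I := [set Z : {set 'I_k} | `[< exists2 e, minsup U e & supp e = Z >]]%SET.
have /boolp.choice[v hv] : forall i : 'I_#|I|, exists e,
    [/\ minsup U e, supp e = enum_val i & (tau *m e) 0 0 = 1].
  move=> i; have := enum_valP i; rewrite inE => /asboolP[e me se].
  have [Ue e0 eN0 emin] := me; have t0 := tau_gt0 Ue e0 eN0.
  set t := (tau *m e) 0 0 in t0.
  have tN0 : t != 0 by rewrite gt_eqF.
  have ss : supp (t^-1 *: e) = supp e.
    by apply/setP => a; rewrite !inE mxE mulf_eq0 invr_eq0 (negbTE tN0).
  exists (t^-1 *: e); split; last by rewrite mulmxZ_entry mulVf.
    split; first exact: subspZ.
    - by move=> a; rewrite mxE mulr_ge0 // invr_ge0 ltW.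
    - by rewrite scaler_eq0 invr_eq0 (negbTE tN0).
    - move=> y' Uy'; rewrite ss => /(emin _ Uy')[b ->]; exists (b * t).
      by rewrite scalerA mulfK.
  by rewrite ss.
have Qv i : Q (v i) by have [[Ue e0 _ _] _ t1] := hv i.
exists #|I|, v; split => //; apply/seteqP; split=> y; last first.
  move=> [w [w0 w1 ->]]; split.
  - by apply: subsp_sum => i; have [] := Qv i.
  - move=> a; rewrite summxE; apply: sumr_ge0 => i _; rewrite mxE mulr_ge0 //.
    by have [_ ] := Qv i.
  - by rewrite tau_sum -w1; apply: eq_bigr => i _; have [_ _ ->] := Qv i; rewrite mulr1.
move=> [Uy y0 y1]; have [es mes ey] := min_decomp hU Uy y0.
have [w w0 yw] : exists2 w : 'I_#|I| -> R, forall i, 0 <= w i & y = \sum_i w i *: v i.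
  rewrite {}ey; elim: es mes {Uy y0 y1} => [_|e es IH mes].
    by exists (fun=> 0) => //; rewrite big_nil big1 // => i _; rewrite scale0r.
  have [|w w0 ew] := IH; first by move=> e' h; apply: mes; rewrite inE h orbT.
  have me := mes e (mem_head _ _); have [Ue e0 eN0 _] := me.
  have seI : supp e \in I by rewrite inE; apply/asboolP; exists e.
  pose i := enum_rank_in seI (supp e).
  have [[_ _ _ vmin] sv tv] := hv i.
  have [|b eb] := vmin e Ue; first by rewrite sv enum_rankK_in.
  have b0 : 0 <= b.
    by have := tau_gt0 Ue e0 eN0; rewrite eb mulmxZ_entry tv mulr1; exact: ltW.
  exists (fun j => b *+ (j == i) + w j) => [j|]; first by rewrite addr_ge0 // mulrn_wge0.
  under [RHS]eq_bigr do rewrite scalerDl.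
  rewrite big_split big_cons ew /=; congr (_ + _).
  rewrite (bigD1 i) //= eqxx mulr1n -eb big1 ?addr0 // => j /negbTE ->.
  by rewrite mulr0n scale0r.
exists w; split => //; rewrite -y1 yw tau_sum.
by apply: eq_bigr => i _; have [_ _ ->] := Qv i; rewrite mulr1.
Qed.

Lemma sum_pred_scale (W : lmodType R) (I : finType) (P : pred I) (f : I -> W) :
  \sum_(i | P i) f i = \sum_i (P i)%:R *: f i.
Proof.
rewrite big_mkcond; apply: eq_bigr => i _.
by case: (P i); rewrite ?scale1r ?scale0r.
Qed.

(* A facet contains a point with as few zero coordinates as possible; if none of
   them is responsible for the facet, one can leave the facet on both sides. *)
Lemma cone_section_facets F : facets Q F ->
  exists a : 'I_k, F = [set y | Q y /\ y a 0 = 0].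
Proof.
move=> [[c [d [cQ FE]]] dimF].
have [m [v [Qv Qconv]]] := cone_section_polytope.
pose s : 'cV[R]_m := \col_i (d - (c *m v i) 0 0).
have sE i : s i 0 = d - (c *m v i) 0 0 by rewrite mxE.
have s_ge0 i : 0 <= s i 0 by rewrite sE subr_ge0; apply: cQ.
have sL : affvals v s.
  by exists (- c), d => i; rewrite sE mulNmx [X in _ = X + _]mxE addrC.
pose Z := [set i | s i 0 == 0]%SET.
have combE (w : 'I_m -> R) : \sum_i w i = 1 ->
    d - (c *m \sum_i w i *: v i) 0 0 = \sum_i w i * s i 0.
  move=> w1; have := mul_comb v w (- c) d; rewrite w1 mulr1 mulNmx [X in X + _]mxE addrC => ->.
  by apply: eq_bigr => i _; rewrite mulNmx [X in _ * (X + _)]mxE addrC sE.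
have rkF : affdim F = Posz (\rank (homs_on v Z)) - 1.
  apply: affdim_rank => [i|x].
    rewrite inE sE subr_eq0 FE => /eqP h; by split.
  rewrite FE Qconv => -[[w [w0 w1 ->]] hx]; exists w; split => // i; rewrite inE => si.
  move: (combE w w1); rewrite hx subrr => /esym/eqP.
  rewrite psumr_eq0 => [/allP/(_ i (mem_index_enum i))|j _]; last by rewrite mulr_ge0.
  by rewrite mulf_eq0 (negbTE si) orbF => /eqP.
have rkQ : affdim Q = Posz (\rank (homs v)) - 1 by rewrite Qconv affdim_conv.
have rk : \rank (homs v) = (\rank (homs_on v Z) + 1)%N.
  by move: dimF; rewrite rkF rkQ; lia.
pose D : 'M[R]_m := diag_mx (\row_i (i \in Z)%:R).
have mulD q (A : 'M[R]_(q, m)) b i : (A *m D) b i = A b i *+ (i \in Z).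
  by rewrite mul_mx_diag !mxE mulr_natr.
have HD : homs_on v Z = homs v *m D.
  by apply/matrixP => b i; rewrite mulD !mxE.
(* The rank drops by one on a facet, so the affine functions vanishing there are the multiples of
   [s]. *)
have K1 : \rank (homs v :&: kermx D)%MS = 1%N.
  by have := mxrank_mul_ker (homs v) D; rewrite -HD rk => /addnI.
have inK (t : 'cV[R]_m) : affvals v t -> (forall i, i \in Z -> t i 0 = 0) ->
    (t^T <= homs v :&: kermx D)%MS.
  move=> /affvalsP tL tZ; rewrite sub_capmx tL; apply/sub_kermxP/matrixP => b i.
  rewrite mulD ord1 [RHS]mxE mxE; have [iZ|_] := boolP (i \in Z); last by rewrite mulr0n.
  by rewrite tZ // mul0rn.
have sN0 : s != 0.
  apply/eqP => s0; move: K1; have -> : (homs v :&: kermx D)%MS = 0.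
    apply/eqP; rewrite -submx0; apply/rV_subP => u; rewrite sub_capmx => /andP[_ /sub_kermxP uD].
    rewrite submx0; apply/eqP/matrixP => b i; rewrite ord1 [RHS]mxE.
    by have /matrixP/(_ 0 i) := uD; rewrite mulD [RHS]mxE inE s0 mxE eqxx mulr1n.
  by rewrite mxrank0.
have Ks t : affvals v t -> (forall i, i \in Z -> t i 0 = 0) -> exists b, t = b *: s.
  move=> tL tZ; have sK := inK s sL _.
  have {}sK : (s^T <= homs v :&: kermx D)%MS by apply: sK => i; rewrite inE => /eqP.
  have : (homs v :&: kermx D <= s^T)%MS.
    by have := mxrank_leqif_sup sK; rewrite K1 rank_rV trmx_eq0 sN0 => -[_ <-].
  move/(submx_trans (inK t tL tZ))/sub_rVP => [b eb]; exists b.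
  by rewrite -[LHS]trmxK eb linearZ /= trmxK.
have [l sl] : exists l, 0 < s l 0.
  by have [l sl] := col_neq0 sN0; exists l; rewrite lt_neqAle eq_sym sl s_ge0.
pose y0 := \sum_(i in Z) v i.
have y0E a : y0 a 0 = \sum_(i in Z) v i a 0 by rewrite summxE.
have v_ge0 i a : 0 <= v i a 0 by have [_] := Qv i.
(* If there is no such coordinate, every coordinate positive at [v l] is positive at [y0], and
   [y0 - eps *: v l] is a nonnegative vector of [U] where the homogenised slack [psi] is
   negative. *)
have [a [t_a ha]] : exists a : 'I_k, (exists i, v i a 0 != 0) /\ forall i, i \in Z -> v i a 0 = 0.
  apply: contrapT => no.
  have [eps eps0 heps] := @small_multiple R _ (fun a => 0 < y0 a 0) (fun a => y0 a 0)
    (fun a => v l a 0) (fun a h => h).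
  have y1_ge0 : nneg (y0 - eps *: v l).
    move=> a; rewrite !mxE subr_ge0; have [pos|] := ltrP 0 (y0 a 0).
      by have := heps a pos; rewrite ger0_norm.
    rewrite y0E => npos; have z0 : \sum_(i in Z) v i a 0 = 0.
      by apply/eqP; rewrite eq_le npos sumr_ge0.
    suff -> : v l a 0 = 0 by rewrite mulr0 z0.
    apply: contrapT => /eqP vl; apply: no; exists a; split; first by exists l.
    move=> i iZ; move/eqP: z0; rewrite psumr_eq0 // => /allP/(_ i (mem_index_enum i)).
    by rewrite iZ => /eqP.
  have Uy0 : U y0 by rewrite /y0 sum_pred_scale; apply: subsp_sum => i; have [] := Qv i.
  have Uvl : U (v l) by have [] := Qv l.
  pose psi (y : 'cV[R]_k) := d * (tau *m y) 0 0 - (c *m y) 0 0.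
  have psi_ge0 (y : 'cV[R]_k) : U y -> nneg y -> 0 <= psi y.
    move=> Uy yge; have [->|yN0] := eqVneq y 0.
      by rewrite /psi !mulmx0 !mxE mulr0 subrr.
    have t0 := tau_gt0 Uy yge yN0; set t := (tau *m y) 0 0 in t0 *.
    have : (c *m (t^-1 *: y)) 0 0 <= d.
      apply: cQ; split; first exact: subspZ.
      - by move=> b; rewrite mxE mulr_ge0 // invr_ge0 ltW.
      - by rewrite mulmxZ_entry mulVf // gt_eqF.
    by rewrite mulmxZ_entry mulrC ler_pdivrMr // /psi subr_ge0.
  have psi_v i : psi (v i) = s i 0 by have [_ _ tv] := Qv i; rewrite /psi tv mulr1 sE.
  have psi_y0 : psi y0 = 0.
    rewrite /psi /y0 !mulmx_sumr !summxE mulr_sumr -sumrB big1 // => i.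
    by rewrite inE => /eqP si; rewrite -[LHS]/(psi (v i)) psi_v.
  have := psi_ge0 _ (subspB eps hU Uvl Uy0) y1_ge0.
  have -> : psi (y0 - eps *: v l) = psi y0 - eps * psi (v l).
    by rewrite /psi !mulmxB_entry !mulmxZ_entry; ring.
  rewrite psi_y0 psi_v sub0r oppr_ge0 leNgt mulr_gt0 //.
have tL : affvals v (\col_i v i a 0).
  by exists (delta_mx 0 a), 0 => i; rewrite -rowE mxE [row a _ _ _]mxE addr0.
have [b eb] : exists b, \col_i v i a 0 = b *: s by apply: Ks => // i iZ; rewrite mxE ha.
have vE i : v i a 0 = b * s i 0.
  by have /matrixP/(_ i 0) := eb; rewrite mxE [RHS]mxE.
have bN0 : b != 0.
  by have [i] := t_a; rewrite vE mulf_eq0 negb_or => /andP[].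
have QaE y : Q y -> y a 0 = b * (d - (c *m y) 0 0).
  rewrite Qconv => -[w [w0 w1 ->]]; rewrite combE // summxE mulr_sumr.
  by apply: eq_bigr => i _; rewrite mxE vE mulrCA.
exists a; rewrite FE; apply/seteqP; split=> y [Qy hy]; split => //.
  by rewrite QaE // hy subrr mulr0.
by move/eqP: hy; rewrite QaE // mulf_eq0 (negbTE bN0) subr_eq0 => /eqP.
Qed.

Lemma cone_section_facets_card :
  exists2 k', (k' <= k)%N & (facets Q #= `I_k')%card.
Proof.
pose f (a : nat) := [set y | Q y /\ (if insub a is Some a' then y (a' : 'I_k) 0 else 0) = 0].
have sub : facets Q `<=` f @` `I_k.
  move=> F /cone_section_facets[a ->]; exists (a : nat); first exact: ltn_ord.
  by rewrite /f valK.
have fin : finite_set (facets Q) by apply: sub_finite_set sub _; exact: finite_image.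
have /finite_setP[k' Fk'] := fin; exists k' => //.
rewrite -card_le_II -(card_le_eql Fk').
exact: card_le_trans (subset_card_le sub) (card_image_le _ _).
Qed.

End ConeSection.
Definition slack_factor n k (A V : 'M[R]_(n, 2)) : Prop :=
  exists (F : 'M[R]_(n, k)) (G : 'M[R]_(k, n)), [/\ forall i a, 0 <= F i a,
    forall a j, 0 <= G a j & forall i j, 1 - (A *m V^T) i j = (F *m G) i j].

Section SlackFactor.
Variables (n : nat) (T : {ffun 'I_n -> {set 'I_n}}) (A V : 'M[R]_(n, 2)).
Hypotheses (n_gt0 : (0 < n)%N) (cT : edge_config T) (rT : realizes T A V).

(** [F] holds the coefficients of the edge slacks in the facet slacks, [G] the facet slacks at
    points lying over the vertices. *)
Lemma slack_factor_of_extension k : extension_of_size (poly_of A) k -> slack_factor k A V.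
Proof.
move=> /extension_slack_rows[m [p [S [Pp [S0 HS]]]]].
have Ap l i : (A *m p l) i 0 <= 1.
  have : poly_of A (p l) by rewrite Pp; exact: conv_hull_vertex.
  exact.
have /boolp.choice[la hla] : forall i, exists la : 'rV[R]_k,
    (forall a, 0 <= la 0 a) /\ forall l, 1 - (A *m p l) i 0 = (la *m S) 0 l.
  move=> i; have [||la la0 e] := HS (\col_l (1 - (A *m p l) i 0)).
  - exists (- row i A), 1 => l; rewrite mxE mulNmx [X in _ = X + _]mxE [RHS]addrC.
    by congr (_ - _); rewrite !mxE; apply: eq_bigr => b _; rewrite mxE.
  - by move=> l; rewrite mxE subr_ge0.
  - by exists la; split => // l; rewrite -e !mxE.
have /boolp.choice[l hl] : forall j, exists l, p l = point V j.
  by move=> j; apply: vertex_of_conv; rewrite -Pp; exact: realizes_vertices rT j.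
exists (\matrix_(i, a) la i 0 a), (\matrix_(a, j) S a (l j)); split.
- by move=> i a; rewrite mxE; have [] := hla i.
- by move=> a j; rewrite mxE.
- move=> i j; rewrite mul_trmxE -hl; have [_ ->] := hla i.
  by rewrite !mxE; apply: eq_bigr => a _; rewrite !mxE.
Qed.

(** The extension consists of the nonnegative [y] for which [F *m y] is the slack vector of a point
    of the plane; column [j] of [G] lies over vertex [j]. Its facets are cut out by coordinates,
    hence at most [k]. *)
Lemma extension_of_slack_factor k : slack_factor k A V ->
  exists2 k', (k' <= k)%N & extension_of_size (poly_of A) k'.
Proof.
move=> [F [G0 [F_ge0 G0_ge0 FG0]]].
(* Coordinates not seen by [F] would make the slice unbounded; they are set to zero here and in
   [U]. *)
pose G : 'M[R]_(k, n) := \matrix_(a, j) (if col a F == 0 then 0 else G0 a j).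
have G_ge0 a j : 0 <= G a j by rewrite mxE; case: ifP.
have FG i j : 1 - (A *m point V j) i 0 = (F *m col j G) i 0.
  rewrite -mul_trmxE FG0 !mxE; apply: eq_bigr => a _; rewrite !mxE.
  by case: eqP => // /matrixP/(_ i 0); rewrite !mxE => ->; rewrite !mul0r.
pose B : 'M[R]_(n, 1 + 2) := row_mx (const_mx 1) (- A).
have BE s (x : 'cV[R]_2) i : (B *m col_mx (const_mx s) x) i 0 = s - (A *m x) i 0.
  rewrite mul_row_col mulNmx mxE [X in _ + X]mxE; congr (_ - _).
  by rewrite mxE big_ord1 !mxE mul1r.
have split3 (z : 'cV[R]_(1 + 2)) : z = col_mx (const_mx (usubmx z 0 0)) (dsubmx z).
  rewrite -[LHS]vsubmxK; congr col_mx; apply/matrixP => a b.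
  by rewrite !ord1 [RHS]mxE.
(* A left inverse of [B] recovers the level s and the point x from the slacks, which makes [tau] and
   [M] linear in [y]. *)
have Bfull : row_full B.
  rewrite -cokermx_eq0; apply/eqP/matrixP => i j; rewrite [RHS]mxE.
  pose z := col j (cokermx B).
  have Bz l : (B *m z) l 0 = 0 by rewrite /z colE mulmxA mulmx_coker mul0mx mxE.
  have [s0 x0] : usubmx z 0 0 = 0 /\ dsubmx z = 0.
    by apply: (homogeneous_inj n_gt0 cT rT) => l; rewrite -BE -split3.
  have z0 : z = 0.
    rewrite (split3 z) s0 x0; apply/matrixP => a b.
    by rewrite !mxE; case: splitP => ? _; rewrite mxE.
  by have /matrixP/(_ i 0) := z0; rewrite !mxE.
have /row_fullP[L LB] := Bfull.
pose U (y : 'cV[R]_k) := (exists s (x : 'cV[R]_2), forall i, (F *m y) i 0 = s - (A *m x) i 0) /\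
  forall a, col a F = 0 -> y a 0 = 0.
pose tau : 'rV[R]_k := usubmx L *m F.
pose M : 'M[R]_(2, k) := dsubmx L *m F.
have sol y s (x : 'cV[R]_2) : (forall i, (F *m y) i 0 = s - (A *m x) i 0) ->
    (tau *m y) 0 0 = s /\ M *m y = x.
  move=> h; have e : F *m y = B *m col_mx (const_mx s) x.
    by apply/matrixP => i b; rewrite ord1 BE h.
  have := congr1 (mulmx L) e; rewrite !mulmxA LB mul1mx -{1}[L]vsubmxK !mul_col_mx.
  by move=> /eq_col_mx[e1 e2]; rewrite /tau /M e1 e2 mxE.
have hU : subsp U.
  split.
    split; last by move=> a _; rewrite mxE.
    by exists 0, 0 => i; rewrite !mulmx0 !mxE subr0.
  move=> a y y' [[s [x h]] hz] [[s' [x' h']] hz']; split.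
    exists (a * s + s'), (a *: x + x') => i.
    by rewrite !mulmxD_entry !mulmxZ_entry h h'; ring.
  by move=> b hb; rewrite !mxE hz // hz' // mulr0 addr0.
have tau_gt0 y : U y -> nneg y -> y != 0 -> 0 < (tau *m y) 0 0.
  move=> [[s [x h]] hz] y0 yN0; have [-> _] := sol y s x h.
  have Fy_ge0 i : 0 <= (F *m y) i 0.
    by rewrite mxE; apply: sumr_ge0 => a _; rewrite mulr_ge0.
  have [|w [w0 sw xw]] := homogeneous_comb n_gt0 cT rT (s0 := s) (x := x).
    by move=> i; rewrite -h.
  have s0 : 0 <= s by rewrite sw; exact: sumr_ge0.
  rewrite lt_neqAle eq_sym s0 andbT; apply/eqP => sz.
  have [a ya] := col_neq0 yN0.
  have /eqP Fa : col a F != 0 by apply: contraNneq ya => /hz ->.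
  apply: Fa; apply/matrixP => i b; rewrite [LHS]mxE [RHS]mxE.
  have w00 j : w j = 0.
    move/eqP: sw; rewrite sz eq_sym psumr_eq0 // => /allP/(_ j (mem_index_enum j)).
    by move=> /eqP.
  have : (F *m y) i 0 = 0.
    rewrite h sz xw big1 ?mulmx0 ?mxE ?subr0 // => j _.
    by rewrite w00 scale0r.
  move/eqP; rewrite mxE psumr_eq0 => [/allP/(_ a (mem_index_enum a))|c _]; last by rewrite mulr_ge0.
  by rewrite mulf_eq0 (negbTE ya) orbF => /eqP.
have [m [v [_ Qv]]] := cone_section_polytope hU tau_gt0.
have [k' k'k Qk'] := cone_section_facets_card hU tau_gt0.
exists k' => //; exists k, [set y | [/\ U y, nneg y & (tau *m y) 0 0 = 1]], M, 0; split => //.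
  by exists m, v.
apply/seteqP; split=> x.
  rewrite (poly_of_realizes n_gt0 cT rT) => -[w [w0 w1 ->]].
  have gj j : [/\ U (col j G), nneg (col j G), (tau *m col j G) 0 0 = 1 & M *m col j G = point V j].
    have [t1 m1] := sol (col j G) 1 (point V j) (fun i => esym (FG i j)).
    split => //; last by move=> a; rewrite mxE.
    split; first by exists 1, (point V j) => i; rewrite FG.
    by move=> a /eqP aF; rewrite !mxE aF.
  exists (\sum_j w j *: col j G).
    split.
    - by apply: (subsp_sum hU) => j; have [] := gj j.
    - move=> a; rewrite summxE; apply: sumr_ge0 => j _; rewrite mxE mulr_ge0 //.
      by have [_ h _ _] := gj j; exact: h.
    - by rewrite tau_sum -w1; apply: eq_bigr => j _; have [_ _ -> _] := gj j; rewrite mulr1.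
  rewrite addr0 mulmx_sumr; apply: eq_bigr => j _.
  by rewrite -scalemxAr; have [_ _ _ ->] := gj j.
move=> [y [[[s [z h]] hz] y0 ty]] <-; rewrite addr0.
have [ts ->] := sol y s z h => i.
rewrite -subr_ge0 -ty ts -h mxE; apply: sumr_ge0 => a _; by rewrite mulr_ge0.
Qed.

End SlackFactor.

End Yannakakis.

(** * Polytopes are spanned by their vertices *)

Section Minkowski.
Context {R : realType}.
Local Open Scope classical_set_scope.

(** Induction on the number of vectors. If the functional [c] separating [x] from the others is
    negative at the first vector [u], everything is projected along [u] to the kernel of [c]. A
    combination found there lifts with a nonnegative weight on [u], and a separating functional is
    pulled back by the projection. *)
Lemma farkas d m (v : 'I_m -> 'cV[R]_d) x :
  (exists2 w : 'I_m -> R, forall i, 0 <= w i & x = \sum_i w i *: v i) \/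
  (exists2 c : 'rV[R]_d, forall i, 0 <= (c *m v i) 0 0 & (c *m x) 0 0 < 0).
Proof.
elim: m v x => [|m IH] v x.
  have [->|xN0] := eqVneq x 0; first by left; exists (fun=> 0) => //; rewrite big_ord0.
  right; exists (- x^T) => [[] //|]; rewrite mulNmx mxE oppr_lt0 mxE.
  have [j xj] := col_neq0 xN0.
  rewrite (bigD1 j) //= mxE ltr_pwDl ?sumr_ge0 // => [|i _].
    by rewrite -expr2 exprn_even_gt0.
  by rewrite mxE -expr2 sqr_ge0.
pose u := v ord0; pose v1 i := v (lift ord0 i).
have [[w w0 ->]|[c cv cx]] := IH v1 x.
  left; exists (fun i => if unlift ord0 i is Some j then w j else 0) => [i|].
    by case: unlift.
  rewrite big_ord_recl unlift_none scale0r add0r.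
  by apply: eq_bigr => i _; rewrite liftK.
have [cu|cu] := lerP 0 ((c *m u) 0 0).
  right; exists c => // i; have [j ->|->//] := unliftP ord0 i; exact: cv.
pose pr (y : 'cV[R]_d) := y - ((c *m y) 0 0 / (c *m u) 0 0) *: u.
have cu0 : (c *m u) 0 0 != 0 by rewrite lt_eqF.
have cpr y : (c *m pr y) 0 0 = 0 by rewrite mulmxB_entry mulmxZ_entry divfK ?subrr.
have [[w w0 ex]|[c' c'v c'x]] := IH (fun i => pr (v1 i)) (pr x).
  left; pose t := (c *m x) 0 0 / (c *m u) 0 0 -
    \sum_i w i * ((c *m v1 i) 0 0 / (c *m u) 0 0).
  have t0 : 0 <= t.
    rewrite subr_ge0; apply: (@le_trans _ _ 0).
      rewrite -oppr_ge0 -sumrN; apply: sumr_ge0 => i _; rewrite -mulrN -mulrN mulr_ge0 //.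
      by rewrite mulr_ge0 ?cv // oppr_ge0 invr_le0 ltW.
    by rewrite -mulrNN mulr_ge0 // oppr_ge0 ?invr_le0 ltW.
  exists (fun i => if unlift ord0 i is Some j then w j else t) => [i|].
    by case: unlift.
  have sE : \sum_i w i *: pr (v1 i) = \sum_i w i *: v1 i -
      (\sum_i w i * ((c *m v1 i) 0 0 / (c *m u) 0 0)) *: u.
    rewrite scaler_suml -sumrB; apply: eq_bigr => i _.
    by rewrite /pr scalerBr scalerA.
  rewrite big_ord_recl unlift_none -/u.
  have -> : \sum_(i < m) (if unlift ord0 (lift ord0 i) is Some j then w j else t) *: v (lift ord0 i)
      = \sum_i w i *: v1 i by apply: eq_bigr => i _; rewrite liftK.
  rewrite /t scalerBl addrAC -addrA -sE -ex /pr addrC subrK //.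
right; exists (c' - ((c' *m u) 0 0 / (c *m u) 0 0) *: c) => [i|].
  have prE y : ((c' - ((c' *m u) 0 0 / (c *m u) 0 0) *: c) *m y) 0 0 = (c' *m pr y) 0 0.
    rewrite mulmxB_entry mulmxZ_entry mulmxBl mxE [X in _ + X]mxE -scalemxAl.
    by rewrite [X in _ - X]mxE; ring.
  rewrite prE; have [j ->|->] := unliftP ord0 i; first exact: c'v.
  by rewrite /pr -/u divff // scale1r subrr mulmx0 mxE.
rewrite mulmxBl mxE [X in _ + X]mxE -scalemxAl [X in _ - X]mxE.
move: c'x; rewrite mulmxB_entry mulmxZ_entry; apply: le_lt_trans.
by rewrite le_eqVlt; apply/orP; left; apply/eqP; ring.
Qed.

Definition conv_on d m (v : 'I_m -> 'cV[R]_d) (I : {set 'I_m}) x : Prop :=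
  exists w : 'I_m -> R, [/\ forall i, 0 <= w i, forall i, i \notin I -> w i = 0,
    \sum_i w i = 1 & x = \sum_i w i *: v i].

Lemma conv_on_trans d m (v : 'I_m -> 'cV[R]_d) (I : {set 'I_m}) k (u : 'I_k -> 'cV[R]_d) x :
  conv_hull u x -> (forall l, conv_on v I (u l)) -> conv_on v I x.
Proof.
move=> [a [a0 a1 ->]] /boolp.choice[w hw].
exists (fun i => \sum_l a l * w l i); split.
- by move=> i; apply: sumr_ge0 => l _; rewrite mulr_ge0 //; have [h _ _ _] := hw l; exact: h.
- by move=> i iI; rewrite big1 // => l _; have [_ h _ _] := hw l; rewrite h // mulr0.
- rewrite exchange_big /= -a1; apply: eq_bigr => l _.
  by rewrite -mulr_sumr; have [_ _ -> _] := hw l; rewrite mulr1.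
- under [RHS]eq_bigr do rewrite scaler_suml.
  rewrite exchange_big /=; apply: eq_bigr => l _.
  by have [_ _ _ {1}->] := hw l; rewrite scaler_sumr; apply: eq_bigr => i _; rewrite scalerA.
Qed.

Lemma conv_on_hull d m (v : 'I_m -> 'cV[R]_d) (I : {set 'I_m}) x :
  conv_on v I x -> conv_hull v x.
Proof. by move=> [w [w0 _ w1 ex]]; exists w. Qed.

Lemma conv_on_self d m (v : 'I_m -> 'cV[R]_d) (I : {set 'I_m}) i : i \in I -> conv_on v I (v i).
Proof.
move=> iI; exists (fun j => (j == i)%:R); split.
- by move=> j; rewrite ler0n.
- by move=> j; apply: contraNeq; rewrite pnatr_eq0 eqb0 negbK => /eqP ->.
- by rewrite (bigD1 i) //= eqxx big1 ?addr0 // => j /negbTE ->.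
- rewrite (bigD1 i) //= eqxx scale1r big1 ?addr0 // => j /negbTE ->.
  by rewrite scale0r.
Qed.

(** In a generating subset of least size no point lies in the hull of the others. Farkas' lemma in
    homogeneous coordinates gives an affine function negative at this point and nonnegative at the
    others, so the point is its unique minimiser. *)
Lemma polytope_vertices d m (v : 'I_m -> 'cV[R]_d) x : conv_hull v x ->
  exists I : {set 'I_m}, conv_on v I x /\ forall i, i \in I -> vertices (conv_hull v) (v i).
Proof.
move=> vx; pose gen (I : {set 'I_m}) := `[< forall l, conv_on v I (v l) >].
have genT : gen [set: 'I_m]%SET.
  by apply/asboolP => l; apply: conv_on_self; rewrite inE.
case: (@arg_minnP _ [set: 'I_m]%SET gen (fun I => #|I|) genT) => I /asboolP gI minI.
exists I; split; first exact: conv_on_trans vx gI.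
move=> i iI; pose J := I :\ i.
pose y l : 'cV[R]_(d + 1) := if l \in J then hom (v l) else 0.
have [[w w0 ew]|[c cy cx]] := farkas y (hom (v i)).
  have : conv_on v J (v i).
    exists (fun l => w l *+ (l \in J)).
    have ey : hom (v i) = col_mx (\sum_l (w l *+ (l \in J)) *: v l)
        (const_mx (\sum_l w l *+ (l \in J))).
      rewrite ew -hom_comb; apply/matrixP => a b; rewrite summxE [RHS]mxE.
      apply: eq_bigr => l _; rewrite [(\col_ _ _) _ _]mxE [homs _ _ _]mxE /y mxE.
      by rewrite ord1; case: (l \in J); rewrite ?mulr1n ?mulr0n ?mulr0 ?mxE ?mulr0 // mulrC.
    have [e1 e2] := eq_col_mx ey; split => //.
    - by move=> l; rewrite mulrn_wge0.
    - by move=> l /negbTE ->; rewrite mulr0n.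
    - by have /matrixP/(_ 0 0) := e2; rewrite !mxE.
  move=> viJ; have /minI : gen J.
    apply/asboolP => l.
    have [a [a0 aI a1 ea]] := gI l.
    apply: (@conv_on_trans _ _ _ _ _ (fun l0 => if l0 \in I then v l0 else v i)).
      exists a; split => //; rewrite ea; apply: eq_bigr => l0 _.
      by case: (boolP (l0 \in I)) => // h; rewrite aI // !scale0r.
    move=> l0; case: ifP => // l0I; have [->//|l0i] := eqVneq l0 i.
    by apply: conv_on_self; rewrite !inE l0i.
  by rewrite leqNgt (cardsD1 i I) iI add1n ltnS leqnn.
pose e z := (c *m hom z) 0 0.
have eE z : e z = (lsubmx c *m z) 0 0 + rsubmx c 0 0.
  by rewrite /e {1}(row_mx_split c) mul_row_hom.
have eJ l : l \in J -> 0 <= e (v l) by move=> lJ; have := cy l; rewrite /y lJ.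
have e_comb (a : 'I_m -> R) : \sum_l a l = 1 -> e (\sum_l a l *: v l) = \sum_l a l * e (v l).
  move=> a1; rewrite eE; have := mul_comb v a (lsubmx c) (rsubmx c 0 0).
  by rewrite a1 mulr1 => ->; apply: eq_bigr => l _; rewrite eE.
have key z : conv_hull v z -> e (v i) <= e z /\ (e z = e (v i) -> z = v i).
  move=> /conv_on_trans/(_ gI)[a [a0 aI a1 ->]]; rewrite e_comb // (bigD1 i) //=.
  set r := \sum_(l | _) _.
  have r0 : 0 <= r.
    apply: sumr_ge0 => l li; have [lI|lI] := boolP (l \in I); last by rewrite aI // mul0r.
    by rewrite mulr_ge0 // eJ // !inE li.
  have a1' : a i <= 1 by rewrite -a1 (bigD1 i) //= lerDl sumr_ge0.
  have ei : e (v i) < 0 := cx.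
  split; first by nra.
  move=> h; have ai : a i = 1 by nra.
  have : \sum_(l | l != i) a l = 0.
    by move: a1; rewrite (bigD1 i) //= ai; lra.
  move/eqP; rewrite psumr_eq0 // => /allP al.
  rewrite (bigD1 i) //= ai scale1r big1 ?addr0 // => l li.
  by have := al l (mem_index_enum l); rewrite li => /eqP ->; rewrite scale0r.
exists (- lsubmx c), (rsubmx c 0 0 - e (v i)); split=> [z /key[h _]|].
  by rewrite mulNmx mxE; move: h; rewrite !eE; lra.
apply/seteqP; split=> [_ ->|z [/key[_ h]]] /=.
  split; first exact: conv_hull_vertex.
  by rewrite mulNmx mxE eE; ring.
by rewrite mulNmx mxE => hz; apply: h; move: hz; rewrite !eE; lra.
Qed.

Lemma conv_of_vertices d n (P : set 'cV[R]_d) (p : 'I_n -> 'cV[R]_d) : polytope P ->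
  (forall x, vertices P x <-> exists j, x = p j) -> P = conv_hull p.
Proof.
move=> [m [v ->]] hp; apply/seteqP; split=> x.
  move=> /polytope_vertices[I [[w [w0 wI w1 ->]] hI]].
  have pT z : (exists j, z = p j) -> conv_on p [set: 'I_n]%SET z.
    by move=> [j ->]; apply: conv_on_self; rewrite inE.
  have [i0 i0I] : exists i0, i0 \in I.
    apply: contrapT => h; move/eqP: w1; rewrite big1 ?(eq_sym 0) ?oner_eq0 // => i _.
    by apply: wI; apply/negP => iI; apply: h; exists i.
  apply: (@conv_on_hull _ _ _ [set: 'I_n]%SET).
  apply: (@conv_on_trans _ _ _ _ _ (fun l => if l \in I then v l else v i0)).
    exists w; split => //; apply: eq_bigr => l _.
    by case: (boolP (l \in I)) => // h; rewrite wI // !scale0r.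
  by move=> l; case: ifP => [/hI|_]; [move/hp/pT | apply/pT/hp/hI].
move=> px; apply: (@conv_on_hull _ _ _ [set: 'I_m]%SET).
apply: conv_on_trans px _ => j.
have : vertices (conv_hull v) (p j) by apply/hp; exists j.
by move/vertex_of_conv => [l <-]; apply: conv_on_self; rewrite inE.
Qed.

(** A face is the hull of the generators it contains, so there are finitely many facets. This rules
    out the default value in [xc]. *)
Lemma extension_self d (P : set 'cV[R]_d) : polytope P -> exists k, extension_of_size P k.
Proof.
move=> pP; have [m [v Pv]] := pP.
have fin : finite_set (facets P).
  apply: (@sub_finite_set _ _ ((fun I => conv_on v I) @` [set: {set 'I_m}])); last first.
    by apply: finite_image; exact: finite_finset.
  move=> F [[c [b [cb ->]]] _].
  exists [set i | (c *m v i) 0 0 == b]%SET => //; apply/seteqP; split=> x.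
    move=> [w [w0 wI w1 ->]]; split; first by rewrite Pv; exists w.
    rewrite mulmx_sumr summxE -[RHS]mul1r -w1 mulr_suml; apply: eq_bigr => i _.
    rewrite -scalemxAr mxE; have [->|wi] := eqVneq (w i) 0; first by rewrite !mul0r.
    have : i \in [set i | (c *m v i) 0 0 == b]%SET by apply: contraNT wi => /wI ->.
    by rewrite inE => /eqP ->.
  rewrite {1}Pv => -[[w [w0 w1 ex]] cx]; exists w; split => // i; rewrite inE => ci.
  have : \sum_i w i * (b - (c *m v i) 0 0) = 0.
    under eq_bigr do rewrite mulrBr; rewrite sumrB -mulr_suml w1 mul1r -cx ex mulmx_sumr summxE.
    by apply/eqP; rewrite subr_eq0; apply/eqP/eq_bigr => l _; rewrite -scalemxAr mxE.
  move/eqP; rewrite psumr_eq0 => [/allP/(_ i (mem_index_enum i))|l _]; last first.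
    by rewrite mulr_ge0 // subr_ge0 cb // Pv; exact: conv_hull_vertex.
  by rewrite mulf_eq0 subr_eq0 [b == _]eq_sym (negbTE ci) orbF => /eqP.
have /finite_setP[k Pk] := fin; exists k, d, P, 1%:M, 0; split => //.
by apply/seteqP; split=> x; [exists x | move=> [y Py <-]]; rewrite // mul1mx addr0.
Qed.

Lemma xc_geP d (P : set 'cV[R]_d) (b : R) : polytope P ->
  b <= (xc P)%:R <-> forall k, extension_of_size P k -> b <= k%:R.
Proof.
move=> /extension_self[k0 Pk0]; rewrite /xc; case: pselect => [ex|]; last first.
  by case; exists k0; apply/asboolP.
case: ex_minnP => k /asboolP Pk kmin; split=> [bk k' Pk'|]; last exact.
by apply: le_trans bk _; rewrite ler_nat; apply: kmin; apply/asboolP.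
Qed.

End Minkowski.

(** * Generic and rational polygons *)

Section RationalPolygons.
Context {R : realType}.
Local Open Scope classical_set_scope.

Lemma vertex_of_strict_max d n (p : 'I_n -> 'cV[R]_d) (c : 'rV[R]_d) j :
  (forall i, i != j -> (c *m p i) 0 0 < (c *m p j) 0 0) -> vertices (conv_hull p) (p j).
Proof.
move=> cmax; pose e i := (c *m p j) 0 0 - (c *m p i) 0 0.
have e_ge0 i : 0 <= e i.
  by rewrite subr_ge0; have [->//|/cmax/ltW] := eqVneq i j.
have combE (w : 'I_n -> R) : \sum_i w i = 1 ->
    (c *m p j) 0 0 - (c *m \sum_i w i *: p i) 0 0 = \sum_i w i * e i.
  move=> w1; under [RHS]eq_bigr do rewrite mulrBr.
  rewrite sumrB -mulr_suml w1 mul1r mulmx_sumr summxE; congr (_ - _).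
  by apply: eq_bigr => i _; rewrite -scalemxAr mxE.
exists c, ((c *m p j) 0 0); split=> [x [w [w0 w1 ->]]|].
  by rewrite -subr_ge0 combE //; apply: sumr_ge0 => i _; rewrite mulr_ge0.
apply/seteqP; split=> [_ ->|x [[w [w0 w1 ->]] hx]] /=.
  by split=> //; exact: conv_hull_vertex.
have := combE w w1; rewrite hx subrr => /esym/eqP.
rewrite psumr_eq0 => [/allP h|i _]; last by rewrite mulr_ge0.
have wi i : i != j -> w i = 0.
  move=> ij; have := h i (mem_index_enum i); rewrite mulf_eq0 => /orP[/eqP //|].
  by rewrite subr_eq0 eq_sym lt_eqF // cmax.
have wj : w j = 1 by rewrite -w1 (bigD1 j) //= big1 ?addr0 // => i /wi.
by rewrite (bigD1 j) //= wj scale1r big1 ?addr0 // => i /wi ->; rewrite scale0r.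
Qed.

Lemma ngon_of_vertices n (p : 'I_n -> 'cV[R]_2) : (3 <= n)%N -> injective p ->
  (forall j, vertices (conv_hull p) (p j)) -> ngon n (conv_hull p).
Proof.
move=> n3 pinj vp; split.
- by exists n, p.
- rewrite affdim_conv; suff -> : \rank (homs p) = 3%N by [].
  apply/eqP; rewrite -[_ == _]/(row_free (homs p)) -kermx_eq0.
  apply/rowV0P => g /sub_kermxP g0.
  have {}g0 j : (lsubmx g *m p j) 0 0 = - rsubmx g 0 0.
    apply/eqP; rewrite -addr_eq0 -mul_row_hom -row_mx_split -mul_homs g0.
    by rewrite mxE.
  have c0 : lsubmx g = 0.
    apply/eqP; apply: contraT => cN0.
    have := line_two_vertices (S := [set: 'I_n]%SET) cN0 pinj (fun j _ => conj (vp j) (g0 j)).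
    by rewrite cardsT card_ord leqNgt n3.
  have n0 : (0 < n)%N by exact: leq_trans n3.
  have b0 : rsubmx g 0 0 = 0.
    by have /eqP := g0 (Ordinal n0); rewrite c0 mul0mx mxE eq_sym oppr_eq0 => /eqP.
  rewrite (row_mx_split g) c0 b0.
  have -> : const_mx 0 = 0 :> 'rV[R]_1 by apply/matrixP => a z; rewrite !mxE.
  exact: row_mx0.
- rewrite card_eq_sym; apply/card_set_bijP.
  exists (fun l => if insub l is Some j then p j else 0); split.
  + by move=> l /= ln; rewrite insubT; exact: vp.
  + move=> l l' /set_mem/= ln /set_mem/= ln'; rewrite !insubT => /pinj e.
    by have := congr1 val e.
  + move=> x /vertex_of_conv[l <-].
    by exists l; rewrite /= ?valK.
Qed.

Lemma mul_row2_le (c : 'rV[R]_2) (x : 'cV[R]_2) delta :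
  (forall a, `|x a 0| <= delta) -> `|(c *m x) 0 0| <= (`|c 0 0| + `|c 0 1|) * delta.
Proof.
move=> hx; rewrite mulmx2E mulrDl; apply: le_trans (ler_normD _ _) _.
by rewrite !normrM lerD // ler_wpM2l.
Qed.

(** Every vertex is the strict maximiser of some functional, and finitely many strict inequalities
    survive a small perturbation. *)
Lemma vertices_stable n (p : 'I_n -> 'cV[R]_2) : injective p ->
  (forall j, vertices (conv_hull p) (p j)) ->
  exists2 delta, 0 < delta & forall p' : 'I_n -> 'cV[R]_2,
    (forall j a, `|p' j a 0 - p j a 0| <= delta) ->
    injective p' /\ forall j, vertices (conv_hull p') (p' j).
Proof.
move=> pinj vp.
have /boolp.choice[c hc] : forall j, exists c : 'rV[R]_2, forall i, i != j ->
    (c *m p i) 0 0 < (c *m p j) 0 0.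
  move=> j; have [c [d [cP e]]] := vp j; exists c => i ij.
  have [_ ej] : conv_hull p (p j) /\ (c *m p j) 0 0 = d.
    by have : [set p j] (p j) by []; rewrite e.
  rewrite ej lt_neqAle cP ?andbT; last exact: conv_hull_vertex.
  apply: contraNneq ij => ei; apply/eqP/pinj; have : [set p j] (p i); last by [].
  by rewrite e; split; [exact: conv_hull_vertex|].
pose C j := `|c j 0 0| + `|c j 0 1|.
have C0 j : 0 <= C j by rewrite addr_ge0.
(* Two values of the functional move by at most [2 * C * delta] in total, while the gap is at least
   [(4 * C + 1) * delta]. *)
have [delta d0 hd] := @small_multiple R _ (fun ij : 'I_n * 'I_n => ij.2 != ij.1)
  (fun ij => (c ij.1 *m p ij.1) 0 0 - (c ij.1 *m p ij.2) 0 0) (fun ij => 4 * C ij.1 + 1)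
  (fun ij h => etrans (subr_gt0 _ _) (hc _ _ h)).
exists delta => // p' hp'.
have cmax j i : i != j -> (c j *m p' i) 0 0 < (c j *m p' j) 0 0.
  move=> ij; have := hd (j, i) ij; rewrite /= ger0_norm; last by have := C0 j; lra.
  have cl l : `|(c j *m (p' l - p l)) 0 0| <= C j * delta.
    by apply: mul_row2_le => a; rewrite !mxE.
  have := cl i; have := cl j; rewrite !mulmxB_entry !ler_norml => /andP[h1 h2] /andP[h3 h4] h5.
  by have := C0 j; have := mulr_ge0 (C0 j) (ltW d0); nra.
split=> [j k ejk|j]; last exact: vertex_of_strict_max (cmax j).
apply/eqP; apply: contraT => jk; have := cmax k j jk.
by rewrite ejk ltxx.
Qed.

(** The point with the same weights differs by at most delta in each coordinate; 2 delta replaces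
    sqrt(2) delta. *)
Lemma dist_conv_le n (p p' : 'I_n -> 'cV[R]_2) delta x : 0 <= delta ->
  (forall j a, `|p' j a 0 - p j a 0| <= delta) -> conv_hull p x ->
  (dist_to_set x (conv_hull p') <= (2 * delta)%:E)%E.
Proof.
move=> d0 hp [w [w0 w1 ->]]; apply: ge_ereal_inf.
exists (eucl_dist (\sum_i w i *: p i) (\sum_i w i *: p' i))%:E.
  by exists (\sum_i w i *: p' i) => //; exists w.
rewrite lee_fin /eucl_dist.
have coord a : `|(\sum_i w i *: p i) a 0 - (\sum_i w i *: p' i) a 0| <= delta.
  rewrite !summxE -sumrB; apply: le_trans (ler_norm_sum _ _ _) _.
  rewrite -[delta]mul1r -w1 mulr_suml; apply: ler_sum => i _.
  by rewrite !mxE -mulrBr normrM ger0_norm // ler_wpM2l // distrC.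
rewrite -(ger0_norm (mulr_ge0 (ler0n R 2) d0)) -sqrtr_sqr ler_wsqrtr // sum2.
have sq a : ((\sum_i w i *: p i) a 0 - (\sum_i w i *: p' i) a 0) ^+ 2 <= delta ^+ 2.
  by rewrite -real_normK ?num_real // lerXn2r ?nnegrE.
have := sq 0; have := sq 1; have := sqr_ge0 delta.
have -> : (2 * delta) ^+ 2 = 4 * delta ^+ 2 by rewrite exprMn; congr (_ * _); rewrite -natrX.
by lra.
Qed.

Lemma hausdorff_conv_le n (p p' : 'I_n -> 'cV[R]_2) delta : 0 <= delta ->
  (forall j a, `|p' j a 0 - p j a 0| <= delta) ->
  (hausdorff_dist (conv_hull p) (conv_hull p') <= (2 * delta)%:E)%E.
Proof.
move=> d0 hp; rewrite /hausdorff_dist ge_max; apply/andP; split.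
  by apply: ge_ereal_sup => _ [x Px <-]; exact: dist_conv_le hp Px.
apply: ge_ereal_sup => _ [x Px <-]; apply: (dist_conv_le d0 _ Px) => j a.
by rewrite distrC.
Qed.

Lemma rational_ngon n (b : R) : (3 <= n)%N ->
  (forall k : nat, k%:R < b -> (k.+1 ^ 2 < 8 * n - 8)%N) -> rational_ngon_xc_ge n b.
Proof.
move=> n3 hb P [polyP _]; rewrite card_eq_sym => /card_set_bijP[f [fI finj fsurj]] eps eps0.
have n0 : (0 < n)%N by exact: leq_trans n3.
pose p (j : 'I_n) := f j.
have pinj : injective p.
  move=> j k e; apply: val_inj; apply: finj => //; exact/mem_set/ltn_ord.
have PE : P = conv_hull p.
  apply: conv_of_vertices => // x; split=> [/fsurj[l ln <-]|[j ->]].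
    by exists (Ordinal ln).
  by apply: fI; exact: ltn_ord.
have vp j : vertices (conv_hull p) (p j) by rewrite -PE; apply: fI; exact: ltn_ord.
have [delta d0 hd] := vertices_stable pinj vp.
have [F FN0 hF] := @small_vertices_thin R n n0.
(* Keeps all points vertices and the Hausdorff distance at most eps / 2. *)
pose eta := Num.min delta (eps / 4).
have eta0 : 0 < eta by rewrite lt_min d0 divr_gt0.
have [V [Vp FV]] := nonroot_rational (\matrix_(j, a) p j a 0) FN0 eta0.
pose W : 'M[R]_(n, 2) := map_mx ratr V.
have Wp j a : `|point W j a 0 - p j a 0| <= eta.
  by have := Vp j a; rewrite !mxE => /ltW.
have eta_delta : eta <= delta by rewrite ge_min lexx.
have eta_eps : eta <= eps / 4 by rewrite ge_min lexx orbT.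
have [winj vw] := hd (point W) (fun j a => le_trans (Wp j a) eta_delta).
have nW := ngon_of_vertices n3 winj vw.
exists (conv_hull (point W)); split=> //.
- by move=> x /vertex_of_conv[j <-] i; exists (V j i); rewrite !mxE.
- rewrite PE; apply: le_lt_trans (hausdorff_conv_le (ltW eta0) Wp) _.
  by rewrite lte_fin; lra.
- have [polyW _ _] := nW; apply/(xc_geP b polyW) => k Wk.
  rewrite leNgt; apply/negP => /hb kn; move/eqP: FV; apply; apply: hF.
  by exists (conv_hull (point W)), k; split=> // i; exact: vw.
Qed.

End RationalPolygons.

(** * Semialgebraicity and genericity of the bound *)

Section Genericity.
Context {R : realType}.
Local Open Scope classical_set_scope.

Definition read_mx o m k (e : seq R) : 'M[R]_(m, k) :=
  \matrix_(i, j) e`_(o + mxvec_index i j).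

Lemma read_mx_env m k (B : 'M[R]_(m, k)) s1 s2 :
  read_mx (size s1) m k (s1 ++ env B ++ s2) = B.
Proof.
apply/matrixP => i j; rewrite mxE -(mxvecE B); move: (mxvec_index i j) => l.
by rewrite nth_cat ltnNge leq_addr addKn nth_cat size_env ltn_ord nth_env.
Qed.

Definition polymx m k (M : seq R -> 'M[R]_(m, k)) := forall i j, polyfun (fun e => M e i j).

Lemma polymx_read o m k : polymx (read_mx o m k).
Proof. by move=> i j; exists (GRing.Var R (o + mxvec_index i j)) => // e; rewrite mxE. Qed.

Lemma polymxM m p k (M : seq R -> 'M[R]_(m, p)) (N : seq R -> 'M[R]_(p, k)) :
  polymx M -> polymx N -> polymx (fun e => M e *m N e).
Proof.
move=> pM pN i j; have [t rt ht] := polyfun_sum (fun l => polyfunM (pM i l) (pN l j)).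
by exists t => // e; rewrite ht mxE.
Qed.

Lemma polymx_tr m k (M : seq R -> 'M[R]_(m, k)) : polymx M -> polymx (fun e => (M e)^T).
Proof. by move=> pM i j; have [t rt ht] := pM j i; exists t => // e; rewrite ht mxE. Qed.

Lemma definable_imply (c : bool) S : definable S -> @definable R (fun e => c -> S e).
Proof.
move=> [f rf fS]; case: c; first by exists f => // e; rewrite fS; split=> // h; exact: h.
by exists (ordered_qelim.ord.Bool true).
Qed.

Lemma definable_realizes n T (A V : seq R -> 'M[R]_(n, 2)) : polymx A -> polymx V ->
  definable (fun e => realizes T (A e) (V e)).
Proof.
move=> pA pV; have pAV := polymxM pA (polymx_tr pV).
apply: definable_forall => i; apply: definable_forall => j.
apply: definableI; apply: definable_imply.
  by apply: definable_eq; [exact: pAV | exact: polyfun_cst].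
by apply: definable_lt; [exact: pAV | exact: polyfun_cst].
Qed.

Lemma semialgebraic_realizes n T :
  semialgebraic [set A : 'M[R]_(n, 2) | exists V, realizes T A V].
Proof.
have def := definable_realizes T (@polymx_read 0 n 2) (@polymx_read (n * 2) n 2).
apply: semialgebraic_ext (semialgebraic_projection n 2 (n * 2) def) => A.
have rA s : read_mx 0 n 2 (env A ++ s) = A by exact: (read_mx_env A [::]).
split=> [[s [_ h]]|[V hV]].
  by exists (read_mx (n * 2) n 2 (env A ++ s)); move: h; rewrite /= rA.
exists (env V); split; first exact: size_env.
by rewrite rA -[env V]cats0 -(size_env A) read_mx_env.
Qed.

Lemma semialgebraic_slack_factor n k T :
  semialgebraic [set A : 'M[R]_(n, 2) | exists2 V, realizes T A V & slack_factor k A V].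
Proof.
pose A_ := read_mx 0 n 2; pose V_ := read_mx (n * 2) n 2.
pose F_ := read_mx (n * 2 + n * 2) n k; pose G_ := read_mx (n * 2 + n * 2 + n * k) k n.
have pA : polymx A_ by exact: polymx_read.
have pV : polymx V_ by exact: polymx_read.
have pF : polymx F_ by exact: polymx_read.
have pG : polymx G_ by exact: polymx_read.
have pAV := polymxM pA (polymx_tr pV); have pFG := polymxM pF pG.
pose S e := realizes T (A_ e) (V_ e) /\ ((forall i a, 0 <= F_ e i a) /\
  ((forall a j, 0 <= G_ e a j) /\
  forall i j, (A_ e *m (V_ e)^T) i j + (F_ e *m G_ e) i j = 1)).
have def : definable S.
  apply: definableI; first exact: definable_realizes.
  apply: definableI.
    by do 2!apply: definable_forall => ?; apply: definable_le; [exact: polyfun_cst | exact: pF].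
  apply: definableI.
    by do 2!apply: definable_forall => ?; apply: definable_le; [exact: polyfun_cst | exact: pG].
  do 2!apply: definable_forall => ?.
  by apply: definable_eq; [apply: polyfunD; [exact: pAV | exact: pFG] | exact: polyfun_cst].
apply: semialgebraic_ext (semialgebraic_projection n 2 (n * 2 + (n * k + k * n)) def) => A.
have rA s : A_ (env A ++ s) = A by exact: (read_mx_env A [::]).
split=> [[s [_]]|[V rV [F [G [F0 G0 FG]]]]].
  rewrite /S rA => -[rV [F0 [G0 FG]]]; exists (V_ (env A ++ s)) => //.
  exists (F_ (env A ++ s)), (G_ (env A ++ s)); split=> // i j.
  by rewrite -(FG i j) addrC addKr.
exists (env V ++ env F ++ env G); split; first by rewrite !size_cat !size_env.
have rV' : V_ (env A ++ env V ++ env F ++ env G) = V.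
  by rewrite /V_ -(size_env A) read_mx_env.
have rF : F_ (env A ++ env V ++ env F ++ env G) = F.
  have -> : F_ = read_mx (size (env A ++ env V)) n k by rewrite size_cat !size_env.
  by rewrite catA read_mx_env.
have rG : G_ (env A ++ env V ++ env F ++ env G) = G.
  have -> : G_ = read_mx (size ((env A ++ env V) ++ env F)) k n.
    by rewrite !size_cat !size_env.
  have := read_mx_env G ((env A ++ env V) ++ env F) [::].
  by rewrite cats0 -!catA.
rewrite /S rA rV' rF rG; do 3!split=> //.
by move=> i j; rewrite -FG addrC subrK.
Qed.

(** An n-gon violates the bound when some size k < b admits a nonnegative factorization of its slack
    matrix. The bound [N] makes these sizes finitely many, so the set is a projection minus a finite
    union of projections. *)
Lemma semialgebraic_ngons_xc_ge n (b : R) N : (0 < n)%N ->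
  (forall k : nat, k%:R < b -> (k < N)%N) -> semialgebraic (@ngons_xc_ge R n b).
Proof.
move=> n0 hb; pose C := {ffun 'I_n -> {set 'I_n}}.
pose S1 : set 'M[R]_(n, 2) := [set A | exists T : C, edge_config T /\ exists V, realizes T A V].
pose S2 : set 'M[R]_(n, 2) := [set A | exists T : C, exists k : 'I_N,
  (edge_config T /\ k%:R < b) /\ exists2 V, realizes T A V & slack_factor k A V].
have s1 : semialgebraic S1.
  apply: semialgebraic_exists => T; apply: (semialgebraic_setI (S := [set _ | edge_config T])).
    exact: semialgebraic_const.
  exact: semialgebraic_realizes.
have s2 : semialgebraic S2.
  apply: semialgebraic_exists => T; apply: semialgebraic_exists => k.
  apply: (semialgebraic_setI (S := [set _ | edge_config T /\ k%:R < b])).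
    exact: semialgebraic_const.
  exact: semialgebraic_slack_factor.
apply: semialgebraic_ext (semialgebraic_setI s1 (semialgebraic_setC s2)) => A; split.
  move=> [[T [cT [V rT]]] nS2]; have nA := ngon_of_config n0 cT rT; split=> //.
  have [pA _ _] := nA; apply/(xc_geP b pA) => k Ak; rewrite leNgt; apply/negP => kb.
  apply: nS2; exists T, (Ordinal (hb k kb)); split=> //; exists V => //.
  exact: slack_factor_of_extension cT rT _ Ak.
move=> [nA hA]; have [T [V [cT rT]]] := config_of_ngon nA; split.
  by exists T; split=> //; exists V.
move=> [T' [k [[cT' kb] [V' rT' sf]]]].
have [k' k'k Ak'] := extension_of_slack_factor n0 cT' rT' sf.
have [pA _ _] := nA; have := (xc_geP b pA).1 hA k' Ak'.
by apply/negP; rewrite -ltNge (le_lt_trans _ kb) // ler_nat.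
Qed.

Lemma small_edges_of_extension n (A : 'M[R]_(n, 2)) k : ngon_space n A ->
  extension_of_size (poly_of A) k -> (k.+1 ^ 2 < 8 * n - 8)%N -> small_edges A.
Proof.
move=> /config_of_ngon[T [V [cT rT]]] Ak kn.
have vV := realizes_vertices cT rT.
exists V; first by exists (poly_of A), k.
have /boolp.choice[e he] : forall i, exists e : 'I_n * 'I_n,
    [/\ e.1 != e.2, i \in T e.1 & i \in T e.2].
  move=> i; have [_ d2 _] := cT; have /cards2P[j [j' [jj' E]]] := introT eqP (d2 i).
  have h l : (i \in T l) = (l \in [set j; j']%SET) by rewrite -E inE.
  by exists (j, j'); rewrite !h finset.set21 finset.set22.
exists (fst \o e), (snd \o e) => i /=; have [ee i1 i2] := he i.
split; last 2 first.
- by have [h _] := rT i (e i).1; exact: h.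
- by have [h _] := rT i (e i).2; exact: h.
apply: contra ee => /eqP E; apply/eqP/(point_inj cT rT).
by rewrite /point E.
Qed.

Lemma near_matrix m k (A : 'M[R]_(m, k)) (U : set 'M[R]_(m, k)) : nbhs A U ->
  exists2 eps, 0 < eps & forall B : 'M[R]_(m, k), (forall i j, `|B i j - A i j| < eps) -> U B.
Proof.
move=> /nbhs_ballP[eps eps0 AU]; exists eps => // B AB; apply: AU; split=> // i j.
by rewrite /ball /= distrC; exact: AB.
Qed.

(** The n-gons off the hypersurface containing [X] form an open set that satisfies the bound; as
    nonroots are dense, it is nonempty and dense in the open space of n-gons. *)
Lemma generic_of_thin n (b : R) (X : 'M[R]_(n, 2) -> Prop) : (3 <= n)%N -> thin X ->
  semialgebraic (@ngons_xc_ge R n b) ->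
  (forall A, ngon_space n A -> ~ X A -> b <= (xc (poly_of A))%:R) ->
  generic_ngon_xc_ge n b.
Proof.
move=> n3 thX sa hX; have n0 : (0 < n)%N by exact: leq_trans n3.
have [F FN0 hF] := thX.
have near (A : 'M[R]_(n, 2)) (U : set 'M[R]_(n, 2)) :
    nbhs A U -> exists2 B, U B & eval_mx F B != 0.
  move=> /near_matrix[eps eps0 AU]; have [B [AB FB]] := nonroot_rational A FN0 eps0.
  by exists (map_mx ratr B) => //; apply: AU => i j; rewrite mxE.
have sub : ngon_space n `&` [set A | eval_mx F A != 0] `<=` @ngons_xc_ge R n b.
  by move=> A [nA /eqP FA]; split=> //; apply: hX => // /hF.
split=> //.
- have [A nA] := @ngon_space_nonempty R n n3.
  have [B nB FB] := near A _ (open_nbhs_nbhs (conj (@ngon_space_open R n n0) nA)).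
  exists B; apply: (interiorS sub); apply: open_nbhs_nbhs; split=> //.
  apply: openI; first exact: ngon_space_open.
  have -> : [set A | eval_mx F A != 0] = ~` [set A | eval_mx F A = 0].
    by apply/seteqP; split=> C /= /eqP.
  exact/closed_openC/eval_mx_closed.
- move=> A nA U AU.
  have [B [nB UB] FB] := near A _ (filterI (open_nbhs_nbhs (conj (@ngon_space_open R n n0) nA)) AU).
  by exists B; split=> //; exact: sub.
- move=> mu ac ae; have mk0 : (0 < n * 2)%N by rewrite muln_gt0 n0.
  apply: negligibleS (negligibleU ae (thin_negligible mk0 ac thX)) => A /= nb.
  have [nA|] := pselect (ngon_space n (A : 'M[R]_(n, 2))); last by left.
  by right=> nXA; apply: nb; exact: hX.
Qed.

Lemma generic_ngon n (b : R) : (3 <= n)%N ->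
  (forall k : nat, k%:R < b -> (k.+1 ^ 2 < 8 * n - 8)%N) -> generic_ngon_xc_ge n b.
Proof.
move=> n3 hb; have n0 : (0 < n)%N by exact: leq_trans n3.
apply: (generic_of_thin n3 (small_edges_thin n0)).
  by apply: (@semialgebraic_ngons_xc_ge _ _ (8 * n)) => // k /hb; nia.
move=> A nA sA; have [pA _ _] := nA; apply/(xc_geP b pA) => k Ak.
by rewrite leNgt; apply/negP => /hb kn; apply: sA; exact: small_edges_of_extension Ak kn.
Qed.

Lemma lt_bound n k : (3 <= n)%N ->
  k%:R < 2 * Num.sqrt (2 * n%:R - 2) - 1 :> R -> (k.+1 ^ 2 < 8 * n - 8)%N.
Proof.
move=> n3; have n3R : 3 <= n%:R :> R by rewrite (ler_nat R 3).
rewrite -(ltr_nat R) natrX natrB ?natrM; last by lia.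
have := sqr_sqrtr (_ : 0 <= 2 * n%:R - 2 :> R) => /(_ ltac:(lra)).
have := sqrtr_ge0 (2 * n%:R - 2 : R); have := ler0n R k.
by rewrite -natr1; move: (Num.sqrt _) => s; nra.
Qed.

End Genericity.

Theorem corollary20 (R : realType) (n : nat) (n_ge3 : (3 <= n)%N) :
  generic_ngon_xc_ge n (2 * Num.sqrt (2 * n%:R - 2) - 1 : R) /\
  rational_ngon_xc_ge n (2 * Num.sqrt (2 * n%:R - 2) - 1 : R).
Proof.
by split; [apply: generic_ngon | apply: rational_ngon] => // k; exact: lt_bound.
Qed.
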